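(* Let $G'$ be a rational semigroup which contains two polynomials $f$ and $g$ of degree greater than or equal to two. If $J_f\neq J_g$, then $E(G')=\overline{\mathbb C}$.
   Context: $\overline{\mathbb C}$ is the Riemann sphere with the spherical metric; polynomials (with complex coefficients) are regarded as rational maps $\overline{\mathbb C}\to\overline{\mathbb C}$. A rational semigroup is a semigroup, under composition, of rational functions of degree at least two on $\overline{\mathbb C}$. For a rational function $h$ of degree at least two, $J_h$ is its Julia set: the complement in $\overline{\mathbb C}$ of the set of points having a neighborhood on which the family of iterates $\{h^n:n\ge1\}$ is normal. A set $X\subset\overline{\mathbb C}$ is completely invariant under $h$ if $h(X)\subset X$ and $h^{-1}(X)\subset X$. For a rational semigroup $G$, $$E(G)=\bigcap\{S\subset\overline{\mathbb C}: S\text{ is closed, completely invariant under each } g\in G,\ \#(S)\ge 3\},$$ where $\#(S)$ is the cardinality of $S$. *)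

(* Defs.v *)
From HB Require Import structures.
From mathcomp Require Import all_boot all_order all_algebra.
From mathcomp Require Import all_classical all_reals all_analysis.
From mathcomp Require Import complex ring lra.

Set Implicit Arguments.
Unset Strict Implicit.
Unset Printing Implicit Defensive.

Import Order.TTheory GRing.Theory Num.Theory.
Import numFieldNormedType.Exports.

Local Open Scope classical_set_scope.
Local Open Scope ring_scope.
Local Open Scope complex_scope.

(** [Some z] is the finite point [z], [None] is the point at infinity. *)
Definition sphere (R : realType) : Type := option R[i].

HB.instance Definition _ (R : realType) := Choice.copy (sphere R) (option R[i]).

Section SphericalMetric.
Variable R : realType.
Implicit Types (z w : R[i]) (x y t : sphere R).

Local Notation modulus := (@ComplexField.Normc.normc R).

(** Euclidean distance in [R^3] between the stereographic projections of [x]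
    and [y] on the unit sphere. *)
Definition chordal x y : R :=
  match x, y with
  | Some z, Some w =>
      2 * modulus (z - w) /
      (Num.sqrt (1 + modulus z ^+ 2) * Num.sqrt (1 + modulus w ^+ 2))
  | Some z, None | None, Some z => 2 / Num.sqrt (1 + modulus z ^+ 2)
  | None, None => 0
  end.

(** Length of the great-circle arc subtended by the chord, i.e. the geodesic
    distance of the Riemannian metric [2 |dz| / (1 + |z|^2)]. *)
Definition spherical x y : R := 2 * asin (chordal x y / 2).

(** Unit vectors of [C^2] representing the points of the projective line. *)
Let nrm z : R := Num.sqrt (1 + modulus z ^+ 2).
Let c1 x : R[i] := if x is Some z then z * (nrm z)^-1%:C else 1.
Let c2 x : R[i] := if x is Some z then (nrm z)^-1%:C else 0.
Let wedge x y := c1 x * c2 y - c2 x * c1 y.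
Let inner x y := c1 x * (c1 y)^*%C + c2 x * (c2 y)^*%C.

Let nrm_gt0 z : 0 < nrm z.
Proof. by rewrite sqrtr_gt0 ltr_pwDl// sqr_ge0. Qed.

Let modulus_ge0 z : 0 <= modulus z.
Proof. by case: z => a b; rewrite sqrtr_ge0. Qed.

Let modulusM z w : modulus (z * w) = modulus z * modulus w.
Proof. exact: ComplexField.Normc.normcM. Qed.

Let modulusC (r : R) : modulus r%:C = `|r|.
Proof. by rewrite /= expr0n /= addr0 sqrtr_sqr. Qed.

Let modulusE z : (modulus z ^+ 2)%:C = z * z^*%C.
Proof. by rewrite -sqr_normc rmorphXn. Qed.

Let modulusN z : modulus (- z) = modulus z.
Proof. exact: normcN. Qed.

Let modulusJ z : modulus z^*%C = modulus z.
Proof. by case: z => a b; rewrite /= sqrrN. Qed.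

Let conjC_real (r : R) : (r%:C)^*%C = r%:C.
Proof. by rewrite /= oppr0. Qed.

Let conjM z w : (z * w)^*%C = z^*%C * w^*%C.
Proof. exact: rmorphM. Qed.

Let conjD z w : (z + w)^*%C = z^*%C + w^*%C.
Proof. exact: rmorphD. Qed.

Let conjB z w : (z - w)^*%C = z^*%C - w^*%C.
Proof. exact: rmorphB. Qed.

Let real_complex_inj (r s : R) : r%:C = s%:C -> r = s.
Proof. by case. Qed.

Let nrm_unit z : (nrm z)^-1%:C * (nrm z)^-1%:C * (1 + z * z^*%C) = 1.
Proof.
rewrite -modulusE -(rmorph1 (real_complex R)) -!rmorphM -rmorphD -rmorphM /=.
congr (_%:C); rewrite -[1 + _]sqr_sqrtr ?addr_ge0 ?sqr_ge0// -/(nrm z) expr2.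
by rewrite mulrACA mulVf ?mul1r// gt_eqF.
Qed.

Let innerxx x : inner x x = 1.
Proof.
case: x => [z|]; rewrite /inner /c1 /c2; last first.
  by rewrite !rmorph1 rmorph0 mulr0 mulr1 addr0.
by rewrite conjM !conjC_real -(nrm_unit z); ring.
Qed.

Let inner_conj x y : modulus (inner x y) = modulus (inner y x).
Proof.
rewrite -modulusJ /inner conjD !conjM !conjcK; congr modulus.
by rewrite mulrC [X in _ + X]mulrC.
Qed.

Let wedgeN x y : wedge x y = - wedge y x.
Proof. by rewrite /wedge; ring. Qed.

Let lagrange x y : modulus (inner x y) ^+ 2 + modulus (wedge x y) ^+ 2 = 1.
Proof.
apply: real_complex_inj.
transitivity ((modulus (inner x y) ^+ 2)%:C + (modulus (wedge x y) ^+ 2)%:C).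
  exact: rmorphD.
rewrite !modulusE.
have := innerxx x; have := innerxx y.
rewrite /inner /wedge !(conjB, conjD, conjM) !conjcK.
move=> hy hx; rewrite [RHS](_ : _ = 1 * 1); last by rewrite mulr1.
by rewrite -{1}hx -hy; ring.
Qed.

Let wedge_split x t y :
  modulus (wedge x y) <=
  modulus (wedge x t) * modulus (inner y t) +
  modulus (wedge t y) * modulus (inner x t).
Proof.
rewrite -!modulusM (_ : wedge x y =
  wedge x t * inner y t + wedge t y * inner x t); first exact: le_normcD.
by rewrite -[LHS]mulr1 -(innerxx t) /wedge /inner; ring.
Qed.

Let chordal_wedge x y : chordal x y / 2 = modulus (wedge x y).
Proof.
have nV z : modulus (nrm z)^-1%:C = (nrm z)^-1.
  by rewrite modulusC gtr0_norm ?invr_gt0.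
case: x y => [z|] [w|]; rewrite /chordal /wedge /c1 /c2.
- rewrite -/(nrm z) -/(nrm w) [X in _ = modulus X](_ : _ =
      (z - w) * (nrm z)^-1%:C * (nrm w)^-1%:C); last by ring.
  by rewrite !modulusM !nV; field; rewrite !gt_eqF//.
- rewrite -/(nrm z) mulr0 mulr1 sub0r modulusN nV.
  by field; rewrite gt_eqF.
- rewrite -/(nrm w) mul0r mul1r subr0 nV.
  by field; rewrite gt_eqF.
- by rewrite mul0r mulr0 mul0r subr0 ComplexField.Normc.normc0.
Qed.

Let angle x y := asin (modulus (wedge x y)).

Let wedge_itv x y : -1 <= modulus (wedge x y) <= 1.
Proof.
rewrite (le_trans _ (modulus_ge0 _)) ?lerN10//=.
rewrite -(@ler_pXn2r _ 2) ?nnegrE//.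
by rewrite expr1n -(lagrange x y) lerDr sqr_ge0.
Qed.

Let sin_angle x y : sin (angle x y) = modulus (wedge x y).
Proof. by rewrite asinK// in_itv/= wedge_itv. Qed.

Let cos_angle x y : cos (angle x y) = modulus (inner x y).
Proof.
by rewrite cos_asin ?wedge_itv// -(lagrange x y) addrK sqrtr_sqr ger0_norm.
Qed.

Let angle_itv x y : 0 <= angle x y <= pi / 2.
Proof.
rewrite asin_lepi2 ?wedge_itv// andbT leNgt; apply/negP => a0.
have : sin (angle x y) < 0.
  rewrite -oppr_gt0 -sinN sin_gt0_pi// oppr_gt0 a0/=.
  rewrite ltrNl (lt_le_trans _ (asin_geNpi2 (wedge_itv x y)))// ltrN2.
  by rewrite ltr_pdivrMr// ltr_pMr ?pi_gt0// ltr1n.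
by rewrite sin_angle ltNge modulus_ge0.
Qed.

Let sphericalE x y : spherical x y = 2 * angle x y.
Proof. by rewrite /spherical chordal_wedge. Qed.

Lemma sphericalxx x : spherical x x = 0.
Proof.
rewrite sphericalE /angle /wedge [c2 x * _]mulrC subrr.
rewrite ComplexField.Normc.normc0 -(@sin0 R) sinK ?sin0 ?mulr0//.
by have p0 := pi_gt0 R; rewrite in_itv/=; apply/andP; split; lra.
Qed.

Lemma spherical_sym x y : spherical x y = spherical y x.
Proof. by rewrite !sphericalE /angle wedgeN modulusN. Qed.

Lemma spherical_eq0 x y : spherical x y = 0 -> x = y.
Proof.
rewrite sphericalE => /eqP; rewrite mulf_eq0 pnatr_eq0/= => /eqP a0.
have := sin_angle x y; rewrite a0 sin0 -chordal_wedge => /esym/eqP.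
rewrite mulf_eq0 invr_eq0 pnatr_eq0 orbF.
case: x y {a0} => [z|] [w|] //; rewrite /chordal; last 2 first.
- by rewrite mulf_eq0 invr_eq0 pnatr_eq0 (gt_eqF (nrm_gt0 z)).
- by rewrite mulf_eq0 invr_eq0 pnatr_eq0 (gt_eqF (nrm_gt0 w)).
rewrite !mulf_eq0 invr_eq0 mulf_eq0 pnatr_eq0.
rewrite (gt_eqF (nrm_gt0 z)) (gt_eqF (nrm_gt0 w)) !orbF.
by move=> /eqP/ComplexField.Normc.eq0_normc/eqP; rewrite subr_eq0 => /eqP ->.
Qed.

Lemma spherical_triangle t x y :
  spherical x y <= spherical x t + spherical t y.
Proof.
rewrite !sphericalE -mulrDr ler_pM2l//.
have /andP[xt0 xtp] := angle_itv x t.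
have /andP[ty0 typ] := angle_itv t y.
have /andP[xy0 xyp] := angle_itv x y.
have [s|/ltW/(le_trans xyp)//] := leP (angle x t + angle t y) (pi / 2).
rewrite leNgt; apply/negP => lt_xy.
have : sin (angle x t + angle t y) < sin (angle x y).
  have p0 := pi_gt0 R.
  by rewrite ltr_sin// in_itv/=; apply/andP; split; lra.
rewrite sinD !sin_angle !cos_angle ltNge => /negP; apply.
rewrite (le_trans (wedge_split x t y))// (inner_conj y t).
by rewrite [X in _ + X <= _]mulrC.
Qed.

HB.instance Definition _ := isMetric.Build R (sphere R)
  sphericalxx spherical_eq0 spherical_sym spherical_triangle.

End SphericalMetric.

Section RationalMaps.
Variable R : realType.
Implicit Types (p q : {poly R[i]}) (h g : sphere R -> sphere R).

(** The map of the sphere induced by [p / q] for coprime [p] and [q]. Finite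
    poles are sent to infinity, and the value at infinity is read off the
    coefficients of degree [max (deg p) (deg q)]. *)
Definition ratmap p q (x : sphere R) : sphere R :=
  let d := (maxn (size p) (size q)).-1 in
  let: (a, b) := if x is Some z then (p.[z], q.[z]) else (p`_d, q`_d) in
  if b == 0 then None else Some (a / b).

Definition polymap p : sphere R -> sphere R := ratmap p 1.

Definition rational_of_degree (d : nat) h : Prop :=
  exists p q, [/\ q != 0, coprimep p q,
    (maxn (size p) (size q)).-1 = d & h = ratmap p q].

Definition rational_semigroup (G : set (sphere R -> sphere R)) : Prop :=
  (forall h, G h -> exists2 d, (2 <= d)%N & rational_of_degree d h) /\
  (forall h g, G h -> G g -> G (h \o g)).

(** Normality on the open set [U]: every sequence in [F] has a subsequence
    converging, for the spherical metric, uniformly on the compact subsets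
    of [U]. *)
Definition normal_on (U : set (sphere R)) (F : set (sphere R -> sphere R)) :
    Prop :=
  forall u : nat -> sphere R -> sphere R, (forall k, F (u k)) ->
  exists phi : nat -> nat, {homo phi : m n / (m < n)%N} /\
  exists l : sphere R -> sphere R,
    {family [set K | compact K /\ K `<=` U], (u \o phi) @ \oo --> l}.

Definition iterates h : set (sphere R -> sphere R) :=
  [set iter n h | n in [set n | (1 <= n)%N]].

Definition fatou h : set (sphere R) :=
  [set x | exists U, [/\ open U, U x & normal_on U (iterates h)]].

Definition julia h : set (sphere R) := ~` fatou h.

Definition completely_invariant h (X : set (sphere R)) : Prop :=
  h @` X `<=` X /\ h @^-1` X `<=` X.

(** The condition [`I_3 #<= S] says that [S] has at least three points. *)
Definition E_set (G : set (sphere R -> sphere R)) : set (sphere R) :=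
  \bigcap_(S in [set S : set (sphere R) | [/\ closed S,
      forall g, G g -> completely_invariant g S & (`I_3 #<= S)%card]]) S.

End RationalMaps.

(* Main.v *)
Require Import Defs.
From mathcomp Require Import all_boot all_order all_algebra.
From mathcomp Require Import all_classical all_reals all_analysis.
From mathcomp Require Import complex ring lra.
Set Implicit Arguments.
Unset Strict Implicit.
Unset Printing Implicit Defensive.
Import Order.TTheory GRing.Theory Num.Theory.
Import numFieldNormedType.Exports.
Local Open Scope classical_set_scope.
Local Open Scope ring_scope.
Local Open Scope complex_scope.

(** Let [S] be a closed set with at least three points which is completely
    invariant under [f] and [g], and suppose that [S] is not the whole sphere.
    The filled Julia sets [K_f], [K_g] (points with bounded orbits) are then
    equal, and so are the Julia sets, their boundaries ([juliaP]). By symmetry it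
    is enough to show that [K_f] is contained in [K_g]. Let [T] be the finite part
    of [S]; it has two points, and [T] and its complement are both invariant and
    backward invariant under [f] and [g].

    All estimates are for polynomials written as products over their roots. Two
    of them replace the theory of harmonic functions. First, a polynomial takes
    every value close to [p y] near [y] ([poly_open_map]), whence a maximum
    principle. Second, if [p] has no zeros on a disc, the mean of [ln |p|] over
    the [m] points [w + r v] with [r^m = 1] is [ln |p w|], up to an error that is
    exponentially small in [m] ([sampled_mean_value]): the product of the
    [w + r v - a] is [(w - a)^m - v^m], up to sign.

    Suppose that [T] or its complement is bounded, and call it [T] again. It is
    infinite, and [f^n - s] has all its roots in [T] when [s] is in [T]. The mean
    value property shows that a disc which misses [T] and contains a point of
    [K_f] is contained in [K_f] ([filled_disc]): this takes the place of Montel's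
    theorem. So the boundary of [K_f] lies in the closure of [T], where the
    iterates of [g] are bounded. By the maximum principle they are bounded on
    [K_f] ([filled_sub_bounded]).

    Suppose now that [T] and its complement are unbounded, and let [G] be the
    escape rate of [f], so that [G (f z) = d G z] and [K_f] is the set of zeros of
    [G]. The mean value property for [f^n - f^n z] shows that near infinity [T] is
    a union of levels of [G] ([green_saturated]): the level curve of [z] is the
    limit set of the roots of [f^n - f^n z], because [max G (G z)] is not harmonic
    there. Let [P] be a polynomial with [P^-1 T = T]. On a level curve in the
    boundary of [T] the function [G o P] is constant: otherwise, by connectedness
    of the level curves, it would take the same value on levels inside and outside
    [T] ([boundary_level_const]). Since [G z = ln |z| + c + O(1/|z|)], it follows
    that [ln |P / Q|] is almost constant on such curves if [Q] is another such
    polynomial of the same degree, and this forces [P = l Q + m] with constants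
    [l] and [m] ([same_degree_affine]). The map [y |-> l y + m] then preserves [T].
    If [|l|] were not [1], its conjugates by the [f^n] would move the levels of [G]
    by arbitrarily small steps, and [T] would contain a neighborhood of infinity.
    Finally [m] is bounded, since an affine map preserving [T] permutes the
    critical points of [f].

    All this applies to [P = f^n o g] and [Q = g o f^n]. If [c] is in [K_f], then
    [g (f^n c)] is bounded, hence so is [f^n (g c)], so that [g] maps the bounded
    set [K_f] into itself, and [K_f] is contained in [K_g]
    ([filled_sub_unbounded]). *)

Local Notation abs := (@ComplexField.Normc.normc _).
#[local] Arguments ComplexField.Normc.normc : simpl never.

(** * Modulus of complex numbers, and first estimates for polynomials *)

Section Modulus.
Variable R : realType.
Implicit Types z w : R[i].

Lemma abs_ge0 z : 0 <= abs z.
Proof. by case: z => a b; rewrite sqrtr_ge0. Qed.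

Lemma abs0 : abs (0 : R[i]) = 0.
Proof. exact: ComplexField.Normc.normc0. Qed.

Lemma abs1 : abs (1 : R[i]) = 1.
Proof. exact: ComplexField.Normc.normc1. Qed.

Lemma absM z w : abs (z * w) = abs z * abs w.
Proof. exact: ComplexField.Normc.normcM. Qed.

Lemma absN z : abs (- z) = abs z.
Proof. exact: normcN. Qed.

Lemma absC z w : abs (z - w) = abs (w - z).
Proof. by rewrite -absN opprB. Qed.

Lemma absV z : abs z^-1 = (abs z)^-1.
Proof. exact: ComplexField.Normc.normcV. Qed.

Lemma abs_eq0 z : (abs z == 0) = (z == 0).
Proof.
by apply/eqP/eqP => [/ComplexField.Normc.eq0_normc//|->]; rewrite abs0.
Qed.

Lemma abs_gt0 z : (0 < abs z) = (z != 0).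
Proof. by rewrite lt_neqAle abs_ge0 andbT eq_sym abs_eq0. Qed.

Lemma absX z n : abs (z ^+ n) = abs z ^+ n.
Proof. by elim: n => [|n ih]; rewrite ?expr0 ?abs1// !exprS absM ih. Qed.

Lemma abs_real (r : R) : abs r%:C = `|r|.
Proof.
by rewrite /ComplexField.Normc.normc /= expr0n /= addr0 sqrtr_sqr.
Qed.

Lemma abs_scale (r : R) z : abs (r%:C * z) = `|r| * abs z.
Proof. by rewrite absM abs_real. Qed.

Lemma absD z w : abs (z + w) <= abs z + abs w.
Proof. exact: le_normcD. Qed.

Lemma absB z w : abs z - abs w <= abs (z - w).
Proof. by rewrite lerBlDr -{1}(subrK w z) absD. Qed.

Lemma absBD z w : abs (z - w) <= abs z + abs w.
Proof. by rewrite -(absN w) absD. Qed.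

Lemma abs_dist_tri y z w : abs (z - w) <= abs (z - y) + abs (y - w).
Proof. by rewrite (_ : z - w = (z - y) + (y - w)) ?absD//; ring. Qed.

Lemma abs_prod (I : Type) (s : seq I) (F : I -> R[i]) :
  abs (\prod_(i <- s) F i) = \prod_(i <- s) abs (F i).
Proof. by apply: (big_morph _ absM); rewrite abs1. Qed.

Lemma abs_rootn n z : (0 < n)%N -> abs z = 1 -> exists2 u, abs u = 1 & u ^+ n = z.
Proof.
move=> n0 z1.
have /closed_rootP [u]: size ('X^n - z%:P) != 1.
  by rewrite size_XnsubC// eqSS -lt0n.
rewrite /root !hornerE subr_eq0 => /eqP uz; exists u => //.
apply/eqP; rewrite -(@pexpr_eq1 _ _ n) ?abs_ge0//.
by rewrite -absX uz z1.
Qed.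

Lemma abs_Re z : `|complex.Re z| <= abs z.
Proof.
case: z => a b; rewrite /ComplexField.Normc.normc /= -sqrtr_sqr.
by rewrite ler_wsqrtr// lerDl sqr_ge0.
Qed.

Lemma abs_Im z : `|complex.Im z| <= abs z.
Proof.
case: z => a b; rewrite /ComplexField.Normc.normc /= -sqrtr_sqr.
by rewrite ler_wsqrtr// lerDr sqr_ge0.
Qed.

Lemma abs_ReIm z : abs z <= `|complex.Re z| + `|complex.Im z|.
Proof.
case: z => a b; rewrite /ComplexField.Normc.normc /=.
rewrite -[leRHS]ger0_norm ?addr_ge0// -sqrtr_sqr ler_wsqrtr//.
rewrite sqrrD !real_normK ?num_real// addrAC lerDl.
by rewrite mulrn_wge0// mulr_ge0.
Qed.

Lemma abs_sqr z : abs z ^+ 2 = complex.Re z ^+ 2 + complex.Im z ^+ 2.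
Proof.
by case: z => a b; rewrite /ComplexField.Normc.normc /= sqr_sqrtr// addr_ge0 ?sqr_ge0.
Qed.

End Modulus.

Section PolynomialEstimates.
Variable R : realType.
Implicit Types (p q : {poly R[i]}) (z w v x y : R[i]).

Lemma abs_horner_roots p : p != 0 ->
  exists rs : seq R[i], [/\ size rs = (size p).-1,
    forall x, x \in rs -> p.[x] = 0 &
    forall z, abs p.[z] = abs (lead_coef p) * \prod_(x <- rs) abs (z - x)].
Proof.
move=> p0; have [rs def_p] := closed_field_poly_normal p.
have lp : lead_coef p != 0 by rewrite lead_coef_eq0.
have pE z : p.[z] = lead_coef p * \prod_(x <- rs) (z - x).
  rewrite {1}def_p hornerZ horner_prod; congr (_ * _).
  by apply: eq_bigr => x _; rewrite !hornerE.
exists rs; split.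
- by rewrite def_p size_scale// size_prod_XsubC.
- move=> x xrs; rewrite pE; apply/eqP; rewrite mulf_eq0 (negPf lp)/=.
  by rewrite prodf_seq_eq0; apply/hasP; exists x; rewrite //= subrr.
- by move=> z; rewrite pE absM abs_prod.
Qed.

(** If [p] omitted [v] on the disc, the factors of [p - v] would all be at
    least the radius at its center: the image of a disc of radius [r] contains
    a disc whose radius depends on [p] only through its leading term. *)
Lemma poly_open_map p y v r : (1 < size p)%N -> 0 < r ->
  abs (p.[y] - v) < abs (lead_coef p) * r ^+ (size p).-1 ->
  exists2 x, abs (x - y) < r & p.[x] = v.
Proof.
move=> sp r0 h; have p0 : p != 0 by rewrite -size_poly_gt0 ltnW.
have sv : (size (- v%:P : {poly R[i]})%R < size p)%N.
  by rewrite size_polyN (leq_ltn_trans (size_polyC_leq1 _)).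
have spv : size (p - v%:P) = size p by rewrite size_polyDl.
have pv0 : p - v%:P != 0 by rewrite -size_poly_gt0 spv ltnW.
have [rs [srs rrs prs]] := abs_horner_roots pv0.
have [/hasP[x xrs xr]|/hasPn far] := boolP (has (fun x => abs (x - y) < r) rs).
  by exists x => //; have /eqP := rrs _ xrs; rewrite !hornerE subr_eq0 => /eqP.
move: h; rewrite -[p.[y] - v](_ : (p - v%:P).[y] = _); last by rewrite !hornerE.
rewrite prs lead_coefDl// ltNge => /negP[].
rewrite ler_wpM2l ?abs_ge0// -spv -srs.
elim: rs far {srs rrs prs} => [|a s ih] far; first by rewrite big_nil expr0.
rewrite big_cons /= exprS ler_pM ?exprn_ge0 ?(ltW r0)//.
  by rewrite absC leNgt; apply: far; rewrite inE eqxx.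
by apply: ih => b bs; apply: far; rewrite inE bs orbT.
Qed.

Lemma poly_surj p v : (1 < size p)%N -> exists x, p.[x] = v.
Proof.
move=> sp; have /closed_rootP[x] : size (p - v%:P) != 1.
  rewrite size_polyDl ?gtn_eqF// size_polyN.
  exact: leq_ltn_trans (size_polyC_leq1 _) _.
by rewrite /root !hornerE subr_eq0 => /eqP; exists x.
Qed.

Lemma poly_lipschitz p (M : R) : exists2 L : R, 0 < L &
  forall x y, abs x <= M -> abs y <= M -> abs (p.[x] - p.[y]) <= L * abs (x - y).
Proof.
elim/poly_ind: p => [|p c [L L0 ih]].
  by exists 1 => // x y _ _; rewrite !horner0 subrr abs0 mul1r abs_ge0.
have [B B0 hB] : exists2 B : R, 0 <= B & forall y, abs y <= M -> abs p.[y] <= B.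
  exists (L * (`|M| + `|M|) + abs p.[0] + abs p.[0]) => [|y yM].
    by rewrite !addr_ge0 ?abs_ge0// mulr_ge0 ?addr_ge0// ltW.
  have M0 : 0 <= M by rewrite (le_trans (abs_ge0 y)).
  have := ih y 0 yM; rewrite abs0 => /(_ M0); rewrite subr0 => h.
  have := absD (p.[y] - p.[0]) p.[0]; rewrite subrK => h2.
  have : L * abs y <= L * (`|M| + `|M|).
    by rewrite ler_pM2l// (le_trans yM)// ger0_norm// lerDl.
  by have := abs_ge0 p.[0]; lra.
exists (B + L * (`|M| + 1)) => [|x y xM yM].
  by rewrite ltr_wpDl// mulr_gt0// ltr_wpDl.
rewrite !hornerMXaddC.
rewrite (_ : _ - _ = p.[y] * (x - y) + (p.[x] - p.[y]) * x); last by ring.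
rewrite (le_trans (absD _ _))// !absM mulrDl lerD//.
  by rewrite ler_wpM2r ?abs_ge0// hB.
have M0 : 0 <= M by rewrite (le_trans (abs_ge0 y)).
rewrite mulrAC ler_pM ?abs_ge0//; first exact: ih.
by rewrite ger0_norm// (le_trans xM)// lerDl.
Qed.

Lemma poly_bounded p (M : R) : exists2 B : R, 0 < B &
  forall x, abs x <= M -> abs p.[x] <= B.
Proof.
have [L L0 hL] := poly_lipschitz p M.
exists (L * `|M| + abs p.[0] + 1) => [|x xM].
  by rewrite ltr_wpDl// addr_ge0 ?abs_ge0// mulr_ge0// ltW.
have M0 : 0 <= M by rewrite (le_trans (abs_ge0 x)).
have := hL x 0 xM; rewrite abs0 => /(_ M0); rewrite subr0 => h.
have := absD (p.[x] - p.[0]) p.[0]; rewrite subrK => h2.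
have : L * abs x <= L * `|M| by rewrite ler_pM2l// (le_trans xM)// ler_norm.
by lra.
Qed.

(** The factor [|z|] on the left stands for a division of the right-hand side,
    so that the degree may be [0]. *)
Lemma poly_lead_estimate p : exists2 C : R, 0 < C &
  forall z, 1 <= abs z ->
  abs (p.[z] - lead_coef p * z ^+ (size p).-1) * abs z <= C * abs z ^+ (size p).-1.
Proof.
elim/poly_ind: p => [|p c [C C0 ih]].
  exists 1 => // z z1; rewrite lead_coef0 mul0r horner0 subrr abs0 mul0r.
  by rewrite mul1r exprn_ge0// abs_ge0.
have [->|p0] := eqVneq p 0.
  exists 1 => // z z1; rewrite mul0r add0r lead_coefC hornerC size_polyC.
  have -> : ((c != 0%R).-1 = 0)%N by case: eqP.
  by rewrite expr0 mulr1 subrr abs0 mul0r mul1r.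
exists (C + abs c + 1) => [|z z1]; first by rewrite ltr_wpDl// addr_ge0 ?abs_ge0// ltW.
have sp : size (p * 'X + c%:P) = (size p).+1.
  by rewrite size_MXaddC (negPf p0).
have lp : lead_coef (p * 'X + c%:P) = lead_coef p.
  rewrite lead_coefDl ?lead_coefMX// size_mulX// ltnS.
  by rewrite (leq_trans (size_polyC_leq1 _))// size_poly_gt0.
rewrite sp lp hornerMXaddC /=.
have spS : (size p = (size p).-1.+1) by rewrite prednK// size_poly_gt0.
rewrite [in _ ^+ size p]spS [in leRHS]spS !exprS.
set n := (size p).-1.
have an : 1 <= abs z ^+ n by rewrite exprn_ege1.
have -> : p.[z] * z + c - lead_coef p * (z * z ^+ n) =
  (p.[z] - lead_coef p * z ^+ n) * z + c by ring.
have h1 := absD ((p.[z] - lead_coef p * z ^+ n) * z) c.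
rewrite absM in h1; have h2 := ih z z1.
apply: (@le_trans _ _ ((C * abs z ^+ n + abs c) * abs z)).
  by rewrite ler_wpM2r ?abs_ge0// (le_trans h1)// lerD2r.
rewrite mulrCA [_ * abs z]mulrC ler_wpM2l ?abs_ge0// !mulrDl -addrA lerD2l.
rewrite -[leLHS]addr0 lerD ?mul1r ?(le_trans _ an)//.
by rewrite ler_peMr ?abs_ge0.
Qed.

(** The factorization of [X^m - 1], made homogeneous so that it applies to the
    points [w + r v] of a circle. The root [1] is kept apart since the estimates
    single out the point [w + v]. *)
Lemma unity_roots m : (0 < m)%N -> exists rs : seq R[i],
  [/\ size rs = m.-1, forall r, r \in rs -> abs r = 1 &
    forall z v, (z - v) * \prod_(r <- rs) (z - r * v) = z ^+ m - v ^+ m].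
Proof.
move=> m0; have [s def_s] := closed_field_poly_normal ('X^m - 1 : {poly R[i]}).
move: def_s; rewrite lead_coefXnsubC// scale1r => def_s.
have ss : size s = m.
  by apply: succn_inj; rewrite -(size_prod_XsubC s id) -def_s size_XnsubC.
have root_s r : (r \in s) = (r ^+ m == 1).
  by rewrite -root_prod_XsubC -def_s /root !hornerE subr_eq0.
have s1 : 1 \in s by rewrite root_s expr1n.
exists (rem 1 s); split.
- by rewrite size_rem ?ss.
- move=> r /mem_rem; rewrite root_s => /eqP rm.
  by apply/eqP; rewrite -(@pexpr_eq1 _ _ m) ?abs_ge0// -absX rm abs1.
move=> z v.
transitivity (\prod_(r <- s) (z - r * v)).
  by rewrite (perm_big _ (perm_to_rem s1)) big_cons mul1r.
have [->|v0] := eqVneq v 0.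
  rewrite expr0n (gtn_eqF m0) subr0; under eq_bigr do rewrite mulr0 subr0.
  by rewrite big_const_seq count_predT iter_mulr_1 ss.
have -> : \prod_(r <- s) (z - r * v) = \prod_(r <- s) (v * (z / v - r)).
  by apply: eq_bigr => r _; field.
rewrite big_split /= big_const_seq count_predT iter_mulr_1 ss.
have := congr1 (horner^~ (z / v)) def_s.
rewrite horner_prod !hornerE; under [in RHS]eq_bigr do rewrite !hornerE.
by move=> <-; rewrite mulrBr mulr1 -exprMn mulrC divfK.
Qed.

End PolynomialEstimates.

(** * Polynomials without zeros on a disc *)

Section ZeroFreeDiscs.
Variable R : realType.
Implicit Types (p q : {poly R[i]}) (z w v x y : R[i]).

Definition zero_free p w (r : R) := forall x, abs (x - w) < r -> p.[x] != 0.

Lemma zero_free_center p w r : 0 < r -> zero_free p w r -> p.[w] != 0.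
Proof. by move=> r0; apply; rewrite subrr abs0. Qed.

Lemma zero_free_neq0 p w r : 0 < r -> zero_free p w r -> p != 0.
Proof.
by move=> r0 /(zero_free_center r0); apply: contra_neq => ->; rewrite horner0.
Qed.

(** Harnack's inequality for the logarithm of a polynomial, with the degree as
    the mass: it holds factor by factor, [|x - a| <= (1 + t) |w - a|]. *)
Lemma harnack_poly p w x (r t : R) : 0 < r -> zero_free p w r -> 0 <= t ->
  abs (x - w) <= t * r -> abs p.[x] <= abs p.[w] * (1 + t) ^+ (size p).-1.
Proof.
move=> r0 pr t0 xw; have [rs [srs rrs prs]] := abs_horner_roots (zero_free_neq0 r0 pr).
rewrite !prs -mulrA ler_wpM2l ?abs_ge0// -srs.
have far a : a \in rs -> r <= abs (w - a).
  move=> ars; rewrite absC leNgt; apply/negP => /pr.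
  by rewrite rrs// eqxx.
elim: rs far {srs rrs prs} => [|a s ih] far; first by rewrite !big_nil expr0 mulr1.
rewrite !big_cons /= exprS mulrACA ler_pM ?abs_ge0 ?prodr_ge0//.
- by move=> b _; exact: abs_ge0.
- rewrite (le_trans (abs_dist_tri w x a))// mulrDr mulr1 addrC lerD2l.
  rewrite (le_trans xw)// mulrC ler_wpM2r//.
  by apply: far; rewrite inE eqxx.
- by apply: ih => b bs; apply: far; rewrite inE bs orbT.
Qed.

Lemma ln_harnack_poly p w x (r t : R) : 0 < r -> zero_free p w r -> 0 <= t ->
  abs (x - w) <= t * r -> p.[x] != 0 ->
  ln (abs p.[x]) <= ln (abs p.[w]) + (size p).-1%:R * t.
Proof.
move=> r0 pr t0 xw px; have pw := zero_free_center r0 pr.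
have t1 : 0 < 1 + t by rewrite ltr_pwDl.
have h := harnack_poly r0 pr t0 xw.
apply: (@le_trans _ _ (ln (abs p.[w] * (1 + t) ^+ (size p).-1))).
  by rewrite ler_ln ?posrE ?mulr_gt0 ?abs_gt0 ?exprn_gt0.
rewrite lnM ?posrE ?abs_gt0 ?exprn_gt0// lnXn// lerD2l -(mulr_natl (ln _)).
by rewrite ler_wpM2l// le_ln1Dx// (lt_le_trans _ t0)// ltrN10.
Qed.

(** The mean value property of [ln |p|] on a zero-free disc, sampled at the
    [m] points [w + r v] with [r^m = 1]. Multiplying [w + r v - a] over all
    these [r] gives [(w - a)^m - v^m] up to sign, so the error is at most
    [theta ^+ m] per root of [p]. *)
Lemma sampled_mean_value m : (0 < m)%N -> exists rs : seq R[i],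
  [/\ size rs = m.-1, forall r, r \in rs -> abs r = 1 &
  forall p w v (rho theta b : R), 0 < rho -> zero_free p w rho ->
    0 <= theta < 1 -> abs v <= theta * rho ->
    (forall r, r \in rs -> b <= ln (abs p.[w + r * v])) ->
    ln (abs p.[w + v]) <= m%:R * ln (abs p.[w]) - m.-1%:R * b
      + (size p).-1%:R * theta ^+ m].
Proof.
move=> m0; have [rs [srs rs1 prs]] := unity_roots R m0; exists rs; split=> //.
move=> p w v rho theta b rho0 prho /andP[th0 th1] vth hb.
have p0 := zero_free_neq0 rho0 prho.
have trho : theta * rho < rho by rewrite gtr_pMl.
have pv : p.[w + v] != 0.
  by apply: prho; rewrite addrC addKr (le_lt_trans vth).
have prv r : r \in rs -> p.[w + r * v] != 0.
  move=> /rs1 r1; apply: prho.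
  by rewrite addrC addKr absM r1 mul1r (le_lt_trans vth).
have pw := zero_free_center rho0 prho.
have t1 : 0 < 1 + theta ^+ m by rewrite ltr_pwDl// exprn_ge0.
have key : abs p.[w + v] * \prod_(r <- rs) abs p.[w + r * v] <=
    abs p.[w] ^+ m * (1 + theta ^+ m) ^+ (size p).-1.
  have [zs [szs zzs pzs]] := abs_horner_roots p0.
  have far a : a \in zs -> rho <= abs (w - a).
    move=> azs; rewrite absC leNgt; apply/negP => /prho.
    by rewrite zzs// eqxx.
  under eq_bigr do rewrite pzs.
  rewrite !pzs.
  rewrite big_split /= big_const_seq count_predT iter_mulr_1 srs.
  rewrite mulrACA -exprS prednK// exprMn -mulrA.
  rewrite ler_wpM2l ?exprn_ge0 ?abs_ge0// -szs exchange_big /= -big_split /=.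
  elim: zs far {szs zzs pzs} => [|a s ih] far.
    by rewrite !big_nil expr0 expr1n mulr1.
  rewrite !big_cons /= exprMn exprS mulrACA ler_pM//.
  - by rewrite mulr_ge0 ?abs_ge0// prodr_ge0// => ? _; exact: abs_ge0.
  - rewrite prodr_ge0// => ? _.
    by rewrite mulr_ge0 ?abs_ge0// prodr_ge0// => ? _; exact: abs_ge0.
  - rewrite -abs_prod -absM.
    have -> : (w + v - a) * \prod_(i <- rs) (w + i * v - a) =
        (w - a) ^+ m - (- v) ^+ m.
      rewrite -prs; congr (_ * _); first by ring.
      by apply: eq_bigr => i _; ring.
    rewrite (le_trans (absBD _ _))// !absX absN mulrDr mulr1 lerD2l -exprMn.
    rewrite lerXn2r ?nnegrE ?mulr_ge0 ?abs_ge0//.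
    rewrite (le_trans vth)// mulrC ler_wpM2r//.
    by apply: far; rewrite inE eqxx.
  - by apply: ih => c cs; apply: far; rewrite inE cs orbT.
have prod0 : 0 < \prod_(r <- rs) abs p.[w + r * v].
  rewrite big_seq; elim/big_ind: _ => // [x y x0 y0|r rrs]; first exact: mulr_gt0.
  by rewrite abs_gt0 prv.
have lnprod : m.-1%:R * b <= ln (\prod_(r <- rs) abs p.[w + r * v]).
  rewrite -srs.
  elim: (rs) hb prv => [|a s ih] hb prv; first by rewrite big_nil ln1 mul0r.
  have prv' c : c \in s -> p.[w + c * v] != 0.
    by move=> cs; apply: prv; rewrite inE cs orbT.
  rewrite big_cons lnM ?posrE.
  - rewrite /= -natr1 mulrDl mul1r addrC lerD ?hb ?inE ?eqxx// ih//.
    by move=> c cs; apply: hb; rewrite inE cs orbT.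
  - by rewrite abs_gt0 prv// inE eqxx.
  - rewrite big_seq; elim/big_ind: _ => // [x y x0 y0|c cs]; first exact: mulr_gt0.
    by rewrite abs_gt0 prv'.
have {key} : ln (abs p.[w + v] * \prod_(r <- rs) abs p.[w + r * v]) <=
    ln (abs p.[w] ^+ m * (1 + theta ^+ m) ^+ (size p).-1).
  by rewrite ler_ln ?posrE ?mulr_gt0 ?exprn_gt0 ?abs_gt0.
rewrite lnM ?posrE ?abs_gt0// lnM ?posrE ?exprn_gt0 ?abs_gt0//.
rewrite !lnXn ?abs_gt0// -!(mulr_natl (ln _)) => key.
have : (size p).-1%:R * ln (1 + theta ^+ m) <= (size p).-1%:R * theta ^+ m.
  by rewrite ler_wpM2l// le_ln1Dx// (@lt_le_trans _ _ 0) ?ltrN10// exprn_ge0.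
by lra.
Qed.

Lemma archi_mul (B c : R) : 0 < c -> exists n : nat, B < n%:R * c.
Proof.
move=> c0; exists (Num.bound (`|B| / c)).
rewrite -ltr_pdivrMr// (le_lt_trans _ (archi_boundP _)) ?divr_ge0 ?(ltW c0)//.
by rewrite ler_wpM2r ?invr_ge0 ?(ltW c0)// ler_norm.
Qed.

(** The maximum principle, for a bounded set [K] whose boundary lies in the
    closure of [T]. Near a point of [K] where [|p|] exceeds its bound on [T] by
    a fixed amount, a disc of fixed radius is contained in [K], and
    [poly_open_map] increases [|p|] within [K] by a fixed amount. *)
Lemma poly_max_principle p (K T : set R[i]) (b M : R) : (1 < size p)%N ->
  0 <= M -> (forall y, K y -> abs y <= b) ->
  (forall t, T t -> abs p.[t] <= M) ->
  (forall y (r : R), K y -> 0 < r -> (forall x, abs (x - y) < r -> ~ T x) ->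
    forall x, abs (x - y) < r -> K x) ->
  forall y, K y -> abs p.[y] <= M.
Proof.
move=> sp M0 Kb TM KT y0 Ky0; rewrite leNgt; apply/negP => gtM.
have p0 : p != 0 by rewrite -size_poly_gt0 ltnW.
have lp : 0 < abs (lead_coef p) by rewrite abs_gt0 lead_coef_eq0.
pose eta := abs p.[y0] - M; have eta0 : 0 < eta by rewrite subr_gt0.
have [L L0 hL] := poly_lipschitz p (b + 1).
pose r := Num.min 1 (eta / L).
have r0 : 0 < r by rewrite lt_min ltr01 divr_gt0.
have rL : r * L <= eta by rewrite -ler_pdivlMr// ge_min lexx orbT.
have r1 : r <= 1 by rewrite ge_min lexx.
pose c := abs (lead_coef p) * r ^+ (size p).-1.
have c0 : 0 < c by rewrite mulr_gt0// exprn_gt0.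
have step y : K y -> M + eta <= abs p.[y] ->
    exists2 y', K y' & abs p.[y] + c / 2 <= abs p.[y'].
  move=> Ky hy.
  have disj x : abs (x - y) < r -> ~ T x.
    move=> xr Tx; have yb := Kb y Ky.
    have xb : abs x <= b + 1.
      have := absD (x - y) y; rewrite subrK; lra.
    have := hL y x; rewrite absC => /(_ _ _)/(le_trans (absB _ _)).
    have : L * abs (x - y) < eta.
      by rewrite (lt_le_trans _ rL)// mulrC ltr_pM2r.
    have := TM x Tx; rewrite absC => h1 h2 h3.
    by have := h3 _ xb; lra.
  have py0 : 0 < abs p.[y] by lra.
  pose e := c / 2 / abs p.[y].
  have e0 : 0 <= e by rewrite !divr_ge0 ?abs_ge0// ltW.
  have eE : e * abs p.[y] = c / 2 by rewrite divfK// gt_eqF.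
  have [|y' yy' py'] := @poly_open_map R p y ((1 + e)%:C * p.[y]) r sp r0.
    rewrite rmorphD mulrDl mul1r opprD addrA subrr sub0r absN abs_scale ger0_norm// eE.
    by rewrite -/c; lra.
  exists y'; first exact: (KT y r).
  by rewrite py' abs_scale ger0_norm ?addr_ge0// mulrDl mul1r eE.
have grow n : exists2 y, K y & M + eta + n%:R * (c / 2) <= abs p.[y].
  elim: n => [|n [y Ky hy]].
    by exists y0 => //; rewrite mul0r addr0 addrC subrK.
  have [|y' Ky' hy'] := step y Ky.
    by rewrite (le_trans _ hy)// lerDl mulr_ge0// ltW// divr_gt0.
  by exists y' => //; rewrite -natr1 mulrDl mul1r; lra.
have [B B0 hB] := poly_bounded p b.
have [n hn] : exists n : nat, B < n%:R * (c / 2) by apply: archi_mul; rewrite divr_gt0.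
have [y Ky hy] := grow n; have := hB y (Kb y Ky); lra.
Qed.

End ZeroFreeDiscs.

(** * The filled Julia set and its escape rate *)

Section PolynomialGrowth.
Variable R : realType.
Implicit Types (p q : {poly R[i]}) (z w : R[i]).

Lemma poly_large p : (1 < size p)%N -> exists2 b : R, 1 <= b &
  forall z, b <= abs z ->
    abs (lead_coef p) / 2 * abs z ^+ (size p).-1 <= abs p.[z]
    <= 2 * abs (lead_coef p) * abs z ^+ (size p).-1.
Proof.
move=> sp; have p0 : p != 0 by rewrite -size_poly_gt0 ltnW.
have a0 : 0 < abs (lead_coef p) by rewrite abs_gt0 lead_coef_eq0.
have [C C0 hC] := poly_lead_estimate p.
exists (Num.max 1 (2 * C / abs (lead_coef p))) => [|z]; first by rewrite le_max lexx.
rewrite ge_max => /andP[z1]; rewrite ler_pdivrMr// => zC.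
have z0 : 0 < abs z by rewrite (lt_le_trans ltr01).
set n := (size p).-1; set a := lead_coef p in a0 hC zC *.
have h : abs (p.[z] - a * z ^+ n) <= abs a / 2 * abs z ^+ n.
  rewrite -(ler_pM2r z0) (le_trans (hC z z1))// -/n mulrAC ler_wpM2r ?exprn_ge0 ?abs_ge0//.
  by lra.
have := absB (a * z ^+ n) (a * z ^+ n - p.[z]); rewrite subKr absC.
have := absD (p.[z] - a * z ^+ n) (a * z ^+ n); rewrite subrK.
rewrite absM absX => h1 h2; apply/andP.
have : 0 <= abs a * abs z ^+ n by rewrite mulr_ge0 ?abs_ge0 ?exprn_ge0 ?abs_ge0.
by split; lra.
Qed.

(** Up to a bounded factor [1 + |p z|] is [(1 + |z|) ^ deg p], on the whole
    plane: adding [1] removes the singularity of [ln] at the zeros of [p]. *)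
Lemma poly_log_growth p : (1 < size p)%N -> exists2 C : R, 0 <= C &
  forall z, `|ln (1 + abs p.[z]) - (size p).-1%:R * ln (1 + abs z)| <= C.
Proof.
move=> sp; have p0 : p != 0 by rewrite -size_poly_gt0 ltnW.
have a0 : 0 < abs (lead_coef p) by rewrite abs_gt0 lead_coef_eq0.
have [b b1 hb] := poly_large sp.
have [B B0 hB] := poly_bounded p b.
set n := (size p).-1 in hb *; set a := abs (lead_coef p) in a0 hb *.
have oneD z : 0 < 1 + abs z by rewrite ltr_pwDl ?abs_ge0.
pose A := 1 + 2 * a + B; pose A' := (1 + b) ^+ n + 2 ^+ n * (2 / a).
have up z : 1 + abs p.[z] <= A * (1 + abs z) ^+ n.
  have e1 : 1 <= (1 + abs z) ^+ n by rewrite exprn_ege1// lerDl abs_ge0.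
  have [zb|/ltW/hb/andP[_ h]] := leP (abs z) b.
    have := hB z zb; have : A <= A * (1 + abs z) ^+ n.
      by rewrite ler_peMr// !addr_ge0 ?mulr_ge0// ltW.
    rewrite /A; lra.
  rewrite /A 2!mulrDl mul1r.
  have : 2 * a * abs z ^+ n <= 2 * a * (1 + abs z) ^+ n.
    rewrite ler_wpM2l ?mulr_ge0 ?(ltW a0)// lerXn2r ?nnegrE ?abs_ge0//.
      by rewrite ltW.
    by rewrite lerDr.
  have : 0 <= B * (1 + abs z) ^+ n by rewrite mulr_ge0 ?ltW// exprn_gt0.
  by lra.
have lo z : (1 + abs z) ^+ n <= A' * (1 + abs p.[z]).
  have [zb|/ltW zb] := leP (abs z) b.
    apply: (@le_trans _ _ ((1 + b) ^+ n)).
      rewrite lerXn2r ?nnegrE ?lerD2l//; first by rewrite ltW.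
      by rewrite addr_ge0// (le_trans _ b1).
    rewrite /A' -[leLHS]mulr1 ler_pM ?exprn_ge0 ?addr_ge0 ?(le_trans _ b1)//.
    - by rewrite lerDl mulr_ge0 ?exprn_ge0// divr_ge0// ltW.
    - by rewrite lerDl abs_ge0.
  have /andP[h _] := hb z zb.
  apply: (@le_trans _ _ (2 ^+ n * (2 / a) * abs p.[z])).
    apply: (@le_trans _ _ (2 ^+ n * abs z ^+ n)).
      rewrite -exprMn lerXn2r ?nnegrE ?mulr_ge0 ?abs_ge0//; first by rewrite ltW.
      by have := le_trans b1 zb; lra.
    rewrite -mulrA ler_wpM2l ?exprn_ge0// -ler_pdivrMl ?divr_gt0// invf_div//.
  apply: ler_pM; rewrite ?abs_ge0 ?lerDr//.
    by rewrite mulr_ge0 ?exprn_ge0 ?divr_ge0 ?(ltW a0).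
  by rewrite exprn_ge0 ?addr_ge0// (le_trans _ b1).
have A1 : 1 <= A by rewrite /A -addrA lerDl addr_ge0 ?mulr_ge0// ltW.
have A'1 : 1 <= A'.
  apply: ler_wpDr.
    by rewrite mulr_ge0 ?exprn_ge0 ?divr_ge0 ?(ltW a0).
  by rewrite exprn_ege1// lerDl (le_trans _ b1).
have Ap : 0 < A by rewrite (lt_le_trans _ A1).
have Ap' : 0 < A' by rewrite (lt_le_trans _ A'1).
exists (ln A + ln A') => [|z]; first by rewrite addr_ge0 ?ln_ge0.
have {}up : ln (1 + abs p.[z]) <= ln (A * (1 + abs z) ^+ n).
  by rewrite ler_ln ?posrE ?mulr_gt0 ?exprn_gt0.
have {}lo : ln ((1 + abs z) ^+ n) <= ln (A' * (1 + abs p.[z])).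
  by rewrite ler_ln ?posrE ?mulr_gt0 ?exprn_gt0.
move: up lo; rewrite !lnM ?posrE ?exprn_gt0// lnXn// -(mulr_natl (ln _)).
have := ln_ge0 A1; have := ln_ge0 A'1 => h1 h2 h3 h4.
by rewrite ler_norml; apply/andP; split; lra.
Qed.

Definition poly_iter p n : {poly R[i]} := iter n (fun q => p \Po q) 'X.

Lemma horner_poly_iter p n z : (poly_iter p n).[z] = iter n (horner p) z.
Proof.
by elim: n => [|n ih]; rewrite ?hornerX// /poly_iter iterS horner_comp -/(poly_iter p n) ih.
Qed.

Lemma size_poly_iter p n : (size (poly_iter p n)).-1 = ((size p).-1 ^ n)%N.
Proof.
elim: n => [|n ih]; first by rewrite size_polyX expn0.
by rewrite /poly_iter iterS size_comp_poly -/(poly_iter p n) ih expnS.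
Qed.

Lemma size_poly_iter_gt1 p n : (1 < size p)%N -> (1 < size (poly_iter p n))%N.
Proof.
move=> sp; have : (0 < (size (poly_iter p n)).-1)%N.
  by rewrite size_poly_iter expn_gt0 -subn1 subn_gt0 sp.
by case: (size _) => [|[]].
Qed.

End PolynomialGrowth.

Section EscapeRate.
Variable R : realType.
Implicit Types (z w : R[i]).

Definition filled (f : {poly R[i]}) : set R[i] :=
  [set z | exists M : R, forall n, abs (iter n (horner f) z) <= M].

(** The escape rate [lim d^-n ln (1 + |f^n z|)], that is, the Green function of
    the filled Julia set with pole at infinity. It is characterized by a bound on
    the difference, which is what the estimates use. *)
Definition green (f : {poly R[i]}) z : R := xget 0 [set t : R | exists C : R,
  forall n, `|ln (1 + abs (iter n (horner f) z)) - (size f).-1%:R ^+ n * t| <= C].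

Variable f : {poly R[i]}.
Hypothesis hf : (2 <= (size f).-1)%N.
Local Notation d := (size f).-1.
Local Notation G := (green f).
Local Notation F n z := (iter n (horner f) z).

Lemma size_gt1 : (1 < size f)%N.
Proof. by case: (size f) hf => [|[|[]]]. Qed.

Let dR : 2 <= d%:R :> R. Proof. by rewrite ler_nat. Qed.
Let dn0 n : 0 < d%:R ^+ n :> R.
Proof. by rewrite exprn_gt0// (lt_le_trans _ dR). Qed.

Lemma le_pow_growth (s t C : R) (n0 : nat) :
  (forall n, (n0 <= n)%N -> d%:R ^+ n * s <= d%:R ^+ n * t + C) -> s <= t.
Proof.
move=> h; rewrite leNgt; apply/negP => st.
have [n hn] : exists n : nat, C < n%:R * (s - t).
  by apply: archi_mul; rewrite subr_gt0.
pose m := maxn n0 n; have := h m (leq_maxl _ _).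
have : n%:R * (s - t) <= d%:R ^+ m * (s - t).
  rewrite ler_wpM2r ?subr_ge0 ?(ltW st)// -natrX ler_nat.
  by rewrite (leq_trans (leq_maxr n0 n))// ltnW// ltn_expl.
by rewrite mulrBr; lra.
Qed.

(** By [poly_log_growth], the bounds [(ln (1 + |f^n z|) -+ C) / d^n] are those of
    nested intervals, and [C] is the same for all [z]. *)
Lemma green_approx : exists2 C : R, 0 <= C &
  forall z n, `|ln (1 + abs (F n z)) - d%:R ^+ n * G z| <= C.
Proof.
have [C C0 hC] := poly_log_growth size_gt1; exists C => // z.
suff [t ht] : exists t, forall n, `|ln (1 + abs (F n z)) - d%:R ^+ n * t| <= C.
  rewrite /green; case: xgetP => [s _ [C' hC'] n|/(_ t) []]; last by exists C.
  suff -> : s = t by [].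
  have bnd k : `|d%:R ^+ k * s - d%:R ^+ k * t| <= C + C'.
    have := ht k; have := hC' k; rewrite !ler_norml => /andP[? ?] /andP[? ?].
    by apply/andP; split; lra.
  apply/eqP; rewrite eq_le; apply/andP; split.
    apply: (@le_pow_growth _ _ (C + C') 0) => k _.
    by have := bnd k; rewrite ler_norml => /andP[? ?]; lra.
  apply: (@le_pow_growth _ _ (C + C') 0) => k _.
  by have := bnd k; rewrite ler_norml => /andP[? ?]; lra.
pose l n := ln (1 + abs (F n z)).
pose lo n := (l n - C) / d%:R ^+ n; pose hi n := (l n + C) / d%:R ^+ n.
have step n : `|l n.+1 - d%:R * l n| <= C by rewrite /l /=; exact: hC.
have powE (x : R) n : x / d%:R ^+ n.+1 * d%:R ^+ n = x / d%:R.
  by rewrite exprS invfM mulrA divfK// gt_eqF.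
have loS n : lo n <= lo n.+1.
  rewrite /lo ler_pdivrMr// powE.
  rewrite ler_pdivlMr ?(lt_le_trans _ dR)//.
  have := step n; rewrite ler_norml => /andP[? ?].
  have : 2 * C <= d%:R * C by rewrite ler_wpM2r.
  by lra.
have hiS n : hi n.+1 <= hi n.
  rewrite /hi ler_pdivlMr// powE.
  rewrite ler_pdivrMr ?(lt_le_trans _ dR)//.
  have := step n; rewrite ler_norml => /andP[? ?].
  have : 2 * C <= d%:R * C by rewrite ler_wpM2r.
  by lra.
have lo_mono m n : (m <= n)%N -> lo m <= lo n.
  by move=> /subnKC <-; elim: (n - m)%N => [|k ih]; rewrite ?addn0// addnS (le_trans ih).
have hi_mono m n : (m <= n)%N -> hi n <= hi m.
  by move=> /subnKC <-; elim: (n - m)%N => [|k ih]; rewrite ?addn0// addnS (le_trans _ ih).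
have lohi m n : lo m <= hi n.
  have : lo (maxn m n) <= hi (maxn m n) by rewrite ler_pM2r ?invr_gt0//; lra.
  move=> h; rewrite (le_trans (lo_mono _ _ (leq_maxl m n)))// (le_trans h)//.
  exact/hi_mono/leq_maxr.
have ne : [set lo n | n in [set: nat]] !=set0 by exists (lo 0), 0.
have ub k : ubound [set lo n | n in [set: nat]] (hi k) by move=> _ [n _ <-].
exists (sup [set lo n | n in [set: nat]]) => n; rewrite -/(l n) ler_norml.
have : lo n <= sup [set lo n | n in [set: nat]].
  by apply: ub_le_sup; [exists (hi 0) | exists n].
have : sup [set lo n | n in [set: nat]] <= hi n by apply: ge_sup.
rewrite ler_pdivrMr// ler_pdivlMr// [_ * d%:R ^+ n]mulrC => h1 h2.
by apply/andP; split; lra.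
Qed.

Lemma green_uniq z t (C : R) :
  (forall n, `|ln (1 + abs (F n z)) - d%:R ^+ n * t| <= C) -> t = G z.
Proof.
move=> ht; have [C' C'0 hC'] := green_approx.
have bnd k : `|d%:R ^+ k * t - d%:R ^+ k * G z| <= C + C'.
  have := ht k; have := hC' z k; rewrite !ler_norml => /andP[? ?] /andP[? ?].
  by apply/andP; split; lra.
apply/eqP; rewrite eq_le; apply/andP; split.
  apply: (@le_pow_growth _ _ (C + C') 0) => k _.
  by have := bnd k; rewrite ler_norml => /andP[? ?]; lra.
apply: (@le_pow_growth _ _ (C + C') 0) => k _.
by have := bnd k; rewrite ler_norml => /andP[? ?]; lra.
Qed.

Let ell_ge0 z : 0 <= ln (1 + abs z).
Proof. by rewrite ln_ge0// lerDl abs_ge0. Qed.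

Lemma green_ge0 z : 0 <= G z.
Proof.
have [C C0 hC] := green_approx; apply: (@le_pow_growth _ _ C 0) => n _.
have := hC z n; have := ell_ge0 (F n z); rewrite ler_norml mulr0 => ? /andP[? ?].
by lra.
Qed.

Lemma green_map z : G f.[z] = d%:R * G z.
Proof.
have [C C0 hC] := green_approx; apply/esym/(@green_uniq _ _ C) => n.
by rewrite -iterSr mulrA -exprSr.
Qed.

Lemma green_iter n z : G (F n z) = d%:R ^+ n * G z.
Proof. by elim: n => [|n ih]; rewrite ?mul1r// iterS green_map ih mulrA -exprS. Qed.

Lemma filled_green z : filled f z <-> G z = 0.
Proof.
have [C C0 hC] := green_approx; split=> [[M hM]|Gz].
  apply/esym/(@green_uniq _ _ (ln (1 + `|M|))) => n.
  rewrite mulr0 subr0 ger0_norm ?ell_ge0// ler_ln ?posrE ?ltr_pwDl ?abs_ge0//.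
  by rewrite lerD2l (le_trans (hM n))// ler_norm.
exists (expR C) => n; have := hC z n; rewrite Gz mulr0 subr0 ger0_norm ?ell_ge0//.
move=> h; have : 1 + abs (F n z) <= expR C.
  by rewrite -[leLHS]lnK ?posrE ?ltr_pwDl ?abs_ge0// ler_expR.
lra.
Qed.

Lemma green_gt0 z : ~ filled f z -> 0 < G z.
Proof. by rewrite lt_neqAle green_ge0 andbT eq_sym filled_green => /eqP. Qed.

Lemma filled_map z : filled f f.[z] <-> filled f z.
Proof.
rewrite !filled_green green_map; split=> [/eqP|->]; last by rewrite mulr0.
by rewrite mulf_eq0 gt_eqF ?(lt_le_trans _ dR)//= => /eqP.
Qed.

Lemma filled_iter n z : filled f (F n z) <-> filled f z.
Proof. by elim: n => [//|n ih]; rewrite iterS filled_map. Qed.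

Lemma filled_bounded : exists2 B : R, 0 < B &
  forall z n, filled f z -> abs (F n z) <= B.
Proof.
have [C C0 hC] := green_approx; exists (expR C) => [|z n]; first exact: expR_gt0.
move=> /(filled_iter n)/filled_green Gz; have := hC (F n z) 0%N.
rewrite Gz mulr0 subr0 ger0_norm ?ell_ge0// => h.
have : 1 + abs (F n z) <= expR C.
  by rewrite -[leLHS]lnK ?posrE ?ltr_pwDl ?abs_ge0// ler_expR.
lra.
Qed.

Lemma filled_nonempty : exists k, filled f k.
Proof.
have sf : (size (- 'X : {poly R[i]})%R < size f)%N.
  by rewrite size_polyN size_polyX; case: (size f) hf => [|[|[]]].
have /closed_rootP[k] : size (f - 'X) != 1.
  by rewrite size_polyDl// gtn_eqF// size_gt1.
rewrite /root !hornerE subr_eq0 => /eqP fk; exists k, (abs k) => n.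
by rewrite iter_fix.
Qed.

Lemma escaping_large z (M : R) : 0 < G z ->
  exists n0, forall n, (n0 <= n)%N -> M <= abs (F n z).
Proof.
move=> Gz; have [C C0 hC] := green_approx.
have [n0 hn0] := archi_mul (ln (1 + `|M|) + C) Gz.
exists n0 => n hn; have := hC z n; rewrite ler_norml => /andP[h _].
have : n0%:R * G z <= d%:R ^+ n * G z.
  rewrite ler_wpM2r ?(ltW Gz)// -natrX ler_nat.
  by rewrite (leq_trans hn)// ltnW// ltn_expl.
move=> h2; have : ln (1 + `|M|) <= ln (1 + abs (F n z)) by lra.
rewrite ler_ln ?posrE ?ltr_pwDl ?abs_ge0// lerD2l; apply: le_trans.
exact: ler_norm.
Qed.

(** Both comparisons rest on [f^n - k] with [k] in the filled Julia set: all
    its roots are in the filled Julia set, and [G] is its growth rate. *)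
Lemma green_compare_le y y' (kappa : R) : 1 <= kappa ->
  (forall a, filled f a -> abs (y' - a) <= kappa * abs (y - a)) ->
  G y' <= G y + ln kappa.
Proof.
move=> k1 hk; have [C C0 hC] := green_approx; have [k Kk] := filled_nonempty.
have k0 : 0 < kappa by rewrite (lt_le_trans _ k1).
have oneD z : 0 < 1 + abs z by rewrite ltr_pwDl ?abs_ge0.
apply: (@le_pow_growth _ _ (C + C + ln (1 + abs k) + ln (1 + abs k)) 0) => n _.
have e1 : 1 <= kappa ^+ (d ^ n) by rewrite exprn_ege1.
have h : abs (F n y' - k) <= kappa ^+ (d ^ n) * abs (F n y - k).
  pose p := poly_iter f n - k%:P.
  have sp : size p = size (poly_iter f n).
    rewrite size_polyDl// size_polyN (leq_ltn_trans (size_polyC_leq1 _))//.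
    exact/size_poly_iter_gt1/size_gt1.
  have p0 : p != 0.
    by rewrite -size_poly_gt0 sp ltnW// size_poly_iter_gt1// size_gt1.
  have [rs [srs rrs prs]] := abs_horner_roots p0.
  have pE z : p.[z] = F n z - k by rewrite !hornerE horner_poly_iter.
  rewrite -!pE !prs mulrCA ler_wpM2l ?abs_ge0//.
  rewrite -(size_poly_iter f) -sp -srs.
  have Krs a : a \in rs -> filled f a.
    by move=> /rrs/eqP; rewrite pE subr_eq0 => /eqP h; rewrite -(filled_iter n) h.
  elim: (rs) Krs => [|a s ih] Krs; first by rewrite !big_nil expr0 mulr1.
  rewrite !big_cons /= exprS mulrACA ler_pM ?abs_ge0 ?prodr_ge0//.
  - by move=> b _; exact: abs_ge0.
  - by apply/hk/Krs; rewrite inE eqxx.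
  - by apply: ih => b bs; apply: Krs; rewrite inE bs orbT.
have h2 : 1 + abs (F n y') <=
    kappa ^+ (d ^ n) * ((1 + abs k) * (1 + abs k) * (1 + abs (F n y))).
  have := absD (F n y' - k) k; rewrite subrK => h3.
  have h4 := absBD (F n y) k.
  apply: (@le_trans _ _ (kappa ^+ (d ^ n) * ((1 + abs k) + (abs (F n y) + abs k)))).
    rewrite mulrDr.
    have : kappa ^+ (d ^ n) * abs (F n y - k) <=
           kappa ^+ (d ^ n) * (abs (F n y) + abs k).
      by rewrite ler_wpM2l// (le_trans _ e1).
    have : 1 + abs k <= kappa ^+ (d ^ n) * (1 + abs k) by rewrite ler_peMl// ltW.
    by lra.
  rewrite ler_wpM2l ?(le_trans _ e1)//.
  have := abs_ge0 k; have := abs_ge0 (F n y) => ? ?; nra.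
have : ln (1 + abs (F n y')) <= ln (kappa ^+ (d ^ n) * ((1 + abs k) * (1 + abs k) * (1 + abs (F n y)))).
  by rewrite ler_ln ?posrE ?mulr_gt0 ?exprn_gt0.
rewrite !lnM ?posrE ?mulr_gt0 ?exprn_gt0// lnXn// -(mulr_natl (ln _)) natrX.
have := hC y n; have := hC y' n; rewrite !ler_norml => /andP[? ?] /andP[? ?].
by rewrite mulrDr; lra.
Qed.

Lemma green_compare_ge y y' (kappa : R) : 1 <= kappa -> 0 < G y ->
  (forall a, filled f a -> kappa * abs (y - a) <= abs (y' - a)) ->
  G y + ln kappa <= G y'.
Proof.
move=> k1 Gy hk; have [C C0 hC] := green_approx; have [k Kk] := filled_nonempty.
have k0 : 0 < kappa by rewrite (lt_le_trans _ k1).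
have oneD z : 0 < 1 + abs z by rewrite ltr_pwDl ?abs_ge0.
have [n0 hn0] := escaping_large (1 + abs k + abs k) Gy.
apply: (@le_pow_growth _ _ (C + C + ln 2 + ln (1 + abs k)) n0) => n /hn0 large.
have e1 : 1 <= kappa ^+ (d ^ n) by rewrite exprn_ege1.
have h : kappa ^+ (d ^ n) * abs (F n y - k) <= abs (F n y' - k).
  pose p := poly_iter f n - k%:P.
  have sp : size p = size (poly_iter f n).
    rewrite size_polyDl// size_polyN (leq_ltn_trans (size_polyC_leq1 _))//.
    exact/size_poly_iter_gt1/size_gt1.
  have p0 : p != 0.
    by rewrite -size_poly_gt0 sp ltnW// size_poly_iter_gt1// size_gt1.
  have [rs [srs rrs prs]] := abs_horner_roots p0.
  have pE z : p.[z] = F n z - k by rewrite !hornerE horner_poly_iter.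
  rewrite -!pE !prs mulrCA ler_wpM2l ?abs_ge0//.
  rewrite -(size_poly_iter f) -sp -srs.
  have Krs a : a \in rs -> filled f a.
    by move=> /rrs/eqP; rewrite pE subr_eq0 => /eqP h; rewrite -(filled_iter n) h.
  elim: (rs) Krs => [|a s ih] Krs; first by rewrite !big_nil expr0 mulr1.
  rewrite !big_cons /= exprS mulrACA ler_pM ?mulr_ge0 ?exprn_ge0 ?abs_ge0 ?prodr_ge0 ?(ltW k0)//.
  - by move=> b _; exact: abs_ge0.
  - by apply/hk/Krs; rewrite inE eqxx.
  - by apply: ih => b bs; apply: Krs; rewrite inE bs orbT.
have h2 : kappa ^+ (d ^ n) * (1 + abs (F n y)) <=
    2 * ((1 + abs k) * (1 + abs (F n y'))).
  have h3 := absBD (F n y') k; have h4 := absB (F n y) k.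
  apply: (@le_trans _ _ (2 * (kappa ^+ (d ^ n) * abs (F n y - k)))).
    by rewrite mulrCA ler_wpM2l ?(le_trans _ e1)//; lra.
  rewrite ler_wpM2l// (le_trans h)// (le_trans h3)//.
  have := abs_ge0 k; have := abs_ge0 (F n y') => ? ?; nra.
have : ln (kappa ^+ (d ^ n) * (1 + abs (F n y))) <= ln (2 * ((1 + abs k) * (1 + abs (F n y')))).
  by rewrite ler_ln ?posrE ?mulr_gt0 ?exprn_gt0.
rewrite !lnM ?posrE ?mulr_gt0 ?exprn_gt0// lnXn// -(mulr_natl (ln _)) natrX.
have := hC y n; have := hC y' n; rewrite !ler_norml => /andP[? ?] /andP[? ?].
by rewrite mulrDr; lra.
Qed.

(** [|t z - a| >= sqrt t |z - a|] when [|a| <= |z|]. *)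
Lemma green_radial (B : R) z (t : R) :
  (forall a, filled f a -> abs a <= B) -> B < abs z -> 1 <= t ->
  G z + ln t / 2 <= G (t%:C * z).
Proof.
move=> hB Bz t1; have t0 : 0 < t by rewrite (lt_le_trans _ t1).
have Gz : 0 < G z by apply: green_gt0 => /hB; lra.
have -> : ln t / 2 = ln (Num.sqrt t).
  rewrite -{1}(sqr_sqrtr (ltW t0)) lnXn ?sqrtr_gt0// -mulr_natl.
  by field.
apply: green_compare_ge => // [|a /hB aB].
  by rewrite -sqrtr1 ler_wsqrtr.
rewrite -(@ler_pXn2r _ 2) ?nnegrE ?mulr_ge0 ?abs_ge0// exprMn sqr_sqrtr ?(ltW t0)//.
have : abs a ^+ 2 <= abs z ^+ 2.
  by rewrite lerXn2r ?nnegrE ?abs_ge0// (le_trans aB)// ltW.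
rewrite !abs_sqr.
case: z a {Gz aB Bz} => [x y] [u v] /= h.
have : 0 <= (t - 1) * (x ^+ 2 + y ^+ 2 - (u ^+ 2 + v ^+ 2)).
  by rewrite mulr_ge0 ?subr_ge0.
have : 0 <= (t - 1) ^+ 2 * (x ^+ 2 + y ^+ 2) by rewrite mulr_ge0 ?addr_ge0 ?sqr_ge0.
by lra.
Qed.

(** [|y' - a| <= (1 + |y' - y|) |y - a|] when [|y - a| >= 1]. *)
Lemma green_lipschitz (B : R) y y' :
  (forall a, filled f a -> abs a <= B) -> B + 1 <= abs y ->
  G y' <= G y + abs (y' - y).
Proof.
move=> hB By.
have h : ln (1 + abs (y' - y)) <= abs (y' - y).
  by rewrite le_ln1Dx// (@lt_le_trans _ _ 0) ?ltrN10// abs_ge0.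
rewrite (le_trans _ (lerD (lexx (G y)) h))//.
apply: green_compare_le => [|a /hB aB]; first by rewrite lerDl abs_ge0.
rewrite (le_trans (abs_dist_tri y y' a))// mulrDl mul1r addrC lerD2l.
rewrite ler_peMr ?abs_ge0//.
by have := absB y a; lra.
Qed.

End EscapeRate.

(** * Invariant sets that are bounded *)

Section Asymptotics.
Variable R : realType.
Implicit Types (p : {poly R[i]}) (z : R[i]).

Lemma ln_near1 (x e : R) : `|x - 1| <= e -> e <= 1 / 2 -> `|ln x| <= 2 * e.
Proof.
rewrite ler_norml => /andP[h1 h2] e2; have x0 : 0 < x by lra.
have up : ln x <= x - 1.
  by rewrite -{1}(subrKC 1 x) le_ln1Dx//; lra.
have lo : ln x^-1 <= x^-1 - 1.
  rewrite -{1}(subrKC 1 x^-1) le_ln1Dx// ltrBrDr addNr.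
  by rewrite invr_gt0.
rewrite lnV ?posrE// in lo.
have : x^-1 - 1 <= 2 * e.
  rewrite -(ler_pM2r x0) mulrBl mulVf ?gt_eqF// mul1r.
  have : e * (1 / 2) <= e * x by rewrite ler_wpM2l; lra.
  lra.
by move=> h3; rewrite ler_norml; apply/andP; split; lra.
Qed.

Lemma poly_ln_estimate p : (1 < size p)%N -> exists K b : R, [/\ 0 < K, 1 <= b &
  forall z, b <= abs z -> p.[z] != 0 /\
    `|ln (abs p.[z]) - ln (abs (lead_coef p)) - (size p).-1%:R * ln (abs z)|
      <= K / abs z].
Proof.
move=> sp; have p0 : p != 0 by rewrite -size_poly_gt0 ltnW.
have a0 : 0 < abs (lead_coef p) by rewrite abs_gt0 lead_coef_eq0.
have [C C0 hC] := poly_lead_estimate p.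
set a := lead_coef p in a0 hC *; set n := (size p).-1 in hC *.
exists (2 * (C / abs a)), (Num.max 1 (2 * C / abs a)); split.
- by rewrite mulr_gt0// divr_gt0.
- by rewrite le_max lexx.
move=> z; rewrite ge_max => /andP[z1]; rewrite ler_pdivrMr// => zC.
have z0 : 0 < abs z by rewrite (lt_le_trans ltr01).
have zn0 : 0 < abs z ^+ n by rewrite exprn_gt0.
have an0 : 0 < abs a * abs z ^+ n by rewrite mulr_gt0.
set e := C / abs a / abs z.
have e2 : e <= 1 / 2.
  by rewrite /e ler_pdivrMr// ler_pdivrMr//; lra.
have near1 : `|abs p.[z] / (abs a * abs z ^+ n) - 1| <= e.
  have -> : abs p.[z] / (abs a * abs z ^+ n) - 1 =
      (abs p.[z] - abs a * abs z ^+ n) / (abs a * abs z ^+ n).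
    by rewrite mulrBl divff ?gt_eqF.
  rewrite normrM normfV (gtr0_norm an0) ler_pdivrMr//.
  have -> : e * (abs a * abs z ^+ n) = C * abs z ^+ n / abs z.
    by rewrite /e; field; rewrite !gt_eqF.
  rewrite ler_pdivlMr// (le_trans _ (hC z z1))// ler_wpM2r ?abs_ge0//.
  rewrite -/n -absX -absM ler_norml; apply/andP; split.
    by rewrite lerNl opprB absC absB.
  exact: absB.
have pz : p.[z] != 0.
  rewrite -abs_gt0 lt_neqAle abs_ge0 andbT; apply/eqP => h.
  by move: near1; rewrite -h mul0r sub0r normrN1; lra.
split=> //; have := ln_near1 near1 e2.
rewrite ln_div ?posrE ?abs_gt0// lnM ?posrE// lnXn// -(mulr_natl (ln _)) opprD addrA.
by rewrite /e mulrA.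
Qed.

End Asymptotics.

Section BackwardInvariantSets.
Variable R : realType.
Implicit Types (z w c x y : R[i]).

Lemma exprn_small (t e : R) : 0 <= t < 1 -> 0 < e ->
  exists2 m, (0 < m)%N & t ^+ m < e.
Proof.
move=> /andP[t0 t1] e0; have ht : `|t| < 1 by rewrite ger0_norm.
have [N _ hN] := cvgr0_norm_lt _ (cvg_expr ht) _ e0.
exists (maxn 1 N); first by rewrite leq_max.
have := hN (maxn 1 N) (leq_maxr _ _).
by rewrite /= ger0_norm ?exprn_ge0.
Qed.

Lemma seq_separated (ts : seq R[i]) : exists2 e : R, 0 < e &
  forall s t, s \in ts -> t \in ts -> s != t -> e <= abs (s - t).
Proof.
elim: ts => [|a ts [e e0 he]]; first by exists 1.
have [e' e'0 he'] : exists2 e' : R, 0 < e' &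
    forall t, t \in ts -> t != a -> e' <= abs (t - a).
  elim: ts {he} => [|b ts [e' e'0 he']]; first by exists 1.
  exists (if b == a then e' else Num.min e' (abs (b - a))).
    by case: eqVneq => // ba; rewrite lt_min e'0 abs_gt0 subr_eq0.
  move=> t; rewrite inE => /orP[/eqP->/negPf->|tts ta]; first by rewrite ge_min lexx orbT.
  by case: ifP => _; rewrite ?ge_min he'.
exists (Num.min e e') => [|s t]; first by rewrite lt_min e0.
rewrite !inE ge_min => /orP[/eqP->|sts] /orP[/eqP->|tts] st.
- by rewrite eqxx in st.
- by rewrite absC he' ?orbT// eq_sym.
- by rewrite he' ?orbT.
- by rewrite he.
Qed.

(** A point is at distance less than [e / 2] from at most one [s]. *)
Lemma separated_pigeonhole (ts ys : seq R[i]) (e : R) : uniq ts ->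
  (size ys < size ts)%N ->
  (forall s t, s \in ts -> t \in ts -> s != t -> e <= abs (s - t)) ->
  exists2 s, s \in ts & forall y, y \in ys -> e / 2 <= abs (y - s).
Proof.
move=> uts lt_sz sep; pose near s y := abs (y - s) < e / 2.
have [/hasP[s sts /hasPn hs]|/hasPn none] :=
  boolP (has (fun s => ~~ has (near s) ys) ts).
  by exists s => // y /hs; rewrite -leNgt.
have {}none s : s \in ts -> has (near s) ys.
  by move=> /none; rewrite negbK.
pose h s := nth 0 ys (find (near s) ys).
have hP s : s \in ts -> near s (h s) by move=> /none; exact: nth_find.
have h_ys s : s \in ts -> h s \in ys.
  by move=> /none; rewrite has_find => /(mem_nth 0).
have : uniq (map h ts).
  rewrite map_inj_in_uniq// => s t sts tts hst; apply/eqP/negPn/negP => st.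
  have := sep s t sts tts st; have := hP s sts; have := hP t tts.
  rewrite /near -hst; have := abs_dist_tri (h s) s t; rewrite (absC s (h s)).
  lra.
move/uniq_leq_size => /(_ ys); rewrite size_map leqNgt lt_sz.
by case/(_ _)/negP => // _ /mapP[s /h_ys ? ->].
Qed.

Lemma size_deriv_gt1 (f : {poly R[i]}) : (2 <= (size f).-1)%N -> (1 < size f^`())%N.
Proof.
move=> hf; rewrite ltnNge; apply/negP => /leq_sizeP/(_ (size f).-2).
have eqS : ((size f).-2.+1 = (size f).-1)%N by case: (size f) hf => [|[|[]]].
rewrite coef_deriv eqS -/(lead_coef f) => h.
have /eqP := h ltac:(by case: (size f) hf => [|[|[]]]).
rewrite -mulr_natr mulf_eq0 lead_coef_eq0 -size_poly_eq0 pnatr_eq0.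
by case: (size f) hf => [|[|[]]].
Qed.

(** If [T] were finite, [f] would permute it, so that each of its points [t] would
    have one preimage [h]. But [f = t + a (X - h)^d], where [d >= 2], has [h] as
    its only critical point, so that [h] and [t] would be the same for all [t]. *)
Lemma backward_invariant_infinite (f : {poly R[i]}) (T : set R[i]) t1 t2 :
  (2 <= (size f).-1)%N -> (forall z, T f.[z] -> T z) ->
  T t1 -> T t2 -> t1 != t2 -> infinite_set T.
Proof.
move=> hf fT T1 T2 t12 /finite_seqP[s0 Ts0]; pose s := undup s0.
have sf := size_gt1 hf.
have sP x : T x <-> x \in s by rewrite Ts0 mem_undup.
have us : uniq s := undup_uniq s0.
have surj t : exists x, f.[x] = t by exact: poly_surj.
pose h t := projT1 (cid (surj t)); have hK t : f.[h t] = t := projT2 (cid (surj t)).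
have h_s t : t \in s -> h t \in s by move=> /sP Tt; apply/sP/fT; rewrite hK.
have uh : uniq (map h s) by rewrite map_inj_uniq//; exact: can_inj hK.
have sub : {subset map h s <= s} by move=> _ /mapP[t ts ->]; exact: h_s.
have [_ eqs] := uniq_min_size uh sub (eq_leq (esym (size_map h s))).
have only x t : T t -> f.[x] = t -> x = h t.
  move=> Tt fx; have : x \in map h s by rewrite eqs; apply/sP/fT; rewrite fx.
  by move=> /mapP[t' _ xE]; rewrite xE -fx xE hK.
have crit t y : T t -> f^`().[y] = 0 -> y = h t.
  move=> Tt; have st : size (f - t%:P) = size f.
    by rewrite size_polyDl// size_polyN (leq_ltn_trans (size_polyC_leq1 _)).
  have [rs def_ft] := closed_field_poly_normal (f - t%:P).
  have lt : lead_coef (f - t%:P) != 0.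
    by rewrite lead_coef_eq0 -size_poly_gt0 st ltnW.
  have rsE : \prod_(z <- rs) ('X - z%:P) = ('X - (h t)%:P) ^+ size rs.
    rewrite -[RHS]iter_mulr_1 -count_predT -big_const_seq !big_seq.
    apply: eq_bigr => x xrs; congr ('X - _%:P); apply: only => //.
    have : root (f - t%:P) x by rewrite def_ft rootZ// root_prod_XsubC.
    by rewrite /root !hornerE subr_eq0 => /eqP.
  have srs : size rs = (size f).-1.
    by rewrite -st def_ft size_scale// size_prod_XsubC.
  have -> : f^`() = (f - t%:P)^`() by rewrite derivB derivC subr0.
  rewrite def_ft rsE derivZ deriv_exp derivB derivX derivC subr0 !hornerE hornerMn.
  rewrite !hornerE -mulr_natr => /eqP; rewrite !mulf_eq0 (negPf lt) srs pnatr_eq0.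
  rewrite expf_eq0 subr_eq0 /=; have -> : (size f).-1 == 0%N = false.
    by case: (size f) hf => [|[|[]]].
  by rewrite orbF => /andP[_ /eqP].
have root_crit t : T t -> f^`().[h t] = 0.
  move=> Tt; have [y fy] := poly_surj 0 (size_deriv_gt1 hf).
  by rewrite -(crit t y Tt fy).
by move/eqP: t12; apply; rewrite -(hK t1) -(crit t1 (h t2) T1 (root_crit t2 T2)) hK.
Qed.

(** The boundary of the filled Julia set lies in the closure of every infinite
    backward invariant set [T]. Suppose that the disc misses [T]; then the
    polynomials [f^n - s], [s] in [T], have no zeros on it. If [x] in the disc
    escaped, apply [sampled_mean_value] to them at the center: [ln |f^n - s|]
    is bounded above at the center, it is bounded below at the sample points,
    provided that [s] is chosen among [m] points of [T], depending on [n], so as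
    to avoid the [m - 1] values of [f^n] there, and at [x] it grows like
    [d^n G x]. Hence [G x <= theta^m] for all [m]. *)
Lemma filled_disc (f : {poly R[i]}) (T : set R[i]) c (r : R) :
  (2 <= (size f).-1)%N -> infinite_set T -> (forall z, T f.[z] -> T z) ->
  filled f c -> 0 < r -> (forall x, abs (x - c) < r -> ~ T x) ->
  forall x, abs (x - c) < r -> filled f x.
Proof.
move=> hf infT fT Kc r0 disj x xr; apply: contrapT => Kx.
have Gx := green_gt0 hf Kx; set v := x - c in xr.
pose th := abs v / r.
have th01 : 0 <= th < 1 by rewrite divr_ge0 ?abs_ge0 ?(ltW r0)//= ltr_pdivrMr// mul1r.
have vth : abs v <= th * r by rewrite divfK// gt_eqF.
have [m m0 hm] := exprn_small th01 Gx.
have [rs [srs rs1 mv]] := sampled_mean_value R m0.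
have [ts [uts sts tsT]] : exists ts : seq R[i],
    [/\ uniq ts, size ts = m & forall t, t \in ts -> T t].
  have [A AT cA] := infinite_set_fset m infT.
  exists (take m (finmap.enum_fset A)); split.
  - by rewrite take_uniq// finmap.fset_uniq.
  - by rewrite size_takel.
  - by move=> t /mem_take tA; apply: AT.
have [e e0 sep] := seq_separated ts.
have [S hS] : exists S : R, forall t, t \in ts -> abs t <= S.
  elim: ts {uts sts tsT sep} => [|a ts [S hS]]; first by exists 0.
  exists (Num.max (abs a) S) => t; rewrite inE => /orP[/eqP->|/hS].
    by rewrite le_max lexx.
  by rewrite le_max => ->; rewrite orbT.
have [B B0 hB] := filled_bounded hf.
have [C C0 hC] := green_approx hf.
(* Beyond this [n0], [|f^n x - s| >= (1 + |f^n x|) / 2] for all the [s] in [ts]. *)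
have [n0 hn0] := escaping_large hf (1 + S + S) Gx.
have iterT n z : T (iter n (horner f) z) -> T z by elim: n => //= n ih /fT.
suff : green f x <= th ^+ m by lra.
apply: (@le_pow_growth R f hf _ _ (C + ln 2 + m%:R * ln (1 + B + `|S|) - m.-1%:R * ln (e / 2)) n0).
move=> n /hn0 large.
have lt_sz : (size [seq iter n (horner f) (c + q * v)%R | q <- rs] < size ts)%N.
  by rewrite size_map srs sts prednK.
have [s sts' far] := separated_pigeonhole uts lt_sz sep.
pose p := poly_iter f n - s%:P.
have pE z : p.[z] = iter n (horner f) z - s by rewrite !hornerE horner_poly_iter.
have sp : (size p).-1 = ((size f).-1 ^ n)%N.
  rewrite -size_poly_iter size_polyDl// size_polyN.
  rewrite (leq_ltn_trans (size_polyC_leq1 _))//.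
  exact/size_poly_iter_gt1/size_gt1.
have zf : zero_free p c r.
  move=> z zr; rewrite pE subr_eq0; apply/eqP => h.
  by apply: (disj z zr); apply: (iterT n); rewrite h; exact: tsT.
have sample q : q \in rs -> ln (e / 2) <= ln (abs p.[c + q * v]).
  move=> qrs; have h : e / 2 <= abs p.[c + q * v].
    by rewrite pE; apply: far; apply/mapP; exists q.
  by rewrite ler_ln ?posrE// ?(lt_le_trans _ h) ?divr_gt0.
have := mv p c v r th (ln (e / 2)) r0 zf th01 vth sample.
rewrite sp natrX (_ : c + v = x) /v ?subrKC// => h.
have pc : ln (abs p.[c]) <= ln (1 + B + `|S|).
  rewrite ler_ln ?posrE ?abs_gt0 ?(zero_free_center r0 zf)//; last first.
    by rewrite ltr_pwDl// ltr_pwDl// ltW.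
  rewrite pE (le_trans (absBD _ _))// -addrA; have := hB c n Kc; have := hS s sts'.
  have := ler_norm S; lra.
have px : ln (1 + abs (iter n (horner f) x)) - ln 2 <= ln (abs p.[x]).
  rewrite -ln_div ?posrE ?ltr_pwDl ?abs_ge0//.
  have hx := absB (iter n (horner f) x) s; have hs := hS s sts'.
  rewrite ler_ln ?posrE ?pE; first by lra.
    by rewrite divr_gt0// ltr_pwDl ?abs_ge0.
  have := abs_ge0 s; lra.
have := hC x n; rewrite ler_norml => /andP[hx _].
have : m%:R * ln (abs p.[c]) <= m%:R * ln (1 + B + `|S|) by rewrite ler_wpM2l.
lra.
Qed.

(** If [f] and [g] share a bounded invariant set [T], the maximum principle on
    the filled Julia set of [f] carries the bounds on [g^n] from [T] to it. *)
Lemma filled_sub_bounded (f g : {poly R[i]}) (T : set R[i]) t1 t2 (M : R) :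
  (2 <= (size f).-1)%N -> (2 <= (size g).-1)%N ->
  (forall z, T f.[z] -> T z) -> (forall z, T z -> T g.[z]) ->
  T t1 -> T t2 -> t1 != t2 -> (forall t, T t -> abs t <= M) ->
  filled f `<=` filled g.
Proof.
move=> hf hg fT gT T1 T2 t12 TM z Kz; exists M => n.
have infT := backward_invariant_infinite hf fT T1 T2 t12.
have [B B0 hB] := filled_bounded hf.
rewrite -horner_poly_iter.
apply: (@poly_max_principle R (poly_iter g n) (filled f) T B M) => //.
- exact/size_poly_iter_gt1/size_gt1.
- by rewrite (le_trans (abs_ge0 t1))// TM.
- by move=> y Ky; exact: (hB y 0%N).
- move=> t Tt; rewrite horner_poly_iter; apply: TM.
  by elim: n => //= n ih; exact: gT.
- by move=> y r Ky r0 disj x xr; exact: (filled_disc hf infT fT Ky r0 disj).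
Qed.

End BackwardInvariantSets.

(** * Invariant sets are unions of levels of the escape rate *)

Section Saturation.
Variable R : realType.
Implicit Types (z w x y : R[i]).
Variable f : {poly R[i]}.
Hypothesis hf : (2 <= (size f).-1)%N.
Local Notation d := (size f).-1.
Local Notation G := (green f).
Local Notation F n z := (iter n (horner f) z).

Lemma ln_gap x y : ln (1 + abs y) + ln 2 <= ln (1 + abs x) ->
  ln (1 + abs x) - ln 2 <= ln (abs (x - y)).
Proof.
have oneD z : 0 < 1 + abs z by rewrite ltr_pwDl ?abs_ge0.
rewrite -lnM ?posrE// ler_ln ?posrE ?mulr_gt0// => h.
rewrite -ln_div ?posrE//; have := absB x y; have := abs_ge0 y => ? ?.
by rewrite ler_ln ?posrE; lra.
Qed.

Lemma pow_growth_ge (b e : R) : 0 < e ->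
  exists n0, forall n, (n0 <= n)%N -> b <= d%:R ^+ n * e.
Proof.
move=> e0; have [n0 hn0] := archi_mul b e0; exists n0 => n hn.
rewrite (le_trans (ltW hn0))// ler_wpM2r ?(ltW e0)// -natrX ler_nat.
by rewrite (leq_trans hn)// ltnW// ltn_expl.
Qed.

Variables (S : set R[i]) (B : R).
Hypothesis fS : forall z, S f.[z] <-> S z.
Hypothesis closedS : forall w, ~ S w ->
  exists2 r : R, 0 < r & forall x, abs (x - w) < r -> ~ S x.
Hypothesis filledB : forall a, filled f a -> abs a <= B.

Lemma iter_inv n z : S (F n z) <-> S z.
Proof. by elim: n => //= n ih; rewrite fS. Qed.

(** A closed completely invariant set is a union of level sets of [G] outside
    the disc of radius [B]. If [S z], the polynomials [f^n - f^n z] have all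
    their roots in [S]; were [w] on the level of [z] but outside [S], they would
    have no zeros near [w]. But the [n]-th one has logarithm about
    [d^n max (G y) (G w)] at [y], and [max G (G w)] fails the minimum principle
    at [w]: it is larger than [G w] at the points [t w], [t > 1]. For points [y]
    whose level is close to that of [w], the lower bound is obtained from
    [t y] by Harnack's inequality. *)
Lemma green_saturated z w : S z -> B < abs w -> G z = G w -> S w.
Proof.
move=> Sz Bw Gzw; apply: contrapT => Sw; set a := G w in Gzw.
have [r r0 disj] := closedS Sw.
pose rho := Num.min r (abs w - B).
have rho0 : 0 < rho by rewrite lt_min r0 subr_gt0.
have rhor : rho <= r by rewrite ge_min lexx.
have rhoB : rho <= abs w - B by rewrite ge_min lexx orbT.
have B0 : 0 <= B by have [k /filledB] := filled_nonempty hf; exact/le_trans/abs_ge0.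
have w0 : 0 < abs w by lra.
have [C C0 hC] := green_approx hf.
pose p n := poly_iter f n - (F n z)%:P.
have pE n y : (p n).[y] = F n y - F n z by rewrite !hornerE horner_poly_iter.
have sp n : (size (p n)).-1 = (d ^ n)%N.
  rewrite -size_poly_iter size_polyDl// size_polyN.
  rewrite (leq_ltn_trans (size_polyC_leq1 _))//.
  exact/size_poly_iter_gt1/size_gt1.
have zf n : zero_free (p n) w rho.
  move=> y yr; rewrite pE subr_eq0; apply/eqP => h.
  apply: (disj y (lt_le_trans yr rhor)).
  by apply/(iter_inv n); rewrite h; apply/iter_inv.
have approx n y : d%:R ^+ n * G y - C <= ln (1 + abs (F n y)) <= d%:R ^+ n * G y + C.
  by have := hC y n; rewrite ler_norml => /andP[? ?]; apply/andP; split; lra.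
have up n : ln (abs (p n).[w]) <= d%:R ^+ n * a + (C + ln 2).
  have pw := zero_free_center rho0 (zf n).
  have oneD y : 0 < 1 + abs y by rewrite ltr_pwDl ?abs_ge0.
  have eC y : G y = a -> 1 + abs (F n y) <= expR (d%:R ^+ n * a + C).
    move=> Gy; rewrite -[leLHS]lnK ?posrE// ler_expR.
    by have /andP[_] := approx n y; rewrite Gy.
  have h : abs (p n).[w] <= 2 * expR (d%:R ^+ n * a + C).
    rewrite pE (le_trans (absBD _ _))//; have := eC w erefl; have := eC z Gzw; lra.
  rewrite (le_trans (y := ln (2 * expR (d%:R ^+ n * a + C))))//.
    by rewrite ler_ln ?posrE ?mulr_gt0 ?expR_gt0 ?abs_gt0.
  by rewrite lnM ?posrE ?expR_gt0// expRK; lra.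
have low (e : R) : 0 < e -> exists n0, forall n, (n0 <= n)%N ->
    forall y, abs (y - w) <= rho / 2 ->
    d%:R ^+ n * (a - e) - (C + ln 2) <= ln (abs (p n).[y]).
  (* [1 + s] is close enough to [1] for [(1 + s) y] to stay in the disc, and for
     Harnack's inequality between [y] and [(1 + s) y] to cost at most [d^n e]. *)
  move=> e0; pose th := Num.min e (1 / 2).
  have th0 : 0 < th by rewrite lt_min e0 divr_gt0.
  have the : th <= e by rewrite ge_min lexx.
  have th2 : th <= 1 / 2 by rewrite ge_min lexx orbT.
  have wr0 : 0 < abs w + rho by lra.
  pose s := th * (rho / 2) / (abs w + rho).
  have s0 : 0 < s by rewrite divr_gt0// mulr_gt0// divr_gt0.
  have lt0 : 0 < ln (1 + s) by rewrite ln_gt0// ltrDl.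
  have [n0 hn0] := pow_growth_ge (C + C + ln 2) (divr_gt0 lt0 (ltr0n R 4)).
  exists n0 => n /hn0 hn y yw.
  have dn0 : 0 < d%:R ^+ n :> R.
    by rewrite exprn_gt0// ltr0n (leq_trans _ hf).
  have yup : abs y <= abs w + rho / 2 by have := absD (y - w) w; rewrite subrK; lra.
  have ylo : abs w - rho / 2 <= abs y by have := absB w y; rewrite absC in yw; lra.
  have [Gy|Gy] := leP (G y) (a - ln (1 + s) / 4).
    have /andP[h1 _] := approx n z; have /andP[_ h2] := approx n y.
    have h3 : d%:R ^+ n * G y <= d%:R ^+ n * (a - ln (1 + s) / 4) by rewrite ler_pM2l.
    have h4 : 0 <= d%:R ^+ n * e by rewrite mulr_ge0// ltW.
    rewrite pE absC (le_trans _ (@ln_gap _ _ _))//; rewrite Gzw mulrBr in h1 h3 *; lra.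
  have Gty : G y + ln (1 + s) / 2 <= G ((1 + s)%:C * y).
    by apply: (green_radial hf filledB); lra.
  set y' := _ * y in Gty.
  have yy' : abs (y' - y) <= th * (rho / 2).
    have -> : y' - y = s%:C * y by rewrite /y' rmorphD mulrDl mul1r addrC addKr.
    rewrite abs_scale gtr0_norm// (le_trans (y := s * (abs w + rho)))//.
      by rewrite ler_pM2l//; lra.
    by rewrite /s divfK// gt_eqF.
  have th_rho : th * (rho / 2) <= 1 / 2 * (rho / 2) by rewrite ler_wpM2r//; lra.
  have /andP[_ h1] := approx n z; have /andP[h2 _] := approx n y'.
  have h3 : d%:R ^+ n * (a + ln (1 + s) / 4) <= d%:R ^+ n * G y'.
    by rewrite ler_pM2l//; lra.
  have h4 : ln (1 + abs (F n y')) - ln 2 <= ln (abs (p n).[y']).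
    by rewrite pE ln_gap//; rewrite Gzw mulrDr in h1 h3; lra.
  have zfy : zero_free (p n) y (rho / 2).
    move=> x xy; apply: zf; have := abs_dist_tri y x w; lra.
  have py' : (p n).[y'] != 0.
    by apply: zfy; lra.
  have rho20 : 0 < rho / 2 by lra.
  have := ln_harnack_poly rho20 zfy (ltW th0) yy' py'; rewrite sp natrX.
  have : d%:R ^+ n * th <= d%:R ^+ n * e by rewrite ler_pM2l.
  have h5 : 0 <= d%:R ^+ n * (ln (1 + s) / 4).
    by rewrite mulr_ge0 ?(ltW dn0)// divr_ge0// ltW.
  by rewrite mulrBr; rewrite mulrDr in h3; lra.
pose s := rho / 2 / abs w.
have s0 : 0 < s by rewrite !divr_gt0.
have ls0 : 0 < ln (1 + s) by rewrite ln_gt0// ltrDl.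
pose del := ln (1 + s) / 2; have del0 : 0 < del by rewrite divr_gt0.
have Gw' : a + del <= G ((1 + s)%:C * w).
  by apply: (green_radial hf filledB) => //; lra.
have vE : (1 + s)%:C * w = w + s%:C * w by rewrite rmorphD mulrDl mul1r.
rewrite vE in Gw'; set v := s%:C * w in Gw'.
have vr : abs v <= 1 / 2 * rho.
  rewrite abs_scale gtr0_norm// /s divfK ?gt_eqF//; lra.
have half : (0 <= (1 / 2 : R)) && ((1 / 2 : R) < 1) by lra.
have del20 : 0 < del / 2 by rewrite divr_gt0.
have [m m0 hm] := exprn_small half del20.
have [rs [srs rs1 mv]] := sampled_mean_value R m0.
(* The [m - 1] lower bounds at the sample points lose [e] each. *)
pose e := del / 2 / m%:R.
have mR : 0 < m%:R :> R by rewrite ltr0n.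
have e0 : 0 < e by rewrite divr_gt0.
have m1 : m.-1%:R = m%:R - 1 :> R by rewrite -[in RHS](prednK m0) -natr1 addrK.
have me : m.-1%:R * e <= del / 2.
  by rewrite m1 /e mulrBl mul1r mulrC divfK ?gt_eqF// gerBl divr_ge0// ltW.
have [n1 hn1] := low e e0.
have [n2 hn2] := pow_growth_ge (C + C + ln 2) del0.
suff : a + del <= a + m.-1%:R * e + (1 / 2) ^+ m by lra.
apply: (@le_pow_growth R f hf _ _ (C + ln 2 + m%:R * (C + ln 2) + m.-1%:R * (C + ln 2)) (maxn n1 n2)).
move=> n; rewrite geq_max => /andP[/hn1 h1 /hn2 h2].
have dn0 : 0 < d%:R ^+ n :> R by rewrite exprn_gt0// ltr0n (leq_trans _ hf).
have sample q : q \in rs ->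
    d%:R ^+ n * (a - e) - (C + ln 2) <= ln (abs (p n).[w + q * v]).
  by move=> /rs1 q1; apply: h1; rewrite addrC addKr absM q1 mul1r; lra.
have := mv (p n) w v rho (1 / 2) _ rho0 (zf n) half vr sample.
rewrite sp natrX => h3.
have h4 : ln (1 + abs (F n (w + v))) - ln 2 <= ln (abs (p n).[w + v]).
  have /andP[_ g1] := approx n z; have /andP[g2 _] := approx n (w + v).
  have g3 : d%:R ^+ n * (a + del) <= d%:R ^+ n * G (w + v) by rewrite ler_pM2l.
  by rewrite pE ln_gap//; rewrite Gzw mulrDr in g1 g3; lra.
have /andP[h5 _] := approx n (w + v).
have h6 : d%:R ^+ n * (a + del) <= d%:R ^+ n * G (w + v) by rewrite ler_pM2l.
have h7 : m%:R * ln (abs (p n).[w]) <= m%:R * (d%:R ^+ n * a + (C + ln 2)).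
  by rewrite ler_wpM2l// ltW.
rewrite m1 in h3 *; lra.
Qed.

End Saturation.

(** * Level curves of the escape rate *)

Section RealLine.
Variable R : realType.
Implicit Types (f : R -> R) (a b v x y r : R).

Lemma lipschitz_IVT f a b v (L : R) : a <= b ->
  (forall x y, a <= x <= b -> a <= y <= b -> `|f x - f y| <= L * `|x - y|) ->
  Num.min (f a) (f b) <= v <= Num.max (f a) (f b) ->
  exists2 c, a <= c <= b & f c = v.
Proof.
move=> ab fL hv; have [|c cab fc] := @IVT R f a b v ab _ hv; last by exists c.
apply/subspace_continuousP => x; rewrite /= in_itv /= => xab.
apply/cvgrPdist_lt => e e0; have L1 : 0 < `|L| + 1 by rewrite ltr_wpDl.
rewrite near_withinE; apply/nbhs_ballP.
exists (e / (`|L| + 1)); first by rewrite /= divr_gt0.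
move=> y /= yx; rewrite in_itv /= => yab.
rewrite (le_lt_trans (fL x y xab yab))//.
rewrite (@le_lt_trans _ _ ((`|L| + 1) * `|x - y|))//.
  by rewrite ler_wpM2r// (le_trans (ler_norm L))// lerDl.
by rewrite mulrC -ltr_pdivlMr.
Qed.

Lemma mvt_lipschitz f (df : R -> R) : (forall x, is_derive x 1 f (df x)) ->
  (forall x, `|df x| <= 1) -> forall x y, `|f x - f y| <= `|x - y|.
Proof.
move=> hd h1; suff le x y : x <= y -> `|f x - f y| <= `|x - y|.
  move=> x y; have [/le//|/ltW/le] := leP x y.
  by rewrite distrC (distrC y).
move=> xy; have cf : {within `[x, y], continuous f}.
  apply: continuous_subspaceT => z.
  by apply/differentiable_continuous/derivable1_diffP; case: (hd z).
have [c _ fxy] := MVT_segment xy (fun z _ => hd z) cf.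
by rewrite distrC fxy normrM (distrC x) ler_piMl.
Qed.

Lemma sub_le_ln x y : 0 < x -> 0 < y -> x - y <= x * (ln x - ln y).
Proof.
move=> x0 y0; have : ln (y / x) <= y / x - 1.
  by rewrite -{1}(subrKC 1 (y / x)) le_ln1Dx// ltrBrDr addNr divr_gt0.
rewrite ln_div ?posrE// -(ler_pM2l x0) [x * (y / x - 1)]mulrBr mulr1.
by rewrite mulrCA divff ?gt_eqF// mulr1; lra.
Qed.

End RealLine.

Section LevelCurves.
Variable R : realType.
Implicit Types (z w x y u : R[i]).

Definition cis (t : R) : R[i] := (cos t +i* sin t)%C.

Lemma abs_cis t : abs (cis t) = 1.
Proof. by rewrite /ComplexField.Normc.normc /= cos2Dsin2 sqrtr1. Qed.

Lemma cis_surj u : abs u = 1 -> exists t, u = cis t.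
Proof.
move=> u1; have := abs_sqr u; rewrite u1 expr1n => sq.
have re : -1 <= complex.Re u <= 1 by rewrite -ler_norml -u1 abs_Re.
have itv : complex.Re u \in `[-1, 1] by rewrite in_itv.
have sE : Num.sqrt (1 - complex.Re u ^+ 2) = `|complex.Im u|.
  by rewrite sq addrAC subrr add0r sqrtr_sqr.
have uE : u = (complex.Re u +i* complex.Im u)%C by case: (u).
have [im|im] := leP 0 (complex.Im u).
  by exists (acos (complex.Re u)); rewrite /cis acosK// sin_acos// sE ger0_norm.
exists (- acos (complex.Re u)).
by rewrite /cis cosN sinN acosK// sin_acos// sE ltr0_norm// opprK.
Qed.

Lemma cis_lipschitz s t : abs (cis s - cis t) <= 2 * `|s - t|.
Proof.
have hc : `|cos s - cos t| <= `|s - t|.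
  apply: (mvt_lipschitz (@is_derive_cos R)) => x.
  by rewrite normrN sin_max.
have hs : `|sin s - sin t| <= `|s - t|.
  by apply: (mvt_lipschitz (@is_derive_sin R)) => x; exact: cos_max.
by rewrite (le_trans (abs_ReIm _))//= ; lra.
Qed.

Variable f : {poly R[i]}.
Hypothesis hf : (2 <= (size f).-1)%N.
Local Notation G := (green f).

Variables B C tb : R.
Hypothesis filledB : forall a, filled f a -> abs a <= B.
Hypothesis greenC : forall z, `|ln (1 + abs z) - G z| <= C.
Hypothesis baseB : forall z, tb < G z -> B + 1 < abs z.

Let B0 : 0 <= B.
Proof. by have [k /filledB] := filled_nonempty hf; exact/le_trans/abs_ge0. Qed.

Let oneD z : 0 < 1 + abs z. Proof. by rewrite ltr_pwDl ?abs_ge0. Qed.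

Lemma level_bound z t : G z <= t -> abs z <= expR (t + C).
Proof.
move=> Gz; have : 1 + abs z <= expR (t + C).
  rewrite -[leLHS]lnK ?posrE// ler_expR.
  by have := greenC z; rewrite ler_norml => /andP[? ?]; lra.
lra.
Qed.

Lemma scaled_unit (r : R) u : 0 <= r -> abs u = 1 -> abs (r%:C * u) = r.
Proof. by move=> r0 u1; rewrite abs_scale u1 mulr1 ger0_norm. Qed.

Lemma level_point u t : abs u = 1 -> tb < t ->
  exists2 r : R, B + 1 < r & G (r%:C * u) = t.
Proof.
move=> u1 tbt; pose r1 := B + 1 + expR (t + C).
have r1B : B + 1 <= r1 by rewrite lerDl expR_ge0.
have [||r /andP[Br _] Gr] := @lipschitz_IVT R (fun r => G (r%:C * u)) (B + 1) r1 t 1 r1B.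
- move=> x y /andP[Bx _] /andP[By _]; rewrite mul1r.
  have x0 : 0 <= x by rewrite (le_trans _ Bx)// addr_ge0.
  have y0 : 0 <= y by rewrite (le_trans _ By)// addr_ge0.
  have xyE : abs (x%:C * u - y%:C * u) = `|x - y|.
    by rewrite -mulrBl -rmorphB abs_scale u1 mulr1.
  have h1 := @green_lipschitz R f hf B (x%:C * u) (y%:C * u) filledB.
  have h2 := @green_lipschitz R f hf B (y%:C * u) (x%:C * u) filledB.
  rewrite !scaled_unit// in h1 h2.
  have {}h1 := h1 Bx; have {}h2 := h2 By.
  rewrite absC xyE in h1; rewrite xyE in h2.
  by rewrite ler_norml; apply/andP; split; lra.
- rewrite ge_min le_max; apply/andP; split.
    apply/orP; left; rewrite leNgt; apply/negP => h.
    by have := baseB (lt_trans tbt h); rewrite scaled_unit ?ltxx// addr_ge0.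
  apply/orP; right.
  have := greenC (r1%:C * u); rewrite scaled_unit//; last first.
    by rewrite (le_trans _ r1B)// addr_ge0.
  have : t + C <= ln (1 + r1).
    rewrite -[leLHS]expRK ler_ln ?posrE ?expR_gt0//.
      by rewrite /r1; have := B0; lra.
    by rewrite ltr_pwDl// (le_trans _ r1B)// addr_ge0.
  by rewrite ler_norml => ? /andP[? ?]; lra.
exists r => //; have := @baseB (r%:C * u); rewrite Gr => /(_ tbt).
by rewrite scaled_unit// (le_trans _ Br)// addr_ge0.
Qed.

Lemma green_radial_ln (r r' : R) u : abs u = 1 -> B < r -> r <= r' ->
  (ln r' - ln r) / 2 <= G (r'%:C * u) - G (r%:C * u).
Proof.
move=> u1 Br rr'; have r0 : 0 < r by rewrite (le_lt_trans _ Br).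
have r'0 : 0 < r' by rewrite (lt_le_trans r0).
have := @green_radial R f hf B (r%:C * u) (r' / r) filledB.
rewrite scaled_unit ?(ltW r0)// ler_pdivlMr// mul1r ln_div ?posrE// => /(_ Br rr').
rewrite mulrA -rmorphM /= divfK ?gt_eqF//; lra.
Qed.

(** In polar coordinates a level curve has a Lipschitz radius: [G] increases by
    at least [ln (r / r') / 2] along a ray, and by at most the distance between
    two points. *)
Lemma level_lipschitz t (r r' M : R) u u' : tb < t -> abs u = 1 -> abs u' = 1 ->
  B + 1 < r -> B + 1 < r' -> G (r%:C * u) = t -> G (r'%:C * u') = t ->
  r <= M -> r' <= M ->
  abs (r%:C * u - r'%:C * u') <= (2 * M ^+ 2 + M) * abs (u - u').
Proof.
move=> tbt; wlog le_r : r r' u u' / r' <= r.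
  move=> wl u1 u'1 Br Br' Gr Gr' rM r'M; have [le_r|/ltW le_r] := leP r' r.
    exact: wl.
  by rewrite (absC (r%:C * u)) (absC u u'); exact: wl.
move=> u1 u'1 Br Br' Gr Gr' rM r'M.
have r0 : 0 < r by have := B0; lra.
have r'0 : 0 < r' by have := B0; lra.
have h1 : G (r%:C * u') <= t + r * abs (u - u').
  have := @green_lipschitz R f hf B (r%:C * u) (r%:C * u') filledB.
  rewrite scaled_unit ?(ltW r0)// => /(_ (ltW Br)).
  by rewrite -mulrBr abs_scale gtr0_norm// Gr (absC u').
have Br'' : B < r' by lra.
have := green_radial_ln u'1 Br'' le_r; rewrite Gr' => h2.
have h3 : r - r' <= 2 * M ^+ 2 * abs (u - u').
  rewrite (le_trans (sub_le_ln r0 r'0))//.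
  apply: (@le_trans _ _ (r * (2 * (r * abs (u - u'))))).
    by rewrite ler_pM2l//; lra.
  rewrite (_ : r * _ = 2 * r ^+ 2 * abs (u - u')); last by ring.
  rewrite ler_wpM2r ?abs_ge0// ler_pM2l// ler_pXn2r// nnegrE ltW//.
  exact: lt_le_trans rM.
rewrite (_ : _ - _ = (r - r')%:C * u + r'%:C * (u - u')); last first.
  by rewrite rmorphB; ring.
rewrite (le_trans (absD _ _))// !abs_scale u1 mulr1 ger0_norm ?subr_ge0//.
by rewrite gtr0_norm// mulrDl lerD// ler_wpM2r ?abs_ge0.
Qed.

Lemma level_point_uniq (r r' : R) u : abs u = 1 -> B < r -> B < r' ->
  G (r%:C * u) = G (r'%:C * u) -> r = r'.
Proof.
move=> u1; wlog rr' : r r' / r <= r'.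
  move=> wl Br Br' GG; have [rr'|/ltW rr'] := leP r r'; first exact: wl.
  by apply/esym/wl.
move=> Br Br' GG; apply/eqP; rewrite eq_le rr' /=.
have := green_radial_ln u1 Br rr'; rewrite GG subrr => h.
have := B0 => hB0; rewrite -ler_ln ?posrE; lra.
Qed.

(** Outside the disc of radius [B] the level curves of [G] are graphs over the
    circle, hence connected. *)
Lemma level_IVT (phi : R[i] -> R) t (L : R) z1 z2 s : tb < t ->
  (forall z z', G z = t -> G z' = t -> `|phi z - phi z'| <= L * abs (z - z')) ->
  G z1 = t -> G z2 = t -> phi z1 <= s <= phi z2 ->
  exists2 z, G z = t & phi z = s.
Proof.
move=> tbt phiL G1 G2 hs.
have [|rad hrad] := @choice R[i] R (fun u r => abs u = 1 ->
    B + 1 < r /\ G (r%:C * u) = t).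
  move=> u; have [u1|u1] := pselect (abs u = 1); last by exists 0.
  by have [r Br Gr] := level_point u1 tbt; exists r.
pose M := expR (t + C).
have radM u : abs u = 1 -> rad u <= M.
  move=> u1; have [Br Gr] := hrad u u1.
  have := @level_bound ((rad u)%:C * u) t; rewrite Gr lexx scaled_unit//; first exact.
  by have := B0; lra.
pose path (x : R) := (rad (cis x))%:C * cis x.
have pathG (x : R) : G (path x) = t by have [] := hrad _ (abs_cis x).
have path_surj z : G z = t -> exists x : R, z = path x.
  move=> Gz; have Bz : B + 1 < abs z by apply: baseB; rewrite Gz.
  have z0 : 0 < abs z by have := B0; lra.
  have [x xE] : exists x : R, z / (abs z)%:C = cis x.
    by apply: cis_surj; rewrite absM absV abs_real ger0_norm ?abs_ge0// divff ?gt_eqF.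
  have zE : z = (abs z)%:C * cis x.
    by rewrite -xE mulrC divfK// eq_complex /= eqxx andbT gt_eqF.
  exists x; rewrite {1}zE /path; congr (_%:C * _); apply/eqP.
  have [Br Gr] := hrad _ (abs_cis x).
  have Gz' : G ((abs z)%:C * cis x) = t by rewrite -zE.
  by apply/eqP; apply: (level_point_uniq (abs_cis x)); rewrite ?Gz'//; have := B0; lra.
have phi_path (x y : R) : `|phi (path x) - phi (path y)| <=
    `|L| * (2 * M ^+ 2 + M) * 2 * `|x - y|.
  rewrite (le_trans (phiL _ _ (pathG x) (pathG y)))//.
  have [Bx Gx] := hrad _ (abs_cis x); have [By Gy] := hrad _ (abs_cis y).
  have h := level_lipschitz tbt (abs_cis x) (abs_cis y) Bx By Gx Gy
    (radM _ (abs_cis x)) (radM _ (abs_cis y)).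
  rewrite -!mulrA (le_trans (y := `|L| * abs (path x - path y)))//.
    by rewrite ler_wpM2r ?abs_ge0// ler_norm.
  rewrite ler_wpM2l// (le_trans h)// ler_wpM2l//.
    by rewrite addr_ge0 ?mulr_ge0 ?exprn_ge0 ?expR_ge0.
  exact: cis_lipschitz.
have [x1 def_z1] := path_surj z1 G1; have [x2 def_z2] := path_surj z2 G2.
move: hs; rewrite def_z1 def_z2 => /andP[hs1 hs2].
have [x12|/ltW x21] := leP x1 x2.
  have [||c _ hc] := @lipschitz_IVT R (phi \o path) x1 x2 s (`|L| * (2 * M ^+ 2 + M) * 2) x12.
  - by move=> x y _ _; exact: phi_path.
  - by rewrite ge_min le_max /= hs1 hs2 orbT.
  - by exists (path c).
have [||c _ hc] := @lipschitz_IVT R (phi \o path) x2 x1 s (`|L| * (2 * M ^+ 2 + M) * 2) x21.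
- by move=> x y _ _; exact: phi_path.
- by rewrite ge_min le_max /= hs1 hs2 !orbT.
- by exists (path c).
Qed.

Lemma level_near z t (e : R) : tb < t -> G z = t -> 0 < e ->
  exists2 eta : R, 0 < eta & forall t', `|t' - t| < eta ->
    exists2 z', G z' = t' & abs (z' - z) < e.
Proof.
move=> tbt Gz e0; pose M := expR (t + 1 + C).
have M0 : 0 < M by exact: expR_gt0.
have Bz : B + 1 < abs z by apply: baseB; rewrite Gz.
have z0 : 0 < abs z by have := B0; lra.
pose u := z / (abs z)%:C.
have u1 : abs u = 1.
  by rewrite absM absV abs_real ger0_norm ?abs_ge0// divff ?gt_eqF.
have zE : z = (abs z)%:C * u.
  by rewrite mulrC divfK// eq_complex /= eqxx andbT gt_eqF.
exists (Num.min (Num.min 1 (t - tb)) (e / (2 * M))) => [|t'].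
  by rewrite !lt_min ltr01 subr_gt0 tbt divr_gt0// mulr_gt0.
rewrite !lt_min ltr_pdivlMr ?mulr_gt0// -andbA => /and3P[].
rewrite !ltr_norml => /andP[t1 t2] /andP[t3 t4] ht.
have [|r Br Gr] := @level_point u t' u1; first by lra.
exists (r%:C * u) => //; rewrite {1}zE -mulrBl -rmorphB abs_scale u1 mulr1.
have r0 : 0 < r by have := B0; lra.
have rM : r <= M.
  have := @level_bound (r%:C * u) t'; rewrite Gr scaled_unit ?(ltW r0)// => /(_ (lexx _)).
  by move=> /le_trans; apply; rewrite ler_expR; lra.
have zM : abs z <= M.
  by apply: level_bound; rewrite Gz; lra.
have Gz' : G ((abs z)%:C * u) = t by rewrite -zE.
have M2 : 0 <= 2 * `|t' - t| by rewrite mulr_ge0.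
have Br' : B < r by lra.
have Bz' : B < abs z by lra.
have [rz|/ltW zr] := leP r (abs z).
  have := green_radial_ln u1 Br' rz; rewrite Gr Gz' => h.
  have h2 := ler_norm (t - t'); rewrite distrC in h2.
  rewrite ler0_norm ?subr_le0// opprB (le_lt_trans (sub_le_ln z0 r0))//.
  have h3 : abs z * (ln (abs z) - ln r) <= abs z * (2 * `|t' - t|).
    by rewrite ler_pM2l//; lra.
  have h4 : abs z * (2 * `|t' - t|) <= M * (2 * `|t' - t|) by rewrite ler_wpM2r.
  lra.
have := green_radial_ln u1 Bz' zr; rewrite Gr Gz' => h.
have h2 := ler_norm (t' - t).
rewrite ger0_norm ?subr_ge0// (le_lt_trans (sub_le_ln r0 z0))//.
have h3 : r * (ln r - ln (abs z)) <= r * (2 * `|t' - t|).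
  by rewrite ler_pM2l//; lra.
have h4 : r * (2 * `|t' - t|) <= M * (2 * `|t' - t|) by rewrite ler_wpM2r.
lra.
Qed.

End LevelCurves.

(** * The escape rate near infinity *)

Section GreenAtInfinity.
Variable R : realType.
Implicit Types (p : {poly R[i]}) (z w x y : R[i]).

Lemma poly_far p (b : R) : (1 < size p)%N ->
  exists b' : R, forall z, b' <= abs z -> b < abs p.[z].
Proof.
move=> sp; have [b0 b01 hb0] := poly_large sp.
have a0 : 0 < abs (lead_coef p).
  by rewrite abs_gt0 lead_coef_eq0 -size_poly_gt0 ltnW.
exists (Num.max b0 (`|b| * (2 / abs (lead_coef p)) + 1)) => z.
rewrite ge_max => /andP[/[dup] bz /hb0/andP[h _] zb].
have z1 : 1 <= abs z by rewrite (le_trans b01).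
rewrite (lt_le_trans _ h)//.
have : abs z <= abs z ^+ (size p).-1.
  by rewrite -{1}(expr1 (abs z)) ler_weXn2l//; case: (size p) sp => [|[]].
rewrite -(ler_pM2l (divr_gt0 a0 (ltr0n R 2))) => /(lt_le_trans _); apply.
rewrite (le_lt_trans (ler_norm b))//.
have : `|b| * (2 / abs (lead_coef p)) < abs z by lra.
by rewrite -(ltr_pM2l (divr_gt0 a0 (ltr0n R 2))) mulrCA -invf_div mulVf ?mulr1// gt_eqF// divr_gt0.
Qed.

Variable f : {poly R[i]}.
Hypothesis hf : (2 <= (size f).-1)%N.
Local Notation G := (green f).
Local Notation d := (size f).-1.

Lemma green_far (b : R) : exists2 t : R, 0 <= t & forall z, t < G z -> b < abs z.
Proof.
have [C C0 hC] := green_approx hf.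
exists (ln (1 + `|b|) + C) => [|z]; first by rewrite addr_ge0// ln_ge0// lerDl.
apply: contraPlt => zb; apply/negP; rewrite -leNgt.
have := hC z 0%N; rewrite expr0 mul1r ler_norml => /andP[h _].
have : ln (1 + abs z) <= ln (1 + `|b|).
  rewrite ler_ln ?posrE ?ltr_pwDl ?abs_ge0// lerD2l (le_trans zb)//.
  exact: ler_norm.
by move: h => /=; lra.
Qed.

(** [D z = G z - ln |z| - c] is bounded near infinity, and [D (f z)] is
    [d D z + O(1/|z|)]. As [|f z| >= 2 |z|], iterating this relation gives
    [D z = O(1/|z|)]. *)
Lemma green_asymptotic : exists c K b : R, [/\ 0 < K, 1 <= b &
  forall z, b <= abs z -> `|G z - ln (abs z) - c| <= K / abs z].
Proof.
set a := abs (lead_coef f).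
have sf := size_gt1 hf; have [C C0 hC] := green_approx hf.
have dR : 2 <= d%:R :> R by rewrite ler_nat.
have a0 : 0 < a by rewrite abs_gt0 lead_coef_eq0 -size_poly_gt0 ltnW.
have [K0 [b0 [K00 b01 hK0]]] := poly_ln_estimate sf.
have [b1 b11 hb1] := poly_large sf.
pose b := Num.max b0 (Num.max b1 (4 / a)).
have bP z : b <= abs z -> [/\ b0 <= abs z, b1 <= abs z & 4 / a <= abs z].
  by rewrite !ge_max => /and3P.
pose c := ln a / (d%:R - 1).
have cE : (d%:R - 1) * c = ln a by rewrite mulrC divfK// gt_eqF//; lra.
have double z : b <= abs z -> 2 * abs z <= abs f.[z].
  move=> /bP[z0 /hb1/andP[h _]]; rewrite ler_pdivrMr// => z4.
  have z1 : 1 <= abs z by rewrite (le_trans b01).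
  rewrite (le_trans _ h)// -/a.
  have : abs z ^+ 2 <= abs z ^+ d by rewrite ler_weXn2l.
  rewrite -(ler_pM2l (divr_gt0 a0 (ltr0n R 2))); apply: le_trans.
  have : 4 * abs z <= abs z * a * abs z by rewrite ler_wpM2r ?abs_ge0.
  by lra.
pose D z := G z - ln (abs z) - c; pose M1 := C + 1 + `|c|.
have D_bnd z : b <= abs z -> `|D z| <= M1.
  move=> /bP[z0 _ _]; have z1 : 1 <= abs z by rewrite (le_trans b01).
  have zp : 0 < abs z by rewrite (lt_le_trans ltr01).
  have := hC z 0%N; rewrite expr0 mul1r => h; rewrite /= in h.
  have l1 : ln (abs z) <= ln (1 + abs z) by rewrite ler_ln ?posrE; lra.
  have l2 : 1 + abs z - abs z <= (1 + abs z) * (ln (1 + abs z) - ln (abs z)).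
    by apply: sub_le_ln; lra.
  have l3 : ln (1 + abs z) - ln (abs z) <= 1.
    have oz : 0 < 1 + abs z by lra.
    rewrite -ln_div ?posrE// mulrDl divff ?gt_eqF// mul1r addrC.
    have zi : 0 < (abs z)^-1 by rewrite invr_gt0.
    rewrite (le_trans (le_ln1Dx _))//; first by rewrite (lt_trans _ zi)// ltrN10.
    by rewrite invf_le1.
  have := ler_norm c; have := ler_norm (- c); rewrite normrN /D /M1.
  by move: h; rewrite !ler_norml => /andP[? ?] ? ?; apply/andP; split; lra.
have D_step z : b <= abs z -> `|D z| <= (`|D f.[z]| + K0 / abs z) / 2.
  move=> bz; have [z0 _ _] := bP z bz; have [fz hz] := hK0 z z0.
  have e : d%:R * D z = D f.[z] + (ln (abs f.[z]) - ln a - d%:R * ln (abs z)).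
    by rewrite /D green_map// -cE; ring.
  have h2 : `|d%:R * D z| <= `|D f.[z]| + K0 / abs z.
    by rewrite e (le_trans (ler_normD _ _))// lerD2l.
  rewrite ler_pdivlMr// (le_trans _ h2)// normrM mulrC ler_wpM2r//.
  by rewrite (le_trans dR)// ler_norm.
have D_iter n z : b <= abs z -> `|D z| <= M1 * (1 / 2) ^+ n + 2 * K0 / abs z.
  have M10 : 0 <= M1 by rewrite /M1 !addr_ge0.
  elim: n z => [|n ih] z bz.
    have := D_bnd z bz; rewrite expr0 mulr1.
    have : 0 <= 2 * K0 / abs z by rewrite !mulr_ge0 ?invr_ge0 ?abs_ge0 ?(ltW K00).
    lra.
  have zp : 0 < abs z by rewrite (lt_le_trans ltr01)// (le_trans _ bz)// le_max b01.
  have fz2 := double z bz.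
  have bfz : b <= abs f.[z] by lra.
  have := ih f.[z] bfz; have := D_step z bz.
  have : 2 * K0 / abs f.[z] <= K0 / abs z.
    rewrite ler_pdivrMr; last by lra.
    rewrite mulrAC ler_pdivlMr// mulrC [leRHS]mulrC mulrCA mulrA ler_wpM2r//.
    by rewrite ltW.
  have : 0 <= K0 / abs z by rewrite divr_ge0 ?abs_ge0// ltW.
  by rewrite exprS; set h := _ ^+ n; lra.
exists c, (2 * K0), b; split; first by rewrite mulr_gt0.
  by rewrite le_max b01.
move=> z bz; rewrite -/(D z) leNgt; apply/negP => h.
pose g := `|D z| - 2 * K0 / abs z; have g0 : 0 < g by rewrite subr_gt0.
have M10 : 0 < M1 by rewrite /M1 ltr_pwDl// ltr_wpDl.
have [n _ hn] := @exprn_small R (1 / 2) (g / M1) ltac:(lra) (divr_gt0 g0 M10).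
rewrite ltr_pdivlMr// in hn.
by have := D_iter n z bz; rewrite /g in hn; lra.
Qed.

End GreenAtInfinity.

(** * Boundary levels *)

Section BoundaryLevels.
Variable R : realType.
Implicit Types (p P Q : {poly R[i]}) (z w x y : R[i]).

Definition boundary_level (A : set R) (t : R) := forall e : R, 0 < e ->
  (exists2 t', `|t' - t| < e & A t') /\ (exists2 t', `|t' - t| < e & ~ A t').

Lemma boundary_level_lt (A : set R) (x y : R) : x < y -> A x -> ~ A y ->
  exists2 t, x <= t & boundary_level A t.
Proof.
move=> xy Ax Ay; pose E := [set s | (s <= y) /\ A s].
have Ex : E x by split => //; exact: ltW.
have ubE : ubound E y by move=> s [].
have supE : has_sup E by split; [exists x | exists y].
have xt : x <= sup E by apply: ub_le_sup => //; exists y.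
have ty : sup E <= y by apply: ge_sup => //; exists x.
exists (sup E) => // e e0; split.
  have [s Es hs] := sup_adherent e0 supE; exists s; last by case: Es.
  have : s <= sup E by apply: ub_le_sup => //; exists y.
  by move=> hs'; rewrite ltr_norml; apply/andP; split; lra.
have [ty'|yt] := ltP (sup E) y; last first.
  have -> : sup E = y by apply/eqP; rewrite eq_le ty yt.
  by exists y => //; rewrite subrr normr0.
pose t' := Num.min y (sup E + e / 2).
have t'y : t' <= y by rewrite ge_min lexx.
have t'e : t' <= sup E + e / 2 by rewrite ge_min lexx orbT.
have t'l : sup E < t' by rewrite lt_min ty' ltrDl divr_gt0.
exists t'; first by rewrite ltr_norml; apply/andP; split; lra.
move=> At'; have : t' <= sup E by apply: ub_le_sup; [exists y | split].
by rewrite leNgt t'l.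
Qed.

Lemma boundary_levelC (A : set R) t : boundary_level (~` A) t -> boundary_level A t.
Proof.
move=> h e e0; have [[t1 h1 n1] [t2 h2 n2]] := h e e0.
by split; [exists t2 => //; exact: contrapT | exists t1].
Qed.

Variable f : {poly R[i]}.
Hypothesis hf : (2 <= (size f).-1)%N.
Local Notation G := (green f).

Variable S : set R[i].
Hypothesis fS : forall z, S f.[z] <-> S z.
Hypothesis closedS : forall w, ~ S w ->
  exists2 r : R, 0 < r & forall x, abs (x - w) < r -> ~ S x.
Hypothesis unboundedS : forall M : R, exists2 z, S z & M < abs z.
Hypothesis unboundedSC : forall M : R, exists2 z, ~ S z & M < abs z.

Variables B C tb : R.
Hypothesis filledB : forall a, filled f a -> abs a <= B.
Hypothesis greenC : forall z, `|ln (1 + abs z) - G z| <= C.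
Hypothesis baseB : forall z, tb < G z -> B + 1 < abs z.

Definition S_level : set R := [set t | exists2 z, G z = t & S z].
Definition S_invariant P := forall z, S P.[z] <-> S z.

Let B0 : 0 <= B.
Proof. by have [k /filledB] := filled_nonempty hf; exact/le_trans/abs_ge0. Qed.

Lemma S_levelP w : B < abs w -> S_level (G w) <-> S w.
Proof.
move=> Bw; split=> [[z Gz Sz]|Sw]; last by exists w.
exact: (green_saturated hf fS closedS filledB Sz Bw).
Qed.

Lemma green_large (M : R) : exists b : R, forall z, b <= abs z -> M < G z.
Proof.
exists (expR (M + C)) => z hz; have := greenC z; rewrite ler_norml => /andP[_ h].
suff : M + C < ln (1 + abs z) by lra.
by rewrite -[ltLHS]expRK ltr_ln ?posrE ?expR_gt0 ?ltr_pwDl ?abs_ge0.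
Qed.

Lemma boundary_level_unbounded (M : R) : exists2 t, M < t & boundary_level S_level t.
Proof.
have [b hb] := green_large M.
have [z Sz zb] := unboundedS b; have [w Sw wb] := unboundedSC (Num.max b B).
move: wb; rewrite gt_max => /andP[wb wB].
have Mz := hb z (ltW zb); have Mw := hb w (ltW wb).
have Az : S_level (G z) by exists z.
have Aw : ~ S_level (G w) by move=> /(S_levelP wB).
have [zw|wz|zw] := ltgtP (G z) (G w).
- have [t zt ht] := boundary_level_lt zw Az Aw.
  by exists t => //; rewrite (lt_le_trans Mz).
- have [|t wt ht] := @boundary_level_lt (~` S_level) _ _ wz Aw; first by apply.
  by exists t; [rewrite (lt_le_trans Mw) | exact: boundary_levelC].
- by rewrite zw in Az.
Qed.

Lemma green_poly_lipschitz P (M : R) : (1 < size P)%N ->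
  exists2 L : R, 0 < L & forall z z', abs z <= M -> abs z' <= M ->
    B + 1 <= abs P.[z] -> B + 1 <= abs P.[z'] ->
    `|G P.[z] - G P.[z']| <= L * abs (z - z').
Proof.
move=> sP; have [L L0 hL] := poly_lipschitz P M; exists L => // z z' zM z'M Pz Pz'.
rewrite (le_trans _ (hL z z' zM z'M))//.
have h1 := green_lipschitz hf P.[z'] filledB Pz.
have h2 := green_lipschitz hf P.[z] filledB Pz'.
rewrite (absC P.[z']) in h1.
by rewrite ler_norml; apply/andP; split; lra.
Qed.

(** If [G o P] took two values on a boundary level [t], it would take some
    value [s] between them on all the levels near [t], by connectedness. As
    [P] preserves [S] and its complement, [s] would be both a level in [S] and
    a level in its complement. *)
Lemma boundary_level_const P : (1 < size P)%N -> S_invariant P ->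
  exists T : R, forall t, T < t -> boundary_level S_level t ->
  forall z1 z2, G z1 = t -> G z2 = t -> G P.[z1] = G P.[z2].
Proof.
move=> sP invP; have [b hb] := poly_far (B + 1) sP.
have [T T0 hT] := green_far hf b.
exists (Num.max T tb) => t; rewrite gt_max => /andP[Tt tbt] bdt.
suff lt_abs z1 z2 : G z1 = t -> G z2 = t -> ~ G P.[z1] < G P.[z2].
  move=> z1 z2 G1 G2; apply/eqP; rewrite eq_le !leNgt.
  by apply/andP; split; apply/negP; exact: lt_abs.
move=> G1 G2 lt12; set phi := fun z => G P.[z].
have PB z : T < G z -> B + 1 < abs P.[z] by move=> /hT/ltW/hb.
pose M := expR (t + 1 + C).
have [L L0 hL] := green_poly_lipschitz M sP.
pose s := (G P.[z1] + G P.[z2]) / 2.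
pose e := (G P.[z2] - G P.[z1]) / 2 / L.
have e0 : 0 < e by rewrite !divr_gt0// subr_gt0.
have [eta1 eta10 near1] := level_near hf filledB greenC baseB tbt G1 e0.
have [eta2 eta20 near2] := level_near hf filledB greenC baseB tbt G2 e0.
pose eta := Num.min (Num.min eta1 eta2) (Num.min 1 (t - Num.max T tb)).
have eta0 : 0 < eta by rewrite !lt_min eta10 eta20 ltr01 subr_gt0 gt_max Tt tbt.
have hM z t' : G z = t' -> t' < t + 1 -> abs z <= M.
  move=> Gz t't; apply: (level_bound greenC).
  by rewrite Gz; lra.
have mid t' : `|t' - t| < eta -> [/\ T < t', tb < t' &
    exists2 z', G z' = t' & phi z' = s].
  rewrite !lt_min => /andP[/andP[/near1[z1' G1' d1] /near2[z2' G2' d2]]].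
  rewrite !ltr_norml => /andP[/andP[t1 t2] /andP[t3 t4]].
  have : Num.max T tb < t' by lra.
  rewrite gt_max => /andP[tT tt]; split=> //.
  have Tz1 : T < G z1 by rewrite G1.
  have Tz2 : T < G z2 by rewrite G2.
  have t_t : t < t + 1 by rewrite ltrDl.
  have t't : t' < t + 1 by lra.
  have z1'T : T < G z1' by rewrite G1'.
  have z2'T : T < G z2' by rewrite G2'.
  have h1 := hL _ _ (hM _ _ G1' t't) (hM _ _ G1 t_t) (ltW (PB _ z1'T)) (ltW (PB _ Tz1)).
  have h2 := hL _ _ (hM _ _ G2' t't) (hM _ _ G2 t_t) (ltW (PB _ z2'T)) (ltW (PB _ Tz2)).
  have Le : L * e = (G P.[z2] - G P.[z1]) / 2 by rewrite mulrC divfK// gt_eqF.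
  have d1' : L * abs (z1' - z1) < L * e by rewrite ltr_pM2l.
  have d2' : L * abs (z2' - z2) < L * e by rewrite ltr_pM2l.
  have hs : phi z1' <= s <= phi z2'.
    rewrite /phi /s; move: h1 h2; rewrite !ler_norml => /andP[? ?] /andP[? ?].
    by apply/andP; split; lra.
  have phiL z z' : G z = t' -> G z' = t' -> `|phi z - phi z'| <= L * abs (z - z').
    move=> Gz Gz'; apply: hL; rewrite ?(hM _ _ Gz)// ?(hM _ _ Gz')//.
      by rewrite ltW// PB// Gz.
    by rewrite ltW// PB// Gz'.
  have [z' Gz' sz'] := level_IVT hf filledB greenC baseB tt phiL G1' G2' hs.
  by exists z'.
have [[t1 /mid[T1 tt1 [z Gz sz]] A1] [t2 /mid[T2 tt2 [z' Gz' sz']] n2]] := bdt eta eta0.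
have PBz : B < abs P.[z] by have := PB z; rewrite Gz => /(_ T1); lra.
have PBz' : B < abs P.[z'] by have := PB z'; rewrite Gz' => /(_ T2); lra.
have Bz : B < abs z by have := @baseB z; rewrite Gz => /(_ tt1); lra.
have Bz' : B < abs z' by have := @baseB z'; rewrite Gz' => /(_ tt2); lra.
apply: n2; rewrite -Gz'; apply/(S_levelP Bz')/invP/(S_levelP PBz').
rewrite -/(phi z') sz' -sz; apply/(S_levelP PBz)/invP/(S_levelP Bz).
by rewrite Gz.
Qed.

End BoundaryLevels.

(** * Deviation of a quotient of polynomials *)

Section LeadingPerturbation.
Variable R : realType.
Implicit Types (P Q : {poly R[i]}) (z u v : R[i]).

Lemma real_complex_neq0 (r : R) : 0 < r -> r%:C != 0 :> R[i].
Proof. by move=> r0; rewrite eq_complex /= eqxx andbT gt_eqF. Qed.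

(** [kap / z^k] is the leading term at infinity of [(P - l Q) / (l Q)]. *)
Lemma leading_perturbation P Q (l : R[i]) : (1 < size P)%N -> size Q = size P ->
  l * lead_coef Q = lead_coef P -> (1 < size (P - l *: Q)%R)%N ->
  exists (k : nat) (kap : R[i]) (b : R),
    [/\ (0 < k < (size P).-1)%N, kap != 0 & forall z, b <= abs z ->
      abs (P.[z] - (1 + kap / z ^+ k) * (l * Q.[z])) <=
      abs kap / abs z ^+ k / 4 * abs (l * Q.[z])].
Proof.
move=> sP sQP lq sE1.
have P0 : P != 0 by rewrite -size_poly_gt0 ltnW.
have sQ : (1 < size Q)%N by rewrite sQP.
set N := (size P).-1; have NQ : (size Q).-1 = N by rewrite sQP.
set p := lead_coef P in lq *; set q := lead_coef Q in lq *.
have p0 : p != 0 by rewrite lead_coef_eq0.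
have q0 : q != 0 by apply: contraNneq p0 => q0; rewrite -lq q0 mulr0.
have l0 : l != 0 by apply: contraNneq p0 => l0; rewrite -lq l0 mul0r.
pose E := P - l *: Q; rewrite -/E in sE1.
have sE : (size E <= N)%N.
  apply/leq_sizeP => i; rewrite leq_eqVlt => /orP[/eqP<-|Ni].
    by rewrite coefB coefZ -[N in Q`_N]NQ -/(lead_coef Q) -/q lq subrr.
  by rewrite coefB coefZ !nth_default ?mulr0 ?subrr// ?sQP -(prednK (ltnW sP)).
have E0 : E != 0 by rewrite -size_poly_gt0 ltnW.
set j := (size E).-1; set e := lead_coef E.
have e0 : e != 0 by rewrite lead_coef_eq0.
have j0 : (0 < j)%N by rewrite /j -ltnS prednK// ltnW.
have jN : (j < N)%N by rewrite /j prednK// ltnW.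
pose k := (N - j)%N; have k0 : (0 < k)%N by rewrite subn_gt0.
have Njk : N = (j + k)%N by rewrite subnKC// ltnW.
have kN : (k < N)%N by rewrite Njk -{1}(add0n k) ltn_add2r.
pose kap := e / p; have kap0 : kap != 0 by rewrite mulf_neq0 ?invr_neq0.
have kapE : e = kap * (l * q) by rewrite lq divfK.
clearbody kap; set K := abs kap; have K0 : 0 < K by rewrite abs_gt0.
have [CE CE0 hE] := poly_lead_estimate E.
have [CQ CQ0 hQ] := poly_lead_estimate Q.
have [bQ bQ1 largeQ] := poly_large sQ.
have ap : 0 < abs p by rewrite abs_gt0.
have aq : 0 < abs q by rewrite abs_gt0.
have al : 0 < abs l by rewrite abs_gt0.
pose CE' := 8 * (CE + K * abs l * CQ) / (K * abs p).
exists k, kap, (Num.max bQ CE'); rewrite k0 kN; split=> // z.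
rewrite ge_max => /andP[bQz zCE].
have z1 : 1 <= abs z by rewrite (le_trans bQ1).
have r0 : 0 < abs z by rewrite (lt_le_trans ltr01).
have z0 : z != 0 by rewrite -abs_gt0.
have zCE' : CE + K * abs l * CQ <= K * abs p / 8 * abs z.
  rewrite ler_pdivrMr ?mulr_gt0// in zCE.
  by rewrite [leRHS]mulrAC ler_pdivlMr// mulrC [leRHS]mulrC.
have rk0 : 0 < abs z ^+ k by rewrite exprn_gt0.
have rj0 : 0 < abs z ^+ j by rewrite exprn_gt0.
have zk0 : z ^+ k != 0 by rewrite expf_neq0.
have -> : P.[z] - (1 + kap / z ^+ k) * (l * Q.[z]) =
    (E.[z] - e * z ^+ j) - kap / z ^+ k * l * (Q.[z] - q * z ^+ N).
  have -> : E.[z] = P.[z] - l * Q.[z] by rewrite /E !hornerE.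
  rewrite kapE Njk exprD; move: (z ^+ k) (z ^+ j) zk0 => Z Y Z0.
  by field.
have h1 := hE z z1; have h2 := hQ z z1; rewrite -/e -/j in h1; rewrite NQ -/q in h2.
have /andP[h4 _] := largeQ z bQz; rewrite NQ -/q in h4.
rewrite -(ler_pM2r r0) (le_trans (ler_wpM2r (ltW r0) (absBD _ _)))//.
rewrite mulrDl !absM absV absX -/K.
have h3 : K / abs z ^+ k * abs l * abs (Q.[z] - q * z ^+ N) * abs z <=
    K * abs l * CQ * abs z ^+ j.
  rewrite -mulrA (le_trans (ler_wpM2l _ h2))//.
    by rewrite mulr_ge0 ?abs_ge0// divr_ge0// ltW.
  rewrite Njk exprD le_eqVlt; apply/orP; left; apply/eqP.
  move: (abs z ^+ k) (abs z ^+ j) rk0 => Z Y Z0; field.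
  by rewrite gt_eqF.
have h5 : K * abs p / 8 * abs z ^+ j <= K / abs z ^+ k / 4 * (abs l * abs Q.[z]).
  apply: (@le_trans _ _ (K / abs z ^+ k / 4 * (abs l * (abs q / 2 * abs z ^+ N)))).
    rewrite le_eqVlt; apply/orP; left; apply/eqP.
    rewrite -lq absM Njk exprD; move: (abs z ^+ k) (abs z ^+ j) rk0 => Z Y Z0; field.
    by rewrite gt_eqF.
  by rewrite ler_wpM2l ?ler_pM2l// !divr_ge0// ltW.
have h6 : (CE + K * abs l * CQ) * abs z ^+ j <= K * abs p / 8 * abs z ^+ j * abs z.
  by rewrite [leRHS]mulrAC ler_pM2r.
have h7 := ler_wpM2r (ltW r0) h5.
rewrite (le_trans _ h7)// (le_trans _ h6)// mulrDl lerD//.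
Qed.

(** The directions [u] and [v] are those where [kap / z^k] is positive,
    respectively negative, so that [|P / (l Q)|] is larger than [1] in the
    direction [u] and at most [1] in the direction [v]. *)
Lemma ratio_deviation P Q (l : R[i]) : (1 < size P)%N -> size Q = size P ->
  l * lead_coef Q = lead_coef P -> (1 < size (P - l *: Q)%R)%N ->
  exists (k : nat) (a b : R) (u v : R[i]),
    [/\ (0 < k < (size P).-1)%N, 0 < a, abs u = 1, abs v = 1 &
    forall r s : R, b <= r -> b <= s ->
      P.[r%:C * u] != 0 -> P.[s%:C * v] != 0 ->
      Q.[r%:C * u] != 0 -> Q.[s%:C * v] != 0 ->
      a / r ^+ k <= (ln (abs P.[r%:C * u]) - ln (abs P.[s%:C * v])) -
        (ln (abs Q.[r%:C * u]) - ln (abs Q.[s%:C * v]))].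
Proof.
move=> sP sQP lq sE1.
have [k [kap [b [kN kap0 hb]]]] := leading_perturbation sP sQP lq sE1.
have l0 : l != 0.
  apply: contraTneq sP => l0; move: lq; rewrite l0 mul0r => /esym/eqP.
  by rewrite lead_coef_eq0 => /eqP->; rewrite size_poly0.
have /andP[k0 _] := kN.
set K := abs kap in hb; have K0 : 0 < K by rewrite abs_gt0.
have KC0 := real_complex_neq0 K0.
have uv1 : abs (kap / K%:C) = 1.
  by rewrite absM absV abs_real gtr0_norm// divff ?gt_eqF.
have [u u1 uk] := abs_rootn k0 uv1.
have [v v1 vk] := abs_rootn k0 (etrans (absN _) uv1).
exists k, (K / 4), (Num.max b (K + 1)), u, v; split=> //; first by rewrite divr_gt0.
move=> r s; rewrite !ge_max => /andP[br Kr] /andP[bs Ks] Pr0 Ps0 Qr0 Qs0.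
have r0 : 0 < r by lra.
have s0 : 0 < s by lra.
have rC0 := real_complex_neq0 r0; have sC0 := real_complex_neq0 s0.
have az : abs (r%:C * u) = r by rewrite abs_scale u1 mulr1 gtr0_norm.
have aw : abs (s%:C * v) = s by rewrite abs_scale v1 mulr1 gtr0_norm.
have hz := hb (r%:C * u); have hw := hb (s%:C * v); rewrite az in hz; rewrite aw in hw.
have {}hz := hz br; have {}hw := hw bs.
have small (t : R) : K + 1 <= t -> K / t ^+ k <= 1.
  move=> tK; have t1 : 1 <= t by lra.
  rewrite ler_pdivrMr ?exprn_gt0 ?(lt_le_trans ltr01)// mul1r.
  have : t <= t ^+ k by rewrite -{1}(expr1 t) ler_weXn2l.
  lra.
pose x := K / r ^+ k; pose y := K / s ^+ k.
have x0 : 0 < x by rewrite divr_gt0// exprn_gt0.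
have y0 : 0 < y by rewrite divr_gt0// exprn_gt0.
have x1 : x <= 1 by exact: small.
have y1 : y <= 1 by exact: small.
have kz : kap / (r%:C * u) ^+ k = x%:C.
  rewrite exprMn uk /x rmorphM fmorphV rmorphXn /=.
  move: (r%:C ^+ k) (expf_neq0 k rC0) => Z Z0.
  by field; rewrite kap0 KC0 Z0.
have kw : kap / (s%:C * v) ^+ k = - y%:C.
  rewrite exprMn vk /y rmorphM fmorphV rmorphXn /=.
  move: (s%:C ^+ k) (expf_neq0 k sC0) => Z Z0.
  by field; rewrite ?oppr_eq0 kap0 KC0 Z0.
rewrite kz -/x in hz; rewrite kw -/y in hw.
set z := r%:C * u in az hz Pr0 Qr0 *; set w := s%:C * v in aw hw Ps0 Qs0 *.
have lQz : 0 < abs (l * Q.[z]) by rewrite abs_gt0 mulf_neq0.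
have lQw : 0 < abs (l * Q.[w]) by rewrite abs_gt0 mulf_neq0.
have upper : (1 + x / 2) * abs (l * Q.[z]) <= abs P.[z].
  have h2 := absB ((1 + x)%:C * (l * Q.[z])) ((1 + x)%:C * (l * Q.[z]) - P.[z]).
  rewrite subKr absC abs_scale ger0_norm ?addr_ge0 ?(ltW x0)// rmorphD in h2.
  have h3 : 0 <= x * abs (l * Q.[z]) by rewrite mulr_ge0 ?abs_ge0// ltW.
  lra.
have lower : abs P.[w] <= abs (l * Q.[w]).
  have h2 := absD (P.[w] - (1 - y)%:C * (l * Q.[w])) ((1 - y)%:C * (l * Q.[w])).
  rewrite subrK abs_scale ger0_norm ?subr_ge0// rmorphB in h2.
  have h3 : 0 <= y * abs (l * Q.[w]) by rewrite mulr_ge0 ?abs_ge0// ltW.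
  lra.
have x20 : 0 < 1 + x / 2 by lra.
have lnx : x / 4 <= ln (1 + x / 2).
  have h := sub_le_ln x20 (ltr01 : 0 < 1 :> R); rewrite ln1 subr0 in h.
  have h0 : 0 <= ln (1 + x / 2) by rewrite ln_ge0//; lra.
  have : (1 + x / 2) * ln (1 + x / 2) <= 2 * ln (1 + x / 2) by rewrite ler_wpM2r//; lra.
  lra.
have {}upper : ln ((1 + x / 2) * abs (l * Q.[z])) <= ln (abs P.[z]).
  by rewrite ler_ln ?posrE ?mulr_gt0// abs_gt0.
have {}lower : ln (abs P.[w]) <= ln (abs (l * Q.[w])).
  by rewrite ler_ln ?posrE// abs_gt0.
rewrite lnM ?posrE// absM lnM ?posrE ?abs_gt0// in upper.
rewrite absM lnM ?posrE ?abs_gt0// in lower.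
have -> : K / 4 / r ^+ k = x / 4 by rewrite /x; ring.
lra.
Qed.

End LeadingPerturbation.

(** * Affine relations between polynomials preserving a set *)

Section AffineRelations.
Variable R : realType.
Implicit Types (p P Q : {poly R[i]}) (z w x y : R[i]).

Variable f : {poly R[i]}.
Hypothesis hf : (2 <= (size f).-1)%N.
Local Notation d := (size f).-1.
Local Notation G := (green f).
Local Notation F n z := (iter n (horner f) z).

Variable S : set R[i].
Hypothesis fS : S_invariant S f.
Hypothesis closedS : forall w, ~ S w ->
  exists2 r : R, 0 < r & forall x, abs (x - w) < r -> ~ S x.
Hypothesis unboundedS : forall M : R, exists2 z, S z & M < abs z.
Hypothesis unboundedSC : forall M : R, exists2 z, ~ S z & M < abs z.

Variables B C tb : R.
Hypothesis filledB : forall a, filled f a -> abs a <= B.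
Hypothesis greenC : forall z, `|ln (1 + abs z) - G z| <= C.
Hypothesis baseB : forall z, tb < G z -> B + 1 < abs z.

Let B0 : 0 <= B.
Proof. by have [k /filledB] := filled_nonempty hf; exact/le_trans/abs_ge0. Qed.

Lemma S_invariant_comp P Q : S_invariant S P -> S_invariant S Q ->
  S_invariant S (P \Po Q).
Proof. by move=> hP hQ z; rewrite horner_comp hP hQ. Qed.

Lemma S_invariant_iter P n : S_invariant S P -> S_invariant S (poly_iter P n).
Proof.
move=> hP; elim: n => [|n ih]; first by move=> z; rewrite hornerX.
exact: S_invariant_comp.
Qed.

Let log_ratio_variation (g h c p p' q q' e1 e2 e3 e4 X Y Z : R) :
  `|g - p - c| <= e1 -> `|g - p' - c| <= e2 ->
  `|h - q - c| <= e3 -> `|h - q' - c| <= e4 ->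
  e1 <= X -> e2 <= Y -> e3 <= X -> e4 <= Y -> Y <= Z ->
  p - p' - (q - q') <= 2 * X + 2 * Z.
Proof.
rewrite !ler_norml => /andP[? ?] /andP[? ?] /andP[? ?] /andP[? ?] ? ? ? ? ?.
lra.
Qed.

Let level_radii_comparable (t c K r s : R) : 0 < r -> 0 < s -> 2 * K <= r -> 2 * K <= s ->
  `|t - ln r - c| <= K / r -> `|t - ln s - c| <= K / s -> r <= expR 1 * s.
Proof.
move=> r0 s0 Kr Ks.
have h1 : K / r <= 1 / 2 by rewrite ler_pdivrMr//; lra.
have h2 : K / s <= 1 / 2 by rewrite ler_pdivrMr//; lra.
rewrite !ler_norml => /andP[? ?] /andP[? ?].
rewrite -ler_ln ?posrE ?mulr_gt0 ?expR_gt0// lnM ?posrE ?expR_gt0// expRK; lra.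
Qed.

(** If [P - l Q] is not constant, compare [P] and [Q] on a high boundary level in
    the directions given by [ratio_deviation]. As [G o P] and [G o Q] are constant
    there, [ln |P / Q|] varies by [O(|z|^-deg P)] only, by the expansion of [G] at
    infinity, whereas it should vary by at least [a / |z|^k] with [k < deg P]. *)
Lemma same_degree_affine P Q : (1 < size P)%N -> size Q = size P ->
  S_invariant S P -> S_invariant S Q ->
  exists l m : R[i], l != 0 /\ P = l *: Q + m%:P.
Proof.
move=> sP sQP invP invQ.
have P0 : P != 0 by rewrite -size_poly_gt0 ltnW.
have sQ : (1 < size Q)%N by rewrite sQP.
have Q0 : Q != 0 by rewrite -size_poly_gt0 ltnW.
have p0 : lead_coef P != 0 by rewrite lead_coef_eq0.
have q0 : lead_coef Q != 0 by rewrite lead_coef_eq0.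
pose l := lead_coef P / lead_coef Q.
have l0 : l != 0 by rewrite mulf_neq0 ?invr_neq0.
have lq : l * lead_coef Q = lead_coef P by rewrite divfK.
have [sE1|sE1] := leqP (size (P - l *: Q)%R) 1.
  by exists l, (P - l *: Q)`_0; rewrite -size1_polyC// subrKC.
exfalso.
have [k [a [b0 [u [v [/andP[k0 kN] a0 u1 v1 dev]]]]]] := ratio_deviation sP sQP lq sE1.
have [bP bP1 largeP] := poly_large sP.
have [bQ bQ1 largeQ] := poly_large sQ.
have [c [K [b1 [K0 b11 asym]]]] := green_asymptotic hf.
have [bfP farP] := poly_far b1 sP.
have [bfQ farQ] := poly_far b1 sQ.
have [TP constP] := boundary_level_const hf fS closedS filledB greenC baseB sP invP.
have [TQ constQ] := boundary_level_const hf fS closedS filledB greenC baseB sQ invQ.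
rewrite sQP in largeQ.
move: kN largeP largeQ dev; set N := (size P).-1; move: N => N kN largeP largeQ dev.
pose m0 := Num.min (abs (lead_coef P) / 2) (abs (lead_coef Q) / 2).
have m00 : 0 < m0 by rewrite lt_min !divr_gt0// abs_gt0.
have m0p : m0 <= abs (lead_coef P) / 2 by rewrite ge_min lexx.
have m0q : m0 <= abs (lead_coef Q) / 2 by rewrite ge_min lexx orbT.
pose e1 : R := expR 1; have e10 : 0 < e1 by exact: expR_gt0.
(* Beyond [Lam] the variation of [ln |P / Q|] is less than [a / |z|^k]. *)
pose Lam := 2 * K * (1 + e1 ^+ N) / (m0 * a).
pose b := Num.max (Num.max (Num.max bP bQ) (Num.max bfP bfQ))
  (Num.max (Num.max b1 (2 * K)) (Num.max b0 Lam)).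
have [T T0 hT] := green_far hf b.
have [t] := boundary_level_unbounded hf fS closedS unboundedS unboundedSC filledB greenC
  (Num.max (Num.max T tb) (Num.max TP TQ)).
rewrite !gt_max => /andP[/andP[Tt tbt] /andP[TPt TQt]] bdt.
have {constP} cP := constP t TPt bdt; have {constQ} cQ := constQ t TQt bdt.
have [r Br Gr] := level_point hf filledB greenC baseB u1 tbt.
have [s Bs Gs] := level_point hf filledB greenC baseB v1 tbt.
have r0 : 0 < r by rewrite (le_lt_trans _ Br)// addr_ge0.
have s0 : 0 < s by rewrite (le_lt_trans _ Bs)// addr_ge0.
set z := r%:C * u in Gr; set w := s%:C * v in Gs.
have az : abs z = r by rewrite scaled_unit// ltW.
have aw : abs w = s by rewrite scaled_unit// ltW.
have bounds x : T < G x -> [/\ [/\ b0 <= abs x, b1 <= abs x & 2 * K <= abs x],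
    [/\ b1 <= abs P.[x], b1 <= abs Q.[x] & Lam < abs x],
    m0 * abs x ^+ N <= abs P.[x] & m0 * abs x ^+ N <= abs Q.[x]].
  move=> /hT; rewrite !gt_max => /andP[/andP[/andP[h1 h2] /andP[h3 h4]]].
  move=> /andP[/andP[h5 h6] /andP[h7 h8]].
  have /andP[h9 _] := largeP x (ltW h1); have /andP[h10 _] := largeQ x (ltW h2).
  have xN : 0 <= abs x ^+ N by rewrite exprn_ge0 ?abs_ge0.
  split; first by rewrite (ltW h5) (ltW h6) (ltW h7).
  - split=> //; apply: ltW; first by apply: farP; exact: ltW.
    by apply: farQ; exact: ltW.
  - by rewrite (le_trans _ h9)// ler_wpM2r.
  - by rewrite (le_trans _ h10)// ler_wpM2r.
have Tz : T < G z by rewrite Gr.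
have Tw : T < G w by rewrite Gs.
have [[b0z b1z Kz] [Pz Qz Lz] mPz mQz] := bounds z Tz.
have [[b0w b1w Kw] [Pw Qw Lw] mPw mQw] := bounds w Tw.
rewrite az in b0z b1z Kz Lz mPz mQz; rewrite aw in b0w b1w Kw Lw mPw mQw.
have nz x : b1 <= abs x -> x != 0.
  by move=> h; rewrite -abs_gt0 (lt_le_trans ltr01)// (le_trans b11).
have := dev r s b0z b0w (nz _ Pz) (nz _ Pw) (nz _ Qz) (nz _ Qw).
rewrite -/z -/w => dev_le.
have aP := asym _ Pz; have aP' := asym _ Pw; have aQ := asym _ Qz; have aQ' := asym _ Qw.
rewrite (cP w z Gs Gr) in aP'; rewrite (cQ w z Gs Gr) in aQ'.
have rN : 0 < r ^+ N by rewrite exprn_gt0.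
have sN : 0 < s ^+ N by rewrite exprn_gt0.
have rk : 0 < r ^+ k by rewrite exprn_gt0.
have inv_le (x y : R) : 0 < y -> m0 * y <= x -> K / x <= K / m0 / y.
  move=> y0 h; rewrite -mulrA -invfM ler_wpM2l ?(ltW K0)// lef_pV2 ?posrE ?mulr_gt0//.
  by rewrite (lt_le_trans _ h)// mulr_gt0.
have iP := inv_le _ _ rN mPz; have iP' := inv_le _ _ sN mPw.
have iQ := inv_le _ _ rN mQz; have iQ' := inv_le _ _ sN mQw.
have rs : r <= e1 * s.
  have g1 := asym z; have g2 := asym w; rewrite az Gr in g1; rewrite aw Gs in g2.
  exact: (level_radii_comparable r0 s0 Kz Kw (g1 b1z) (g2 b1w)).
have rsN : K / m0 / s ^+ N <= K / m0 * e1 ^+ N / r ^+ N.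
  rewrite -[leRHS]mulrA ler_wpM2l ?divr_ge0 ?(ltW K0) ?(ltW m00)//.
  rewrite ler_pdivlMr// mulrC ler_pdivrMr// -exprMn.
  by rewrite lerXn2r// nnegrE ltW// mulr_gt0.
suff : ln (abs P.[z]) - ln (abs P.[w]) - (ln (abs Q.[z]) - ln (abs Q.[w])) < a / r ^+ k.
  by rewrite ltNge dev_le.
have total : ln (abs P.[z]) - ln (abs P.[w]) - (ln (abs Q.[z]) - ln (abs Q.[w])) <=
    2 * (K / m0 / r ^+ N) + 2 * (K / m0 * e1 ^+ N / r ^+ N).
  exact: log_ratio_variation aP aP' aQ aQ' iP iP' iQ iQ' rsN.
rewrite (le_lt_trans total)//.
have -> : 2 * (K / m0 / r ^+ N) + 2 * (K / m0 * e1 ^+ N / r ^+ N) =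
    Lam * a / r ^+ N.
  rewrite /Lam; move: (r ^+ N) (e1 ^+ N) rN => X Y X0.
  by field; rewrite !gt_eqF.
have -> : a / r ^+ k = r ^+ (N - k) * a / r ^+ N.
  rewrite -{2}(subnK (ltnW kN)) exprD invfM mulrA [_ * a]mulrC mulfK//.
  by rewrite expf_neq0// gt_eqF.
rewrite ltr_pM2r ?invr_gt0// ltr_pM2r// (lt_le_trans Lz)//.
have r1 : 1 <= r by rewrite (le_trans b11).
by rewrite -{1}(expr1 r) ler_weXn2l// subn_gt0.
Qed.

(** Conjugating [y |-> l y + m] by [f^n] gives a correspondence which preserves
    [S] and moves the levels by about [ln |l| / d^n]. Hence the levels in [S] are
    dense above any of them, whereas the complement of [S] is open and
    unbounded. *)
Let affine_not_expanding (l m : R[i]) : 1 < abs l ->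
  (forall y, S (l * y + m) <-> S y) -> False.
Proof.
move=> l1 invl; pose p := l *: 'X + m%:P.
have l0 : l != 0 by rewrite -abs_gt0 (lt_trans ltr01).
have pE y : p.[y] = l * y + m by rewrite !hornerE.
have sp : size p = 2%N.
  by rewrite size_polyDl size_scale ?size_polyX// (leq_ltn_trans (size_polyC_leq1 _)).
have lp : lead_coef p = l by rewrite lead_coefE sp /p coefD coefZ coefX coefC /= mulr1 addr0.
have sp1 : (1 < size p)%N by rewrite sp.
have [c [K [b1 [K0 b11 asym]]]] := green_asymptotic hf.
have [K2 [b2 [K20 b21 lnp]]] := poly_ln_estimate sp1.
have [b3 b31 largep] := poly_large sp1.
rewrite lp sp /= in lnp largep.
pose ell := ln (abs l); have ell0 : 0 < ell by rewrite ln_gt0.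
pose b := Num.max (Num.max (2 * b1) b2) (Num.max b3 (2 * (3 * K + K2) / ell)).
have shift y : b <= abs y -> G y + ell / 2 <= G (l * y + m) <= G y + 3 * ell / 2.
  rewrite !ge_max => /andP[/andP[yb1 yb2] /andP[yb3]]; rewrite ler_pdivrMr// => yK.
  have y0 : 0 < abs y by lra.
  have [py0 lny] := lnp y yb2; have /andP[py _] := largep y yb3.
  rewrite pE expr1 in py py0 lny; rewrite mul1r in lny.
  have py2 : abs y / 2 <= abs (l * y + m).
    have : 1 * abs y <= abs l * abs y by rewrite ler_pM2r// ltW.
    lra.
  have g1 := asym y ltac:(lra); have g2 := asym (l * y + m) ltac:(lra).
  have inv2 : K / abs (l * y + m) <= 2 * K / abs y.
    rewrite ler_pdivrMr; last by lra.
    have : 2 * K / abs y * (abs y / 2) <= 2 * K / abs y * abs (l * y + m).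
      by rewrite ler_wpM2l// divr_ge0 ?abs_ge0// mulr_ge0// ltW.
    by rewrite (_ : 2 * K / abs y * (abs y / 2) = K)//; field; rewrite gt_eqF.
  have err : 3 * (K / abs y) + K2 / abs y <= ell / 2.
    rewrite mulrA -mulrDl ler_pdivrMr//; lra.
  move: g1 g2 lny; rewrite -/ell !ler_norml => /andP[? ?] /andP[? ?] /andP[? ?].
  have e2 : 2 * K / abs y = 2 * (K / abs y) by rewrite mulrA.
  rewrite e2 in inv2; apply/andP; split; lra.
have [T T0 hT] := green_far hf b.
have dn0 n : 0 < d%:R ^+ n :> R.
  by rewrite exprn_gt0// ltr0n (leq_trans _ hf).
have dn1 n : 1 <= d%:R ^+ n :> R.
  by rewrite exprn_ege1// ler1n (leq_trans _ hf).
have step n t : T < t -> S_level f S t -> exists2 t', S_level f S t' &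
    t + ell / 2 / d%:R ^+ n <= t' <= t + 3 * ell / 2 / d%:R ^+ n.
  move=> Tt [z Gz Sz].
  have Gy : G (F n z) = d%:R ^+ n * t by rewrite green_iter// Gz.
  have tle : t <= d%:R ^+ n * t by rewrite ler_peMl// (le_trans T0)// ltW.
  have by_ : b <= abs (F n z) by rewrite ltW// hT// Gy (lt_le_trans Tt).
  have [w] := poly_surj (l * F n z + m) (size_poly_iter_gt1 n (size_gt1 hf)).
  rewrite horner_poly_iter => wE.
  have Gw : d%:R ^+ n * G w = G (l * F n z + m) by rewrite -green_iter// wE.
  exists (G w).
    by exists w => //; apply/(iter_inv fS n); rewrite wE; apply/invl/iter_inv.
  have /andP[h1 h2] := shift _ by_; rewrite -Gw Gy in h1 h2.
  have e (x : R) : t + x / d%:R ^+ n = (d%:R ^+ n * t + x) / d%:R ^+ n.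
    by rewrite mulrDl mulrAC divff ?mul1r// gt_eqF.
  by rewrite !e; apply/andP; split;
    rewrite ?ler_pdivrMr ?ler_pdivlMr// [G w * _]mulrC.
have [bg hbg] := green_large greenC T.
have [z0 Sz0 z0b] := unboundedS bg; pose t0 := G z0.
have Tt0 : T < t0 by apply/hbg/ltW.
have [bh hbh] := green_large greenC (Num.max T t0).
have [w0 Sw0] := unboundedSC (Num.max bh (B + 1)); rewrite gt_max => /andP[w0b w0B].
have := hbh w0 (ltW w0b); rewrite gt_max => /andP[Tw0 tw0].
have [r r0 disj] := closedS Sw0.
have aw0 : 0 < abs w0 by rewrite (le_lt_trans _ w0B)// addr_ge0.
have Bw0 : B < abs w0 by rewrite (le_lt_trans _ w0B)// lerDl.
pose s1 := 1 + r / 2 / abs w0.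
have r2 : 0 < r / 2 / abs w0 by rewrite !divr_gt0.
have s11 : 1 < s1 by rewrite ltrDl.
have gap_gt0 : 0 < ln s1 / 2 by rewrite divr_gt0// ln_gt0.
have top : G w0 + ln s1 / 2 <= G (s1%:C * w0).
  by apply: (green_radial hf filledB) => //; exact: ltW.
have free t : G w0 <= t <= G w0 + ln s1 / 2 -> ~ S_level f S t.
  move=> /andP[t1 t2].
  have [||s /andP[s_ge1 s_le] Gs] := @lipschitz_IVT R (fun s => G (s%:C * w0)) 1 s1 t
      (abs w0) (ltW s11).
  - move=> x y /andP[x1 _] /andP[y1 _].
    have big (s : R) : 1 <= s -> B + 1 <= abs (s%:C * w0).
      move=> s1'; rewrite abs_scale ger0_norm ?(le_trans ler01)//.
      by rewrite (le_trans (ltW w0B))// ler_peMl// ltW.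
    have dist : abs (x%:C * w0 - y%:C * w0) = abs w0 * `|x - y|.
      by rewrite -mulrBl -rmorphB abs_scale mulrC.
    have h1 := green_lipschitz hf (y%:C * w0) filledB (big x x1).
    have h2 := green_lipschitz hf (x%:C * w0) filledB (big y y1).
    rewrite absC dist in h1; rewrite dist in h2.
    by rewrite ler_norml; apply/andP; split; lra.
  - rewrite mul1r ge_min le_max t1 (le_trans t2 top) orbT//.
  have Bs : B < abs (s%:C * w0).
    rewrite abs_scale ger0_norm ?(le_trans ler01)//.
    by rewrite (lt_le_trans Bw0)// ler_peMl// ltW.
  rewrite -Gs => /(S_levelP hf fS closedS filledB Bs); apply: disj.
  have -> : s%:C * w0 - w0 = (s - 1)%:C * w0 by rewrite rmorphB; ring.
  rewrite abs_scale ger0_norm ?subr_ge0//.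
  have : (s - 1) * abs w0 <= r / 2 / abs w0 * abs w0.
    by rewrite ler_pM2r// lerBlDl.
  by rewrite divfK ?gt_eqF//; lra.
have [n hn] : exists n : nat, 3 * ell / 2 <= d%:R ^+ n * (ln s1 / 2).
  have [n hn] := pow_growth_ge hf (3 * ell / 2) gap_gt0.
  by exists n; exact: hn.
pose del := ell / 2 / d%:R ^+ n; have del0 : 0 < del by rewrite !divr_gt0.
have climb i : exists2 t, S_level f S t & [/\ T < t, t < G w0 & t0 + i%:R * del <= t].
  elim: i => [|i [t At [Tt tw it]]].
    by exists t0; [exists z0 | split => //; rewrite mul0r addr0].
  have [t' At' /andP[t'1 t'2]] := step n t Tt At; rewrite -/del in t'1.
  exists t' => //.
  have t'3 : 3 * ell / 2 / d%:R ^+ n <= ln s1 / 2.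
    by rewrite ler_pdivrMr// [leRHS]mulrC.
  split; first by lra.
    rewrite ltNge; apply/negP => h; apply: (@free t') => //.
    by rewrite h /=; lra.
  by rewrite -natr1 mulrDl mul1r; lra.
have [i hi] := archi_mul (G w0 - t0) del0.
by have [t _ [_ tw it]] := climb i; lra.
Qed.

Lemma affine_invariance_unit (l m : R[i]) : l != 0 ->
  (forall y, S (l * y + m) <-> S y) -> abs l = 1.
Proof.
move=> l0 inv; have al : 0 < abs l by rewrite abs_gt0.
apply/eqP; rewrite eq_le !leNgt; apply/andP; split; apply/negP => l1.
  exact: (affine_not_expanding l1 inv).
apply: (@affine_not_expanding l^-1 (- (m / l))) => [|y].
  by rewrite absV invf_gt1.
rewrite -inv (_ : l * _ + m = y)//.
by field.
Qed.

Lemma same_degree_isometry P Q : (1 < size P)%N -> size Q = size P ->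
  S_invariant S P -> S_invariant S Q -> exists l m : R[i],
  [/\ abs l = 1, P = l *: Q + m%:P & forall y, S (l * y + m) <-> S y].
Proof.
move=> sP sQP invP invQ; have [l [m [l0 PQ]]] := same_degree_affine sP sQP invP invQ.
have sQ : (1 < size Q)%N by rewrite sQP.
have inv y : S (l * y + m) <-> S y.
  have [z <-] := poly_surj y sQ.
  have -> : l * Q.[z] + m = P.[z] by rewrite PQ !hornerE.
  by rewrite invP invQ.
by exists l, m; split=> //; exact: affine_invariance_unit inv.
Qed.

(** An affine map [s] preserving [S] satisfies [f o s = s' o f] for another affine
    map [s'], by [same_degree_isometry]. So it permutes the critical points of
    [f], and its translation part is at most twice their largest modulus. *)
Lemma affine_invariance_bounded : exists M : R, forall l m : R[i], abs l = 1 ->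
  (forall y, S (l * y + m) <-> S y) -> abs m <= M.
Proof.
have sdf := size_deriv_gt1 hf; have sf := size_gt1 hf.
have [b hb] := poly_far 0 sdf.
have crit y : f^`().[y] = 0 -> abs y <= b.
  by move=> dfy; rewrite leNgt; apply/negP => /ltW/hb; rewrite dfy abs0 ltxx.
have [y0 dfy0] := poly_surj 0 sdf.
exists (b + b) => l m l1 inv; pose p := l *: 'X + m%:P.
have l0 : l != 0 by rewrite -abs_gt0 l1.
have sp : size p = 2%N.
  by rewrite size_polyDl size_scale ?size_polyX// (leq_ltn_trans (size_polyC_leq1 _)).
have invp : S_invariant S p by move=> z; rewrite !hornerE inv.
have [l' [m' [l'1 fp _]]] : exists l' m' : R[i], [/\ abs l' = 1,
    f \Po p = l' *: f + m'%:P & forall y, S (l' * y + m') <-> S y].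
  apply: same_degree_isometry => //; last exact: S_invariant_comp.
    by rewrite size_comp_poly2.
  by rewrite size_comp_poly2.
have dp : p^`() = l%:P.
  by rewrite /p derivD derivZ derivX derivC addr0 alg_polyC.
have := congr1 (fun q => (q^`()).[y0]) fp.
rewrite /= deriv_comp dp derivD derivZ derivC addr0 hornerM horner_comp hornerZ dfy0.
rewrite hornerC mulr0 => /eqP; rewrite mulf_eq0 (negPf l0) orbF => /eqP/crit.
rewrite !hornerE => h; have := absB m (- (l * y0)).
rewrite opprK absN absM l1 mul1r [m + _]addrC => h2.
by have := crit y0 dfy0; lra.
Qed.

(** [f^n o g] and [g o f^n] have the same degree, and both preserve [S]: they
    differ by an affine map [y |-> l_n y + m_n] with [|l_n| = 1] and [m_n]
    bounded. So the orbit of [g c] is bounded when that of [c] is. *)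
Lemma filled_sub_S_invariant (g : {poly R[i]}) : (2 <= (size g).-1)%N -> S_invariant S g ->
  filled f `<=` filled g.
Proof.
move=> hg invg; have sf := size_gt1 hf; have sg := size_gt1 hg.
have [M hM] := affine_invariance_bounded.
have [Bf Bf0 hBf] := filled_bounded hf.
have [Bg Bg0 hBg] := poly_bounded g Bf.
have gK c : filled f c -> filled f g.[c].
  move=> Kc; exists (Bg + M) => n.
  have sfn := size_poly_iter_gt1 n sf.
  have sc (p q : {poly R[i]}) : (1 < size p)%N -> (1 < size q)%N ->
      size (p \Po q) = ((size p).-1 * (size q).-1)%N.+1.
    move=> sp sq; rewrite -size_comp_poly prednK// size_poly_gt0 comp_poly_eq0//.
    by rewrite -size_poly_gt0 ltnW.
  have [||||l [m [l1 PQ inv]]] := @same_degree_isometry (poly_iter f n \Po g) (g \Po poly_iter f n).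
  - by rewrite sc// ltnS muln_gt0 !ltn_predRL sfn.
  - by rewrite !sc// mulnC.
  - apply: S_invariant_comp => //; exact: S_invariant_iter.
  - apply: S_invariant_comp => //; exact: S_invariant_iter.
  have := congr1 (fun q => q.[c]) PQ.
  rewrite /= horner_comp !hornerE horner_comp !horner_poly_iter => ->.
  rewrite (le_trans (absD _ _))// absM l1 mul1r lerD//; last exact: (hM l).
  by apply: hBg; exact: hBf.
move=> c Kc; exists Bf => n.
have : filled f (iter n (horner g) c) by elim: n => //= n ih; exact: gK.
exact: (hBf _ 0%N).
Qed.

End AffineRelations.

Lemma filled_sub_unbounded (R : realType) (f g : {poly R[i]}) (S : set R[i]) :
  (2 <= (size f).-1)%N -> (2 <= (size g).-1)%N ->
  (forall z, S f.[z] <-> S z) -> (forall z, S g.[z] <-> S z) ->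
  (forall w, ~ S w -> exists2 r : R, 0 < r & forall x, abs (x - w) < r -> ~ S x) ->
  (forall M : R, exists2 z, S z & M < abs z) ->
  (forall M : R, exists2 z, ~ S z & M < abs z) ->
  filled f `<=` filled g.
Proof.
move=> hf hg fS gS closedS unbS unbSC.
have [B B0 hB] := filled_bounded hf.
have filledB a : filled f a -> abs a <= B by move=> Ka; exact: (hB a 0%N).
have [C C0 hC] := green_approx hf.
have greenC z : `|ln (1 + abs z) - green f z| <= C.
  by have := hC z 0%N; rewrite expr0 mul1r.
have [tb _ baseB] := green_far hf (B + 1).
exact: (filled_sub_S_invariant hf fS closedS unbS unbSC filledB greenC baseB hg gS).
Qed.

(** * The spherical metric *)

Section SphericalMetricFacts.
Variable R : realType.
Implicit Types (z w : R[i]) (x y : sphere R).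

Lemma cauchy_abs z w : abs (z - w) ^+ 2 <= (1 + abs z ^+ 2) * (1 + abs w ^+ 2).
Proof.
rewrite !abs_sqr; case: z w => [a b] [c d] /=.
have : 0 <= (1 + (a * c + b * d)) ^+ 2 + (a * d - b * c) ^+ 2.
  by rewrite addr_ge0 ?sqr_ge0.
by lra.
Qed.

Let nrm_gt0 z : 0 < Num.sqrt (1 + abs z ^+ 2).
Proof. by rewrite sqrtr_gt0 ltr_pwDl// sqr_ge0. Qed.

Let nrm_ge1 z : 1 <= Num.sqrt (1 + abs z ^+ 2).
Proof. by rewrite -{1}sqrtr1 ler_wsqrtr// lerDl sqr_ge0. Qed.

Let nrm_le z : Num.sqrt (1 + abs z ^+ 2) <= 1 + abs z.
Proof.
rewrite -[leRHS]ger0_norm ?addr_ge0 ?abs_ge0// -sqrtr_sqr ler_wsqrtr//.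
by rewrite sqrrD expr1n mul1r addrAC lerDl mulrn_wge0// abs_ge0.
Qed.

Lemma chordal_ge0 x y : 0 <= chordal x y.
Proof.
case: x y => [z|] [w|] //=; rewrite divr_ge0 ?mulr_ge0 ?abs_ge0 ?sqrtr_ge0//.
Qed.

Lemma chordal_le2 x y : chordal x y <= 2.
Proof.
case: x y => [z|] [w|] //=; rewrite ler_pdivrMr ?mulr_gt0//; last 2 first.
- by rewrite ler_peMr.
- by rewrite ler_peMr.
rewrite ler_pM2l// -(@ler_pXn2r _ 2) ?nnegrE ?mulr_ge0 ?abs_ge0 ?sqrtr_ge0//.
rewrite exprMn !sqr_sqrtr ?cauchy_abs//; by rewrite addr_ge0 ?sqr_ge0.
Qed.

Lemma spherical_ge0 x y : 0 <= spherical x y.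
Proof.
have := spherical_triangle y x x; rewrite sphericalxx (spherical_sym y x).
lra.
Qed.

Lemma chordal_le_spherical x y : chordal x y <= spherical x y.
Proof.
have hs := spherical_ge0 x y; have hc := chordal_ge0 x y; have h2 := chordal_le2 x y.
have sinE : sin (spherical x y / 2) = chordal x y / 2.
  rewrite /spherical [2 * _]mulrC mulfK// asinK// in_itv /=.
  by apply/andP; split; lra.
have := mvt_lipschitz (@is_derive_sin R) (@cos_max R) (spherical x y / 2) 0.
rewrite sin0 !subr0 sinE.
have s0 : 0 <= spherical x y / 2 by rewrite divr_ge0.
by rewrite (ger0_norm s0) => /(le_trans (ler_norm _)); lra.
Qed.

Lemma spherical_small (e : R) : 0 < e ->
  exists2 d : R, 0 < d & forall x y, chordal x y < d -> spherical x y < e.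
Proof.
move=> e0; have a0 : asin (0 : R) = 0.
  rewrite -{1}(@sin0 R) sinK// in_itv /=; have := pi_gt0 R => p0.
  by apply/andP; split; lra.
have c0 : {for (0 : R), continuous (@asin R)}.
  by apply: continuous_asin; rewrite ltrN10 ltr01.
have e20 : 0 < e / 2 by rewrite divr_gt0.
have /cvgrPdist_lt/(_ _ e20)/nbhs_ballP[d /= d0 hd] := c0.
exists d => // x y xy.
have hc := chordal_ge0 x y.
have := hd (chordal x y / 2); rewrite /ball /= a0 !sub0r !normrN => h.
have {}h : `|asin (chordal x y / 2)| < e / 2.
  by apply: h; rewrite ger0_norm ?divr_ge0//; lra.
by rewrite /spherical; have := ler_norm (asin (chordal x y / 2)); lra.
Qed.

Lemma spherical_some_close (e : R) : 0 < e -> exists2 d : R, 0 < d &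
  forall z w, abs (z - w) < d -> spherical (Some z) (Some w) < e.
Proof.
move=> /spherical_small[d d0 hd]; exists (d / 2) => [|z w zw]; first by rewrite divr_gt0.
apply: hd; rewrite /= ltr_pdivrMr ?mulr_gt0//.
apply: (@lt_le_trans _ _ d); first by lra.
by rewrite ler_peMr ?(ltW d0)// mulr_ege1.
Qed.

Lemma spherical_none_close (e : R) : 0 < e -> exists M : R,
  forall z, M < abs z -> spherical None (Some z) < e.
Proof.
move=> /spherical_small[d d0 hd]; exists (2 / d) => z zM.
apply: hd; rewrite /= ltr_pdivrMr// -ltr_pdivrMl// mulrC (lt_le_trans zM)//.
rewrite -[leLHS]ger0_norm ?abs_ge0// -sqrtr_sqr ler_wsqrtr// lerDr//.
Qed.

Lemma spherical_none_far (M : R) z : abs z <= M -> 2 / (1 + M) <= spherical None (Some z).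
Proof.
move=> zM; rewrite (le_trans _ (chordal_le_spherical _ _))//=.
have M0 := le_trans (abs_ge0 z) zM.
rewrite ler_pM2l// lef_pV2 ?posrE ?ltr_pwDl// (le_trans (nrm_le z))//.
by rewrite lerD2l.
Qed.

Lemma ball_some (c : R[i]) (r : R) : 0 < r -> exists2 e : R, 0 < e &
  forall y, spherical (Some c) y < e -> exists2 z, y = Some z & abs (z - c) < r.
Proof.
move=> r0; pose A := 1 + abs c; have A1 : 1 <= A by rewrite lerDl abs_ge0.
have A0 : 0 < A by rewrite (lt_le_trans ltr01).
pose e := Num.min (1 / A) (r / A ^+ 2).
have e1 : e * A <= 1 by rewrite -ler_pdivlMr// ge_min lexx.
have er : e * A ^+ 2 <= r by rewrite -ler_pdivlMr ?exprn_gt0// ge_min lexx orbT.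
have e0 : 0 < e by rewrite lt_min !divr_gt0 ?exprn_gt0.
exists e => // y /(le_lt_trans (chordal_le_spherical _ _)).
case: y => [w|] /=; last first.
  rewrite ltr_pdivrMr// => h; have := nrm_le c; rewrite -/A => h2.
  have : e * Num.sqrt (1 + abs c ^+ 2) <= e * A by rewrite ler_pM2l.
  lra.
rewrite ltr_pdivrMr ?mulr_gt0// absC => h; exists w => //.
set D := abs (w - c) in h *.
have hw : Num.sqrt (1 + abs w ^+ 2) <= A + D.
  rewrite (le_trans (nrm_le w))// /A -addrA lerD2l addrC.
  by have := absD (w - c) c; rewrite subrK.
have D0 : 0 <= D by exact: abs_ge0.
have h2 : Num.sqrt (1 + abs c ^+ 2) * Num.sqrt (1 + abs w ^+ 2) <= A * (A + D).
  by rewrite ler_pM ?sqrtr_ge0// nrm_le.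
have h3 : e * (Num.sqrt (1 + abs c ^+ 2) * Num.sqrt (1 + abs w ^+ 2)) <= e * (A * (A + D)).
  by rewrite ler_pM2l.
have h4 : e * A * D <= 1 * D by rewrite ler_wpM2r.
have h5 : e * (A * (A + D)) = e * A ^+ 2 + e * A * D by ring.
lra.
Qed.

Lemma ball_none (M : R) : exists2 e : R, 0 < e & forall z,
  spherical None (Some z) < e -> M < abs z.
Proof.
exists (2 / (1 + `|M|)) => [|z]; first by rewrite divr_gt0// ltr_pwDl.
apply: contraPlt => zM; apply/negP; rewrite -leNgt spherical_none_far//.
by rewrite (le_trans zM)// ler_norm.
Qed.

Lemma openP (U : set (sphere R)) : open U <->
  forall x, U x -> exists2 e : R, 0 < e & forall y, spherical x y < e -> U y.
Proof.
rewrite openE; split=> [h x /h/nbhs_ballP[e /= e0 eU]|h x /h[e e0 eU]].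
  by exists e => // y xy; exact: eU.
by apply/nbhs_ballP; exists e => //= y xy; exact: eU.
Qed.

Lemma open_disc (c : R[i]) (r : R) :
  open [set x : sphere R | exists2 z, x = Some z & abs (z - c) < r].
Proof.
apply/openP => _ [z -> zr].
have [|e e0 he] := @ball_some z (r - abs (z - c)); first by rewrite subr_gt0.
exists e => // y /he[w -> wz]; exists w => //.
by have := abs_dist_tri z w c; lra.
Qed.

Definition outside (M : R) : set (sphere R) :=
  [set x | if x is Some z then M < abs z else True].

Lemma open_outside (M : R) : open (outside M).
Proof.
apply/openP => -[z zM|_].
  have [|e e0 he] := @ball_some z (abs z - M); first by rewrite subr_gt0.
  exists e => // y /he[w -> wz] /=; rewrite absC in wz.
  by have := absB z w; lra.
have [e e0 he] := ball_none M; exists e => // -[w /he //|//].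
Qed.

Lemma openI_plane (P : sphere R -> Prop) c : open [set x | P x] -> P (Some c) ->
  exists2 r : R, 0 < r & forall z, abs (z - c) < r -> P (Some z).
Proof.
move=> /openP/[apply][[e e0 he]].
have [r r0 hr] := spherical_some_close e0; exists r => // z zr.
by apply/he/hr; rewrite absC.
Qed.

End SphericalMetricFacts.

(** * Normality, and the Julia set as the boundary of the filled Julia set *)

Section Normality.
Variable R : realType.
Implicit Types (z w : R[i]) (x y : sphere R) (h : sphere R -> sphere R).

Lemma uniform_cvgP (K : set (sphere R)) (u : nat -> sphere R -> sphere R) h :
  {uniform K, u @ \oo --> h} <->
  forall e : R, 0 < e -> exists N, forall n, (N <= n)%N ->
    forall x, K x -> spherical (h x) (u n x) < e.
Proof.
split=> [cvg e e0|cvg P /uniform_nbhs[E [entE EP]]].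
  have [|N _ hN] := cvg [set g | forall y, K y -> spherical (h y) (g y) < e].
    apply/uniform_nbhs; exists [set xy | ball xy.1 e xy.2]; split.
      exact: (entourage_ball _ (PosNum e0)).
    by [].
  by exists N => n /hN.
move: entE; rewrite -entourage_from_ballE => -[e /= e0 eE].
have [N hN] := cvg e e0; exists N => // n /= Nn; apply: EP => y Ky.
by apply: eE; exact: (hN n Nn y Ky).
Qed.

(** Here the convergence is uniform on all of [U]: each application takes [U]
    small enough for that. *)
Lemma normal_on_cluster (U : set (sphere R)) (F : set (sphere R -> sphere R)) :
  (forall u : nat -> sphere R -> sphere R, (forall k, F (u k)) -> exists h,
    forall (e : R) K, 0 < e -> exists2 k, (K <= k)%N &
      forall x, U x -> spherical (h x) (u k x) < e) ->
  normal_on U F.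
Proof.
move=> cl u Fu; have [h hh] := cl u Fu.
have next (i K : nat) : exists k, (K < k)%N /\
    forall x, U x -> spherical (h x) (u k x) < i.+1%:R^-1.
  have [|k Kk hk] := hh (i.+1%:R^-1) K.+1; first by rewrite invr_gt0.
  by exists k.
have [g hg] := @choice _ _ (fun iK k => (iK.2 < k)%N /\
  forall x, U x -> spherical (h x) (u k x) < iK.1.+1%:R^-1) (fun iK => next iK.1 iK.2).
pose phi := fix phi i : nat := if i is j.+1 then g (i, phi j) else g (0, 0)%N.
exists phi; split.
  apply: homo_ltn; first exact: ltn_trans.
  by move=> i; have [] := hg (i.+1, phi i).
have phiP i x : U x -> spherical (h x) (u (phi i) x) < i.+1%:R^-1.
  by case: i => [|i]; [have [_] := hg (0, 0)%N; exact|have [_] := hg (i.+1, phi i); exact].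
exists h; apply/fam_cvgP => K [_ KU]; apply/uniform_cvgP => e e0.
have [N hN] := archi_mul 1 e0; exists N => n Nn x Kx /=.
rewrite (lt_le_trans (phiP n x (KU x Kx)))// -[leLHS]mul1r ler_pdivrMr//.
rewrite (le_trans (ltW hN))// mulrC ler_pM2l// ler_nat.
exact: leq_trans (leqnSn _).
Qed.

Lemma normal_on_uniform (U K : set (sphere R)) F (u : nat -> sphere R -> sphere R) :
  normal_on U F -> compact K -> K `<=` U -> (forall k, F (u k)) ->
  exists phi : nat -> nat, {homo phi : m n / (m < n)%N} /\ exists h,
    forall e : R, 0 < e -> exists N, forall n, (N <= n)%N ->
      forall x, K x -> spherical (h x) (u (phi n) x) < e.
Proof.
move=> nU cK KU Fu; have [phi [phi_incr [h cvg]]] := nU u Fu.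
exists phi; split=> //; exists h; apply/uniform_cvgP.
by move/fam_cvgP : cvg; apply.
Qed.

Lemma compact_square (c : R[i]) (r : R) :
  compact [set x : sphere R | exists a b : R,
    [/\ `|a| <= r, `|b| <= r & x = Some (c + (a +i* b)%C)]].
Proof.
have -> : [set x : sphere R | exists a b : R,
    [/\ `|a| <= r, `|b| <= r & x = Some (c + (a +i* b)%C)]] =
    [set (fun ab : R * R => Some (c + (ab.1 +i* ab.2)%C) : sphere R) ab |
      ab in `[- r, r] `*` `[- r, r]].
  apply/seteqP; split=> x.
    move=> [a [b [ar br ->]]]; exists (a, b) => //=.
    by rewrite /= !in_itv /= -!ler_norml.
  move=> [[a b]] /= []; rewrite /= !in_itv /= -!ler_norml => ar br <-.
  by exists a, b.
apply: continuous_compact; last exact: compact_setX (@segment_compact _ _ _) (@segment_compact _ _ _).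
apply: continuous_subspaceT => -[a b]; apply/cvg_ballP => e e0.
have [d d0 hd] := spherical_some_close e0.
have d20 : 0 < d / 2 by rewrite divr_gt0.
exists (ball a (d / 2), ball b (d / 2)) => /=.
  by split; exact: nbhsx_ballx.
move=> [a' b'] [/= aa' bb']; apply: hd; rewrite (_ : _ - _ = ((a - a') +i* (b - b'))%C).
  rewrite (le_lt_trans (abs_ReIm _))//=.
  by move: aa' bb'; rewrite /ball /= => aa' bb'; lra.
by apply/eqP; rewrite eq_complex /=; apply/andP; split; apply/eqP; case: (c) => ? ? /=; ring.
Qed.

End Normality.

Section PolynomialJulia.
Variable R : realType.
Implicit Types (x y z w c : R[i]).

(** Schwarz's lemma: apply the maximum principle to [(p - p y) / (X - y)]. *)
Lemma poly_schwarz (p : {poly R[i]}) y (r M : R) : 0 < r ->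
  (forall x, abs (x - y) <= r -> abs p.[x] <= M) ->
  forall x, abs (x - y) <= r -> abs (p.[x] - p.[y]) <= 2 * M / r * abs (x - y).
Proof.
move=> r0 pM x xr.
have : root (p - (p.[y])%:P) y by rewrite /root !hornerE subrr.
move=> /factor_theorem[q pq].
have qE z : p.[z] - p.[y] = q.[z] * (z - y).
  by have := congr1 (horner^~ z) pq; rewrite !hornerE.
have M0 : 0 <= M by rewrite (le_trans (abs_ge0 p.[x]))// pM.
have K0 : 0 <= 2 * M / r by rewrite divr_ge0 ?mulr_ge0// ltW.
have circle z : abs (z - y) = r -> abs q.[z] <= 2 * M / r.
  move=> zr; rewrite ler_pdivlMr// -[X in _ * X]zr -absM -qE.
  have h1 : abs p.[z] <= M by apply: pM; rewrite zr.
  have h2 : abs p.[y] <= M by apply: pM; rewrite subrr abs0 ltW.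
  by have := absBD p.[z] p.[y]; lra.
rewrite qE absM ler_wpM2r ?abs_ge0//.
have on_circle t w : w != 0 -> abs w = t -> abs (y + (r / t)%:C * w - y) = r.
  move=> w0 wt; have t0 : 0 < t by rewrite -wt abs_gt0.
  by rewrite addrAC subrr add0r abs_scale wt ger0_norm ?divfK ?divr_ge0 ?(ltW r0) ?(ltW t0)// gt_eqF.
have [sq|sq] := leqP (size q) 1.
  have qc t : q.[t] = q`_0 by rewrite {1}(size1_polyC sq) hornerC.
  rewrite qc.
  have := circle (y + (r / 1)%:C * 1) (on_circle 1 1 (oner_neq0 _) (abs1 _)).
  by rewrite qc.
apply: (@poly_max_principle R q [set z | abs (z - y) <= r]
   [set z | abs (z - y) = r] (abs y + r)) => //.
- by move=> z /= zr; have := absD (z - y) y; rewrite subrK; lra.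
move=> x0 rho /= x0r rho0 disj z zrho.
have [x0y|x0y] := eqVneq x0 y.
  have h : rho <= r.
    rewrite leNgt; apply/negP => rrho.
    have e := on_circle 1 1 (oner_neq0 _) (abs1 _).
    by apply: (disj _ _ e); rewrite x0y e.
  by rewrite -x0y ltW// (lt_le_trans zrho).
have w0 : x0 - y != 0 by rewrite subr_eq0.
have t0 : 0 < abs (x0 - y) by rewrite abs_gt0.
have e := on_circle (abs (x0 - y)) (x0 - y) w0 erefl.
have h : rho <= r - abs (x0 - y).
  rewrite leNgt; apply/negP => lt_rho; apply: (disj _ _ e).
  have -> : y + (r / abs (x0 - y))%:C * (x0 - y) - x0 =
      (r / abs (x0 - y) - 1)%:C * (x0 - y) by rewrite rmorphB rmorph1; ring.
  rewrite abs_scale ger0_norm; last by rewrite subr_ge0 ler_pdivlMr// mul1r.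
  by rewrite mulrBl divfK ?gt_eqF// mul1r.
by have := abs_dist_tri x0 z y; lra.
Qed.

Variable f : {poly R[i]}.
Hypothesis hf : (2 <= (size f).-1)%N.
Local Notation F n z := (iter n (horner f) z).

Lemma polymap_some (p : {poly R[i]}) z : polymap p (Some z) = Some p.[z].
Proof. by rewrite /polymap /ratmap hornerC oner_eq0 divr1. Qed.

Lemma polymap_none (p : {poly R[i]}) : (1 < size p)%N -> polymap p None = None.
Proof.
move=> sp; rewrite /polymap /ratmap size_poly1 (maxn_idPl _) ?(ltnW sp)//.
by rewrite coef1; case: (size p) sp => [|[|n]]//= _; rewrite eqxx.
Qed.

Lemma iter_polymap_some n z : iter n (polymap f) (Some z) = Some (F n z).
Proof. by elim: n => //= n ->; rewrite polymap_some. Qed.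

Lemma iter_polymap_none n : iter n (polymap f) None = None.
Proof. by elim: n => //= n ->; rewrite polymap_none// size_gt1. Qed.

(** In a sequence [f^(n_k)], either [n_k] is unbounded and the limit is infinity,
    or some value of [n_k] occurs infinitely often. *)
Lemma escaping_normal (U : set (sphere R)) :
  (forall M : R, exists n0, forall n, (n0 <= n)%N -> forall x : sphere R, U x ->
     outside M (iter n (polymap f) x)) ->
  normal_on U (iterates (polymap f)).
Proof.
move=> esc; apply: normal_on_cluster => u Fu.
have [ns hns] := @choice _ _ (fun k n => u k = iter n (polymap f))
   (fun k => let: ex_intro2 n _ e := Fu k in ex_intro _ n (esym e)).
have [unb|bnd] := pselect (forall N K, exists2 k, (K <= k)%N & (N <= ns k)%N).
  exists (fun=> None) => e K e0; have [M hM] := spherical_none_close e0.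
  have [n0 hn0] := esc M; have [k Kk nk] := unb n0 K; exists k => // x Ux.
  rewrite hns; have := hn0 _ nk x Ux.
  by case: (iter _ _ _) => [z /hM//|_]; rewrite sphericalxx.
have [N [K0 hN]] : exists N K0, forall k, (K0 <= k)%N -> (ns k < N)%N.
  move/existsNP: bnd => [N /existsNP[K0 h]]; exists N, K0 => k K0k.
  by rewrite ltnNge; apply/negP => Nk; apply: h; exists k.
have [v hv] : exists v, forall K, exists2 k, (K <= k)%N & ns k = v.
  apply: contrapT => /forallNP none.
  have {}none v : exists K, forall k, (K <= k)%N -> ns k <> v.
    have /existsNP[K h] := none v; exists K => k Kk nk; apply: h; exists k => //.
  have [K1 hK1] : exists K1, forall v, (v < N)%N -> forall k, (K1 <= k)%N -> ns k <> v.
    elim: N {hN} => [|N [K1 ih]]; first by exists 0%N.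
    have [K2 hK2] := none N; exists (maxn K1 K2) => v; rewrite ltnS leq_eqVlt => /orP[/eqP->|vN] k.
      by rewrite geq_max => /andP[_ /hK2].
    by rewrite geq_max => /andP[/(ih v vN)].
  have := hN (maxn K0 K1) (leq_maxl _ _).
  by move=> /hK1/(_ (maxn K0 K1) (leq_maxr _ _)).
exists (iter v (polymap f)) => e K e0; have [k Kk nk] := hv K; exists k => // x Ux.
by rewrite hns nk sphericalxx.
Qed.

Lemma escape_region : exists M0 : R, 0 < M0 /\ forall z n, M0 < abs z ->
  2 ^+ n * abs z <= abs (F n z).
Proof.
have sf := size_gt1 hf; have [b b1 hb] := poly_large sf.
have a0 : 0 < abs (lead_coef f) by rewrite abs_gt0 lead_coef_eq0 -size_poly_gt0 ltnW.
pose M0 := Num.max b (4 / abs (lead_coef f)).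
have M00 : 0 < M0 by rewrite lt_max (lt_le_trans ltr01 b1).
exists M0; split=> //.
have double z : M0 < abs z -> 2 * abs z <= abs f.[z].
  rewrite gt_max => /andP[/ltW bz]; rewrite ltr_pdivrMr// => /ltW az.
  have /andP[h _] := hb z bz; rewrite (le_trans _ h)//.
  have z1 : 1 <= abs z by rewrite (le_trans b1).
  have z2 : abs z ^+ 2 <= abs z ^+ (size f).-1 by rewrite ler_weXn2l.
  have : abs (lead_coef f) / 2 * abs z ^+ 2 <= abs (lead_coef f) / 2 * abs z ^+ (size f).-1.
    by rewrite ler_wpM2l// divr_ge0// ltW.
  apply: le_trans.
  have : 4 * abs z <= abs z * abs (lead_coef f) * abs z by rewrite ler_wpM2r ?abs_ge0.
  by lra.
move=> z n; elim: n z => [|n ih] z zM; first by rewrite mul1r.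
have h1 := double z zM; have z0 : 0 < abs z by rewrite (lt_trans M00).
have h2 := ih f.[z] ltac:(lra); rewrite iterSr (le_trans _ h2)//.
by rewrite exprSr -mulrA ler_pM2l// exprn_gt0.
Qed.

Lemma fatou_none : Defs.fatou (polymap f) None.
Proof.
have [M0 [M00 hM0]] := escape_region.
exists (outside M0); split; [exact: open_outside | by [] |].
apply: escaping_normal => M; have [n0 hn0] := archi_mul M M00.
exists n0 => n hn [z|_]; last by rewrite iter_polymap_none.
rewrite iter_polymap_some /= => zM; rewrite (lt_le_trans hn0)//.
rewrite (le_trans _ (hM0 z n zM))// ler_pM ?(ltW M00) ?(ltW zM)//.
by rewrite -natrX ler_nat (leq_trans hn)// ltnW// ltn_expl.
Qed.

Lemma fatou_escaping c : ~ filled f c -> Defs.fatou (polymap f) (Some c).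
Proof.
move=> /(green_gt0 hf) Gc; have [M0 [M00 hM0]] := escape_region.
have [m hm] := escaping_large hf (M0 + 1) Gc.
have [L L0 hL] := poly_lipschitz (poly_iter f m) (abs c + 1).
pose r := Num.min 1 (1 / L).
have r0 : 0 < r by rewrite lt_min ltr01 divr_gt0.
exists [set x : sphere R | exists2 z, x = Some z & abs (z - c) < r].
split; [exact: open_disc | by exists c => //; rewrite subrr abs0 |].
have far z : abs (z - c) < r -> M0 < abs (F m z).
  rewrite lt_min ltr_pdivlMr// => /andP[z1 zL].
  have zc : abs z <= abs c + 1 by have := absD (z - c) c; rewrite subrK; lra.
  have := hL z c zc; rewrite !horner_poly_iter lerDl ler01 => /(_ isT) h2.
  have h1 := hm m (leqnn m).
  by have := absB (F m c) (F m z); rewrite (absC (F m c)); lra.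
apply: escaping_normal => M; have [n0 hn0] := archi_mul M M00.
exists (n0 + m)%N => n hn _ [z -> zr].
rewrite iter_polymap_some -(subnK (leq_trans (leq_addl n0 m) hn)) iterD /=.
have h := hM0 _ (n - m)%N (far z zr).
rewrite (lt_le_trans hn0)// (le_trans _ h)// ler_pM ?(ltW M00) ?(ltW (far z zr))//.
rewrite -natrX ler_nat ltnW// (leq_ltn_trans _ (ltn_expl (n - m) (ltnSn 1)))//.
by rewrite leq_subRL ?(leq_trans (leq_addl n0 m) hn)// addnC.
Qed.

Lemma disc_net (c : R[i]) (r e : R) : 0 < e -> exists zs : seq R[i],
  forall z, abs (z - c) <= r -> exists2 w, w \in zs & abs (z - w) < e.
Proof.
move=> e0; pose d := e / 4; have d0 : 0 < d by rewrite divr_gt0.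
pose N := (Num.truncn (2 * `|r| / d)).+1.
pose pt (i j : nat) : R[i] := c + ((i%:R * d - `|r|) +i* (j%:R * d - `|r|))%C.
exists [seq pt i j | i <- iota 0 N, j <- iota 0 N] => z zr.
have grid (x : R) : `|x| <= `|r| -> exists2 i, (i < N)%N &
    `|x - (i%:R * d - `|r|)| <= d.
  rewrite ler_norml => /andP[x1 x2]; exists (Num.truncn ((x + `|r|) / d)).
    rewrite ltnS le_truncn// ler_pM2r ?invr_gt0//; lra.
  have x0 : 0 <= (x + `|r|) / d by rewrite divr_ge0 ?(ltW d0)//; lra.
  have /andP[] := truncn_itv x0; rewrite ler_pdivlMr// ltr_pdivrMr// -natr1 => h1 h2.
  by rewrite ler_norml; apply/andP; split; lra.
have r0 : 0 <= r by rewrite (le_trans (abs_ge0 (z - c))).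
have zr' : abs (z - c) <= `|r| by rewrite (ger0_norm r0).
have [i iN hi] := grid _ (le_trans (abs_Re (z - c)) zr').
have [j jN hj] := grid _ (le_trans (abs_Im (z - c)) zr').
exists (pt i j); first by apply: allpairs_f; rewrite mem_iota.
rewrite (le_lt_trans (abs_ReIm _))//.
have -> : z - pt i j = (z - c) - ((i%:R * d - `|r|) +i* (j%:R * d - `|r|))%C.
  by rewrite /pt opprD addrA.
move: hi hj; case: (z - c) => a b /= hi hj; rewrite /d in hi hj *; lra.
Qed.

(** The iterates are uniformly bounded, hence uniformly Lipschitz, on a disc in
    the filled Julia set. Their pointwise limits along an ultrafilter exist, and
    the convergence is uniform as it is so on the finite nets of the disc. *)
Lemma fatou_interior c (r : R) : 0 < r -> (forall z, abs (z - c) < r -> filled f z) ->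
  Defs.fatou (polymap f) (Some c).
Proof.
move=> r0 cK; have [B B0 hB] := filled_bounded hf.
pose r4 := r / 4; have r40 : 0 < r4 by rewrite divr_gt0.
pose L := 2 * B / r4; have L0 : 0 < L by rewrite divr_gt0// mulr_gt0.
have lip n y z : abs (y - c) <= 2 * r4 -> abs (z - y) <= r4 ->
    abs (F n z - F n y) <= L * abs (z - y).
  move=> yc zy; rewrite -!horner_poly_iter; apply: poly_schwarz => // x xy.
  rewrite horner_poly_iter; apply/hB/cK.
  by have := abs_dist_tri y x c; rewrite /r4 in yc xy *; lra.
exists [set x : sphere R | exists2 z, x = Some z & abs (z - c) < r4].
split; [exact: open_disc | by exists c => //; rewrite subrr abs0 |].
apply: normal_on_cluster => u Fu.
have [ns hns] := @choice _ _ (fun k n => u k = iter n (polymap f))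
   (fun k => let: ex_intro2 n _ e := Fu k in ex_intro _ n (esym e)).
have [G [ultraG ooG]] := ultraFilterLemma eventually_filter.
have pG : ProperFilter G by exact: ultra_proper.
have conv (v : nat -> R) : (forall k, `|v k| <= B) -> exists l : R,
    forall e : R, 0 < e -> G [set k | `|l - v k| < e].
  move=> vB; have pV : ProperFilter (v @ G) by exact: fmap_proper_filter.
  have [|l [_ clu]] := @segment_compact R (- B) B (v @ G) pV.
    apply: (@filterS _ G _ setT); last exact: filterT.
    by move=> k _; rewrite /= in_itv /= -ler_norml.
  exists l => e e0.
  have [//|nG] := in_ultra_setVsetC [set k | `|l - v k| < e] ultraG.
  have [|_ [/= [k nk <-] lk]] := clu [set v k | k in ~` [set k | `|l - v k| < e]] _ _ (nbhsx_ballx l e e0).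
    by apply: (@filterS nat G _ (~` [set k | `|l - v k| < e])) nG => k nk; exists k.
  by case: nk.
have Gnonempty P : G P -> exists k, P k by move=> /filter_ex.
have reim z k : abs (z - c) <= 2 * r4 ->
    `|complex.Re (F (ns k) z)| <= B /\ `|complex.Im (F (ns k) z)| <= B.
  move=> zc; have h : abs (F (ns k) z) <= B.
    by apply/hB/cK; rewrite /r4 in zc; lra.
  split; first exact: le_trans (abs_Re _) h.
  exact: le_trans (abs_Im _) h.
have [h hh] : exists h : R[i] -> R[i], forall z, abs (z - c) <= 2 * r4 ->
    forall e : R, 0 < e -> G [set k | abs (h z - F (ns k) z) < e].
  have [|h hh] := @choice R[i] R[i] (fun z l => abs (z - c) <= 2 * r4 ->
      forall e : R, 0 < e -> G [set k | abs (l - F (ns k) z) < e]); last by exists h.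
  move=> z; have [zc|zc] := pselect (abs (z - c) <= 2 * r4); last by exists 0.
  have [a ha] := conv (fun k => complex.Re (F (ns k) z)) (fun k => (reim z k zc).1).
  have [b hb] := conv (fun k => complex.Im (F (ns k) z)) (fun k => (reim z k zc).2).
  exists (a +i* b)%C => _ e e0; have e20 : 0 < e / 2 by rewrite divr_gt0.
  apply: filterS (filterI (ha _ e20) (hb _ e20)) => k /= [h1 h2].
  rewrite (le_lt_trans (abs_ReIm _))//; move: h1 h2; case: (F _ _) => x y /=; lra.
have hlip z w : abs (z - c) <= r4 -> abs (w - z) < r4 ->
    abs (h z - h w) <= L * abs (z - w).
  move=> zc wz; have wc : abs (w - c) <= 2 * r4.
    by have := abs_dist_tri z w c; lra.
  have zc2 : abs (z - c) <= 2 * r4 by lra.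
  rewrite leNgt; apply/negP => gt_h.
  pose e := (abs (h z - h w) - L * abs (z - w)) / 2.
  have e0 : 0 < e by rewrite divr_gt0// subr_gt0.
  have [k [h1 h2]] := Gnonempty _ (filterI (hh z zc2 e e0) (hh w wc e e0)).
  have h3 : abs (F (ns k) z - F (ns k) w) <= L * abs (z - w).
    by rewrite (absC (F _ z)) (absC z w); apply: lip => //; exact: ltW.
  move: h1 h2 => /=; rewrite (absC (h w)) => h1 h2.
  have := abs_dist_tri (F (ns k) z) (h z) (h w).
  have := abs_dist_tri (F (ns k) w) (F (ns k) z) (h w).
  by rewrite /e in h1 h2; lra.
exists (fun x : sphere R => if x is Some z then Some (h z) else None) => e K e0.
have [d d0 hd] := spherical_some_close e0.
have L8 : 0 < 8 * L by rewrite mulr_gt0.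
pose d' := Num.min (d / (8 * L)) r4.
have d'0 : 0 < d' by rewrite lt_min r40 divr_gt0.
have d'L : d' * (8 * L) <= d by rewrite -ler_pdivlMr// ge_min lexx.
have d'r : d' <= r4 by rewrite ge_min lexx orbT.
have [zs hzs] := disc_net c r4 d'0.
have netG : G [set k | forall w, w \in zs -> abs (w - c) <= 2 * r4 ->
    abs (h w - F (ns k) w) < d / 2].
  have d2 : 0 < d / 2 by rewrite divr_gt0.
  elim: zs {hzs} => [|a zs ih].
    by apply: (@filterS nat G _ setT) => [k _ w|]; [rewrite in_nil | exact: filterT].
  have [ac|ac] := pselect (abs (a - c) <= 2 * r4).
    apply: (@filterS nat G _ _ _ _ (filterI ih (hh a ac _ d2))) => k [h1 h2] w.
    by rewrite inE => /orP[/eqP->//|wzs]; exact: h1.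
  apply: (@filterS nat G _ _ _ _ ih) => k h1 w.
  by rewrite inE => /orP[/eqP->//|wzs]; exact: h1.
have tailG : G [set k | (K <= k)%N] by apply: ooG; exists K.
have [k [/= hk Kk]] := Gnonempty _ (filterI netG tailG).
exists k => // _ [z -> zc]; rewrite hns iter_polymap_some; apply: hd.
have [w wzs zw] := hzs z (ltW zc).
have wz : abs (w - z) < r4 by rewrite absC (lt_le_trans zw).
have wc : abs (w - c) <= 2 * r4 by have := abs_dist_tri z w c; lra.
have zc2 : abs (z - c) <= 2 * r4 by lra.
have h1 := hk w wzs wc; have h2 := hlip z w (ltW zc) wz.
have h3 := lip (ns k) z w zc2 (ltW wz).
have h4 : L * abs (z - w) <= d / 8.
  have : L * abs (z - w) <= L * d' by rewrite ler_pM2l// ltW.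
  lra.
rewrite (absC w) in h3.
have := abs_dist_tri (h w) (h z) (F (ns k) z).
have := abs_dist_tri (F (ns k) w) (h w) (F (ns k) z).
lra.
Qed.

(** At a boundary point of the filled Julia set a uniform limit would be finite
    at the point and infinite at escaping points close to it. *)
Lemma julia_boundary c : filled f c ->
  (forall r : R, 0 < r -> exists2 x, abs (x - c) < r & ~ filled f x) ->
  ~ Defs.fatou (polymap f) (Some c).
Proof.
move=> Kc bd [U [oU Uc nU]]; have [B B0 hB] := filled_bounded hf.
have [d d0 hd] := openI_plane oU Uc.
pose u k := iter k.+1 (polymap f).
have d40 : 0 < d / 4 by rewrite divr_gt0.
have [|k|phi [phi_incr [h hh]]] := @normal_on_uniform _ _ _ _ u nU (@compact_square R c (d / 4)).
- move=> _ [a [b [ha hb ->]]]; apply: hd.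
  rewrite addrAC subrr add0r (le_lt_trans (abs_ReIm _))//=; lra.
- by exists k.+1.
have phi_ge n : (n <= phi n)%N.
  elim: n => // n ih; exact: leq_ltn_trans ih (phi_incr n n.+1 (ltnSn n)).
(* Points of modulus at most [B + 1] are at distance at least [2 e] from infinity. *)
pose e := 1 / (1 + (B + 1)); have e0 : 0 < e by rewrite divr_gt0//; lra.
have [N hN] := hh e e0.
have [L L0 hL] := poly_lipschitz (poly_iter f (phi N).+1) (abs c + 1).
pose r := Num.min (d / 4) (Num.min 1 (1 / L)).
have r0 : 0 < r by rewrite !lt_min d40 ltr01 divr_gt0.
have [x xr Kx] := bd r r0.
move: xr; rewrite !lt_min => /and3P[xd x1]; rewrite ltr_pdivlMr// => xL.
have sq : exists a b : R, [/\ `|a| <= d / 4, `|b| <= d / 4 & Some x = Some (c + (a +i* b)%C)].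
  exists (complex.Re (x - c)), (complex.Im (x - c)); split.
  - by rewrite (le_trans (abs_Re _))// ltW.
  - by rewrite (le_trans (abs_Im _))// ltW.
  - by congr Some; rewrite -[LHS](subrKC c); congr (_ + _); case: (x - c).
have h_none (eta : R) : 0 < eta -> spherical None (h (Some x)) < 2 * eta.
  move=> eta0; have [N1 hN1] := hh eta eta0.
  have [M hM] := spherical_none_close eta0.
  have [n0 hn0] := escaping_large hf (M + 1) (green_gt0 hf Kx).
  pose n := maxn N1 n0.
  have h1 := hN1 n (leq_maxl _ _) _ sq.
  have h2 : spherical None (u (phi n) (Some x)) < eta.
    rewrite /u iter_polymap_some; apply: hM.
    have n0phi : (n0 <= (phi n).+1)%N.
      by rewrite (leq_trans (leq_maxr N1 n0))// (leq_trans (phi_ge n)).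
    by rewrite (lt_le_trans _ (hn0 _ n0phi))// ltrDl.
  have := spherical_triangle (u (phi n) (Some x)) None (h (Some x)).
  by rewrite (spherical_sym (u _ _) (h (Some x))); lra.
have h1 := hN N (leqnn N) _ sq.
have e20 : 0 < (2 * e - spherical (h (Some x)) (u (phi N) (Some x)) - e) / 2.
  by rewrite divr_gt0//; lra.
have h2 := h_none _ e20.
have h3 := spherical_triangle (h (Some x)) None (u (phi N) (Some x)).
have far : 2 / (1 + (B + 1)) <= spherical None (u (phi N) (Some x)).
  rewrite /u iter_polymap_some; apply: spherical_none_far.
  have xc : abs x <= abs c + 1 by have := absD (x - c) c; rewrite subrK; lra.
  have := hL x c xc; rewrite !horner_poly_iter lerDl ler01 => /(_ isT) h4.
  have := hB c (phi N).+1 Kc.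
  have := absD (F (phi N).+1 x - F (phi N).+1 c) (F (phi N).+1 c); rewrite subrK.
  by lra.
have e2 : 2 / (1 + (B + 1)) = 2 * e by rewrite /e; ring.
by rewrite e2 in far; lra.
Qed.

Lemma juliaP (x : sphere R) : julia (polymap f) x <-> exists c, [/\ x = Some c, filled f c &
  forall r : R, 0 < r -> exists2 z, abs (z - c) < r & ~ filled f z].
Proof.
split=> [|[c [-> Kc bd]]]; last exact: julia_boundary.
case: x => [c|] nF; last by case: nF; exact: fatou_none.
have Kc : filled f c by apply: contrapT => /fatou_escaping.
exists c; split=> // r r0; apply: contrapT => none; apply: nF.
apply: (@fatou_interior c r) => // z zr; apply: contrapT => Kz.
by apply: none; exists z.
Qed.

End PolynomialJulia.

(** * Invariant sets of the sphere *)

Section InvariantSets.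
Variable R : realType.
Implicit Types (z w : R[i]).

Lemma julia_eq_filled (f g : {poly R[i]}) : (2 <= (size f).-1)%N ->
  (2 <= (size g).-1)%N -> filled f = filled g -> julia (polymap f) = julia (polymap g).
Proof.
move=> hf hg fg; apply/seteqP; split=> x.
  by move=> /(juliaP hf)[c]; rewrite fg => h; apply/(juliaP hg); exists c.
by move=> /(juliaP hg)[c]; rewrite -fg => h; apply/(juliaP hf); exists c.
Qed.

Lemma two_finite_points (S : set (sphere R)) : (`I_3 #<= S)%card ->
  exists t1 t2 : R[i], [/\ S (Some t1), S (Some t2) & t1 != t2].
Proof.
move=> S3; apply: contrapT => none.
have uniq t1 t2 : S (Some t1) -> S (Some t2) -> t1 = t2.
  by move=> S1 S2; apply/eqP/negPn/negP => t12; apply: none; exists t1, t2.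
have [a Sa] : exists a, forall t, S (Some t) -> t = a.
  have [[a Sa]|nS] := pselect (exists a, S (Some a)).
    by exists a => t St; exact: uniq.
  by exists 0 => t St; case: nS; exists t.
pose pts (i : nat) : sphere R := if i is 0 then None else Some a.
have sub : S `<=` pts @` `I_2.
  by move=> [t /Sa ->|_]; [exists 1%N | exists 0%N].
have := card_le_trans S3 (card_le_trans (subset_card_le sub) (card_image_le pts `I_2)).
by rewrite card_le_II.
Qed.

(** The plane trace [T] of [S] and its complement are both preserved by [f] and
    [g]. If one of them is bounded it controls the orbits of [g] on the filled
    Julia set of [f]; otherwise [filled_sub_unbounded] applies. *)
Lemma filled_sub_invariant (f g : {poly R[i]}) (S : set (sphere R)) y0 :
  (2 <= (size f).-1)%N -> (2 <= (size g).-1)%N -> closed S ->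
  completely_invariant (polymap f) S -> completely_invariant (polymap g) S ->
  (`I_3 #<= S)%card -> ~ S y0 -> filled f `<=` filled g.
Proof.
move=> hf hg clS [f1 f2] [g1 g2] S3 nS.
pose T := [set z | S (Some z)].
have fT z : T f.[z] <-> T z.
  rewrite /T /= -polymap_some; split; first exact: f2.
  by move=> Sz; apply: f1; exists (Some z).
have gT z : T g.[z] <-> T z.
  rewrite /T /= -polymap_some; split; first exact: g2.
  by move=> Sz; apply: g1; exists (Some z).
have openSC : open (~` S) := closed_openC clS.
have closedT w : ~ T w -> exists2 r : R, 0 < r & forall x, abs (x - w) < r -> ~ T x.
  exact: (openI_plane openSC).
have [w Tw] : exists w, ~ T w.
  case: y0 nS => [w|] nS; first by exists w.
  have /openP/(_ _ nS)[e e0 he] := openSC.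
  have [M hM] := spherical_none_close e0.
  exists (`|M| + 1)%:C; apply/he/hM; rewrite abs_real.
  by rewrite ger0_norm ?addr_ge0//; have := ler_norm M; lra.
have [r r0 hr] := closedT w Tw.
have [t1 [t2 [T1 T2 t12]]] := two_finite_points S3.
have [[M TM]|unb] := pselect (exists M : R, forall z, T z -> abs z <= M).
  apply: (filled_sub_bounded hf hg _ _ T1 T2 t12 TM) => z; first by move=> /fT.
  by move=> /gT.
have [[M TM]|unbC] := pselect (exists M : R, forall z, ~ T z -> abs z <= M).
  have Tw' : ~ T (w + (r / 2)%:C).
    by apply: hr; rewrite addrAC subrr add0r abs_real gtr0_norm ?divr_gt0//; lra.
  have ww' : w != w + (r / 2)%:C.
    by rewrite -subr_eq0 opprD addrA subrr add0r oppr_eq0 real_complex_neq0// divr_gt0.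
  apply: (@filled_sub_bounded R f g (~` T) w (w + (r / 2)%:C) M) => //.
    by move=> z nT /fT.
  by move=> z nT /gT.
have unbounded (P : set R[i]) : ~ (exists M : R, forall z, P z -> abs z <= M) ->
    forall M : R, exists2 z, P z & M < abs z.
  move=> nP M; apply: contrapT => none; apply: nP; exists M => z Pz.
  by rewrite leNgt; apply/negP => Mz; apply: none; exists z.
exact: (filled_sub_unbounded hf hg fT gT closedT (unbounded T unb) (unbounded (~` T) unbC)).
Qed.

End InvariantSets.

Theorem theorem2 (R : realType) (G' : set (sphere R -> sphere R))
    (f g : {poly R[i]}) (hG : rational_semigroup G')
    (hf : (2 <= (size f).-1)%N) (hg : (2 <= (size g).-1)%N)
    (hfG : G' (polymap f)) (hgG : G' (polymap g))
    (hJ : julia (polymap f) <> julia (polymap g)) :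
  E_set G' = [set: sphere R].
Proof.
apply/seteqP; split=> // x _ S [clS invS S3]; apply: contrapT => Sx; apply: hJ.
have invf := invS _ hfG; have invg := invS _ hgG.
apply: julia_eq_filled => //; apply/seteqP; split.
  exact: (filled_sub_invariant hf hg clS invf invg S3 Sx).
exact: (filled_sub_invariant hg hf clS invg invf S3 Sx).
Qed.
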